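(* Let $\Omega, a, b, c, g, \theta$ be as specified in the context, with $\theta\ge0$, $b\ge 0$ and $c\le 0$ a.e. in $\Omega$. Define $\Psi_0\in H^1(\Omega)$ as the weak solution of $$-\nabla\cdot a\nabla\Psi_0+b\Psi_0=0\ \text{ in }\Omega,\qquad \Psi_0=g^{\frac{2}{1+\theta}}\ \text{ on }\partial\Omega,$$ and set $\kappa_0:=\min_{\mathbf{x}\in\Omega}g(\mathbf{x})^{\frac{2}{1+\theta}}$. For $n\ge1$, set $\nu_n:=-\theta\,\kappa_{n-1}^{-(1+\theta)}$, define $\Psi_n\in H^1(\Omega)$ as the weak solution of the linear problem $$-\nabla\cdot a\nabla\Psi_n+(b+c\nu_n)\Psi_n=-c\left(\Psi_{n-1}^{-\theta}-\nu_n\Psi_{n-1}\right)\ \text{ in }\Omega,\qquad \Psi_n=g^{\frac{2}{1+\theta}}\ \text{ on }\partial\Omega ,$$ and then set $\kappa_n:=\min_{\mathbf{x}\in\Omega}\Psi_n(\mathbf{x})$. Then the sequence $\{\Psi_n\}_{n\ge0}$ converges to the unique positive weak solution $\Psi$ of $$\nabla\cdot a\nabla\Psi = b\,\Psi + c\,|\Psi|^{-(1+\theta)}\Psi \ \text{ in }\Omega,\qquad \Psi = g^{\frac{2}{1+\theta}}\ \text{ on }\partial\Omega .$$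
   Context: Setting: $d\in\{2,3\}$; $\Omega\subset\mathbb{R}^d$ is a bounded, simply connected domain with $C^2$ boundary. $K_0,K_1$ are positive constants. $a\in C^{0,1}(\overline\Omega)$ (a diffusion coefficient), $\sigma_{x,a}\in L^\infty(\Omega)$ and $g\in C^1(\overline\Omega)$ (whose restriction to $\partial\Omega$ gives the boundary datum) satisfy $K_0<a,\sigma_{x,a},g<K_1$. $\theta\in\mathbb{R}\setminus\{-1\}$ and $\mu\in\mathbb{R}$ are constants, $b:=-\frac{2}{1+\theta}\mu\,\sigma_{x,a}$, and $c\in L^\infty(\Omega)$ is real-valued. Minima over $\Omega$ are understood as (essential) infima. Positive weak solution of the semilinear problem: $\Psi\in H^1(\Omega)$ with $\Psi>0$ a.e. in $\Omega$ and trace $g^{2/(1+\theta)}$ such that, for every $\phi\in H^1_0(\Omega)$, $(b\Psi+c\Psi^{-\theta})\phi$ is integrable and $\int_\Omega a\nabla\Psi\cdot\nabla\phi\,d\mathbf{x} = -\int_\Omega (b\Psi+c\Psi^{-\theta})\phi\,d\mathbf{x}$. *)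

(* Defs.v *)
From HB Require Import structures.
From mathcomp Require Import all_boot all_order all_algebra.
From mathcomp Require Import all_classical all_reals all_analysis ess_sup_inf.
Set Implicit Arguments.
Unset Strict Implicit.
Unset Printing Implicit Defensive.
Import Order.TTheory GRing.Theory Num.Theory.
Import numFieldNormedType.Exports.
Local Open Scope classical_set_scope.
Local Open Scope ring_scope.

(** [R^n] is ['rV[R]_n], with the sigma-algebra generated by the coordinates
    (the Borel sets).  [lebesgue_rV] is the [n]-fold product of
    [lebesgue_measure], transported along [(x, y) |-> row_mx x y]. *)

Definition measure_rV_display : measure_display.
Proof. exact. Qed.

Section measurable_rV.
Variables (R : realType) (n : nat).

Definition coord_rV (i : 'I_n) (x : 'rV[R]_n) : measurableTypeR R := x 0 i.

Let rV_set0 : g_sigma_preimage coord_rV set0.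
Proof. exact: sigma_algebra0. Qed.

Let rV_setC A : g_sigma_preimage coord_rV A -> g_sigma_preimage coord_rV (~` A).
Proof. exact: sigma_algebraC. Qed.

Let rV_bigcup (F : _^nat) : (forall i, g_sigma_preimage coord_rV (F i)) ->
  g_sigma_preimage coord_rV (\bigcup_i (F i)).
Proof. exact: sigma_algebra_bigcup. Qed.

HB.instance Definition _ := @isMeasurable.Build measure_rV_display
  'rV[R]_n (g_sigma_preimage coord_rV) rV_set0 rV_setC rV_bigcup.

End measurable_rV.

Section lebesgue_rV.
Variable R : realType.

Definition cons_rV n (p : measurableTypeR R * 'rV[R]_n) : 'rV[R]_n.+1 :=
  row_mx (const_mx p.1 : 'rV[R]_1) p.2.

Lemma measurable_coord_rV n (i : 'I_n) :
  measurable_fun [set: 'rV[R]_n] (@coord_rV R n i).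
Proof.
move=> _ Y mY; rewrite setTI; apply: sub_sigma_algebra => /=.
rewrite -bigcup_seq/=; exists i => /=; first by rewrite mem_index_enum.
by exists Y => //; rewrite setTI.
Qed.

Lemma measurable_fun_rVP d (T : measurableType d) n (f : T -> 'rV[R]_n) :
  (forall i, measurable_fun setT (fun t => coord_rV i (f t))) ->
  measurable_fun setT f.
Proof.
move=> mf _ A mA; rewrite setTI.
pose S : set (set 'rV[R]_n) := [set B | measurable (f @^-1` B)].
suff : g_sigma_preimage (@coord_rV R n) `<=` S by exact.
apply: smallest_sub.
  split => [|B mB|F mF].
  - by rewrite /S/= preimage_set0; exact: measurable0.
  - by rewrite /S/= setTD preimage_setC; exact: measurableC.
  - by rewrite /S/= preimage_bigcup; exact: bigcupT_measurable.
rewrite -bigcup_seq => B [i _ [C mC <-]]; rewrite /S/= setTI.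
by have := mf i measurableT C mC; rewrite setTI.
Qed.

Lemma measurable_cons_rV n : measurable_fun setT (@cons_rV n).
Proof.
apply: measurable_fun_rVP => i.
have [j ->|j ->] := split_ordP (i : 'I_(1 + n)).
  rewrite (_ : (fun _ => _) = fst); first exact: measurable_fst.
  apply/funext => -[x y].
  by transitivity ((const_mx x : 'rV[R]_1) 0 j); [exact: row_mxEl|rewrite mxE].
rewrite (_ : (fun _ => _) = @coord_rV R n j \o snd).
  by apply: measurableT_comp; [exact: measurable_coord_rV|exact: measurable_snd].
by apply/funext => -[x y]; exact: row_mxEr.
Qed.

Section step.
Variables (n : nat) (m : {sigma_finite_measure set 'rV[R]_n -> \bar R}).

Definition lebesgue_rV_step : set 'rV[R]_n.+1 -> \bar R :=
  pushforward (lebesgue_measure \x m)%E (@cons_rV n).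

Let step0 : lebesgue_rV_step set0 = 0%E.
Proof. by rewrite /lebesgue_rV_step /pushforward preimage_set0 measure0. Qed.

Let step_ge0 A : (0 <= lebesgue_rV_step A)%E.
Proof. by rewrite /lebesgue_rV_step /pushforward; exact: measure_ge0. Qed.

Let step_sigma_additive : semi_sigma_additive lebesgue_rV_step.
Proof.
have mc B : measurable B -> measurable (@cons_rV n @^-1` B).
  by move=> mB; rewrite -[X in measurable X]setTI; exact: measurable_cons_rV.
move=> F mF tF mUF; rewrite /lebesgue_rV_step /pushforward preimage_bigcup.
apply: measure_semi_sigma_additive.
- by move=> k; exact: mc.
- apply/trivIsetP => /= i j _ _ ij; rewrite -preimage_setI.
  by move/trivIsetP : tF => /(_ _ _ _ _ ij) ->//; rewrite preimage_set0.
- by rewrite -preimage_bigcup; exact: mc.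
Qed.

HB.instance Definition _ := isMeasure.Build _ _ _ lebesgue_rV_step
  step0 step_ge0 step_sigma_additive.

Let step_sigma_finite : sigma_finite setT lebesgue_rV_step.
Proof.
have [F TF Foo] : sigma_finite setT (@lebesgue_measure R \x m)%E.
  have /sigma_finiteP[F [TF ndF Foo]] := sigma_finiteT (@lebesgue_measure R).
  have /sigma_finiteP[G [TG ndG Goo]] := sigma_finiteT m.
  exists (fun k => F k `*` G k).
    rewrite -setXTT TF TG predeqE => -[x y]; split.
      move=> [/= [i _ Fix] [k _ Gky]]; exists (maxn i k) => //; split.
      - by move: x Fix; exact/subsetPset/ndF/leq_maxl.
      - by move: y Gky; exact/subsetPset/ndG/leq_maxr.
    by move=> [k _ []/= ? ?]; split; exists k.
  move=> k; have [? ?] := Foo k; have [? ?] := Goo k.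
  split; first exact: measurableX.
  by rewrite product_measure1E// lte_mul_pinfty// ge0_fin_numE.
pose u (x : 'rV[R]_n.+1) : measurableTypeR R * 'rV[R]_n :=
  ((lsubmx (x : 'rV_(1 + n))) 0 0, rsubmx (x : 'rV_(1 + n))).
have uK : cancel (@cons_rV n) u.
  move=> [x y]; rewrite /u /cons_rV/= row_mxKl row_mxKr.
  by rewrite mxE.
have mu : measurable_fun setT u.
  apply/measurable_fun_pairP; split.
    rewrite (_ : _ \o _ = @coord_rV R n.+1 (lshift n (0 : 'I_1))).
      exact: measurable_coord_rV.
    by apply/funext => x; rewrite /u /coord_rV/= mxE.
  apply: measurable_fun_rVP => i.
  rewrite (_ : (fun _ => _) = @coord_rV R n.+1 (rshift 1 i)).
    exact: measurable_coord_rV.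
  by apply/funext => x; rewrite /u /coord_rV/= mxE.
exists (fun k => u @^-1` F k).
  by rewrite -preimage_bigcup -TF preimage_setT.
move=> k; have [mF Fk] := Foo k; split.
  by rewrite -[X in measurable X]setTI; exact: mu.
rewrite /lebesgue_rV_step /pushforward -comp_preimage.
by rewrite (_ : u \o _ = id)//; apply/funext => p /=; rewrite uK.
Qed.

HB.instance Definition _ := Measure_isSigmaFinite.Build _ _ _ lebesgue_rV_step
  step_sigma_finite.

End step.

Fixpoint lebesgue_rV n : {sigma_finite_measure set 'rV[R]_n -> \bar R} :=
  match n with
  | 0 => dirac (0 : 'rV[R]_0)
  | n'.+1 => lebesgue_rV_step (lebesgue_rV n')
  end.

End lebesgue_rV.

Section classical.
Variables (R : realType) (d : nat).
Implicit Types (f phi : 'rV[R]_d -> R) (Omega : set 'rV[R]_d).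

Definition pderiv (i : 'I_d) f : 'rV[R]_d -> R :=
  fun x => 'D_(delta_mx 0 i) f x.

Fixpoint Ck (k : nat) f : Prop :=
  match k with
  | 0 => continuous f
  | k'.+1 => continuous f /\ forall i,
      (forall x, derivable f x (delta_mx 0 i)) /\ Ck k' (pderiv i f)
  end.

(* [C^1(closure Omega)]: [C^1] in [Omega], and the function and its first
   partial derivatives extend continuously up to the boundary. *)
Definition C1_closure Omega f : Prop :=
  {within closure Omega, continuous f} /\
  forall i, exists h : 'rV[R]_d -> R,
    {within closure Omega, continuous h} /\
    forall x, Omega x -> is_derive x (delta_mx 0 i) f (h x).

Definition test_fun Omega phi : Prop :=
  Ck 1 phi /\
  let supp := closure [set x | phi x != 0] in compact supp /\ supp `<=` Omega.

(* Every loop [g] in [A] contracts to a point through loops based at [g 0]. *)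
Definition simply_connected (A : set 'rV[R]_d) : Prop :=
  connected A /\
  forall g : R -> 'rV[R]_d,
    {within `[0, 1], continuous g} -> g @` `[0, 1] `<=` A -> g 0 = g 1 ->
    exists H : R * R -> 'rV[R]_d,
      [/\ {within `[0, 1] `*` `[0, 1], continuous H},
          H @` (`[0, 1] `*` `[0, 1]) `<=` A,
          forall s, s \in `[0, 1] -> H (s, 0) = g s,
          forall s, s \in `[0, 1] -> H (s, 1) = g 0 &
          forall t, t \in `[0, 1] -> H (0, t) = g 0 /\ H (1, t) = g 0].

End classical.

(* Near each boundary point, up to the choice of a coordinate axis [i] and of
   its orientation [s], the set is the strict epigraph of a [C^2] function of
   the other coordinates [col' i x].  Balls are taken for the maximum norm. *)
Definition C2_boundary (R : realType) (d : nat) (Omega : set 'rV[R]_d) : Prop :=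
  forall x0, (closure Omega `\` interior Omega) x0 ->
  exists (r : R) (i : 'I_d) (s : bool) (gamma : 'rV[R]_d.-1 -> R),
    [/\ 0 < r, Ck 2 gamma &
        forall x, ball x0 r x ->
          (Omega x <-> gamma (col' i x) < (-1) ^+ s * x 0 i)].

(** Weak derivatives are tested against [C^1_0(Omega)], and [H^1_0(Omega)] is
    the closure of [C^1_0(Omega)], as in Gilbarg and Trudinger, Elliptic
    Partial Differential Equations of Second Order, sections 7.3 and 7.5.
    Functions on [Omega] are total functions of which only the restriction to
    [Omega], up to a null set, matters. *)

Section sobolev.
Variables (R : realType) (d : nat) (Omega : set 'rV[R]_d).
Local Notation mu := (@lebesgue_rV R d).
Implicit Types (u v : 'rV[R]_d -> R) (g : 'I_d -> 'rV[R]_d -> R).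

Definition ae_on (P : 'rV[R]_d -> Prop) : Prop :=
  {ae mu, forall x, Omega x -> P x}.

Definition Linfty u : Prop :=
  measurable_fun Omega u /\ exists M : R, ae_on (fun x => `|u x| <= M).

Definition L2 u : Prop :=
  measurable_fun Omega u /\ mu.-integrable Omega (fun x => (u x ^+ 2)%:E).

Definition is_wgrad u g : Prop :=
  forall i, L2 (g i) /\ forall phi, test_fun Omega phi ->
    \int[mu]_(x in Omega) (u x * pderiv i phi x) =
    - \int[mu]_(x in Omega) (g i x * phi x).

Definition H1 u : Prop := L2 u /\ exists g, is_wgrad u g.

(* The weak gradient, unique up to a null set; meaningful when [H1 u]. *)
Definition wgrad u : 'I_d -> 'rV[R]_d -> R := get (is_wgrad u).

Definition H1norm u : R :=
  Num.sqrt (\int[mu]_(x in Omega) (u x ^+ 2) +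
            \sum_(i < d) \int[mu]_(x in Omega) (wgrad u i x ^+ 2)).

Definition H1_cvg (u_ : nat -> 'rV[R]_d -> R) u : Prop :=
  H1norm (fun x => u_ n x - u x) @[n --> \oo] --> (0 : R).

Definition H10 u : Prop :=
  H1 u /\ exists phi_ : nat -> 'rV[R]_d -> R,
    (forall n, test_fun Omega (phi_ n)) /\ H1_cvg phi_ u.

(* For [u], [G] in [H^1(Omega)]: the trace of [u - G] vanishes.  When [G] is
   [C^1] up to the boundary, the trace of [G] is its restriction. *)
Definition same_trace u G : Prop := H10 (fun x => u x - G x).

Definition essinf u : R :=
  fine (ess_inf mu (patch (fun=> +oo%E) Omega (EFin \o u))).

End sobolev.

Section equations.
Variables (R : realType) (d : nat) (Omega : set 'rV[R]_d).
Local Notation mu := (@lebesgue_rV R d).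
Implicit Types (a b c q f G u : 'rV[R]_d -> R) (theta : R).

Definition dirichlet_form a u v : R :=
  \int[mu]_(x in Omega)
    (a x * \sum_(i < d) wgrad Omega u i x * wgrad Omega v i x).

(* [- div (a grad u) + q u = f] in [Omega], [u = G] on the boundary *)
Definition weak_sol_linear a q f G u : Prop :=
  [/\ H1 Omega u, same_trace Omega u G &
      forall phi, H10 Omega phi ->
        [/\ mu.-integrable Omega (fun x => (q x * u x * phi x)%:E),
            mu.-integrable Omega (fun x => (f x * phi x)%:E) &
            dirichlet_form a u phi + \int[mu]_(x in Omega) (q x * u x * phi x)
            = \int[mu]_(x in Omega) (f x * phi x)]].

(* [div (a grad u) = b u + c |u|^-(1+theta) u] in [Omega], [u = G] on the
   boundary, [u > 0]; note that [|u|^-(1+theta) u = u^-theta] when [u > 0]. *)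
Definition pos_weak_sol a b c theta G u : Prop :=
  [/\ H1 Omega u, ae_on Omega (fun x => 0 < u x), same_trace Omega u G &
      forall phi, H10 Omega phi ->
        let F x := (b x * u x + c x * u x `^ (- theta)) * phi x in
        mu.-integrable Omega (fun x => (F x)%:E) /\
        dirichlet_form a u phi = - \int[mu]_(x in Omega) (F x)].

(* [kappa 0] is the infimum of the boundary datum [G], not of [Psi 0]. *)
Definition kappa G (Psi : nat -> 'rV[R]_d -> R) (n : nat) : R :=
  if n is 0 then essinf Omega G else essinf Omega (Psi n).

Definition iteration a b c theta G (Psi : nat -> 'rV[R]_d -> R) : Prop :=
  weak_sol_linear a b (fun=> 0) G (Psi 0%N) /\
  forall n,
    let nu := - theta * kappa G Psi n `^ (- (1 + theta)) in
    weak_sol_linear a (fun x => b x + c x * nu)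
      (fun x => - c x * (Psi n x `^ (- theta) - nu * Psi n x))
      G (Psi n.+1).

End equations.

(* Main.v *)
(** Write [gamma = - c >= 0] and [k_n = - nu_n], so that [Psi_(n+1)] solves
    [- div (a grad u) + (b + gamma k_n) u = gamma (Psi_n^-theta + k_n Psi_n)].
    A barrier [delta exp (lambda x_i)] bounds [Psi_0] below by a positive
    constant, and comparison gives [Psi_0 <= Psi_n <= V] for all [n].  The
    choice of [k_n] makes [t^-theta + k_n t] nondecreasing at [Psi_n] for
    [n >= 1] only: as [Psi_0] may fall below [kappa_0], the sequence need not be
    monotone.  However, by the tangent inequality for [t^-theta], the negative
    part of [Psi_(n+2) - Psi_(n+1)] is at most [z_n], where
    [- div (a grad z_n) + (b + gamma k_(n+1)) z_n = gamma k_n z_(n-1)], and the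
    energy estimate with Poincare's inequality makes [z_n] decay geometrically in
    [L2].  Hence [Psi_(n+1) + sum_(i < n) z_i] is nondecreasing and bounded in
    [L2], [Psi_n] converges in [L2], and its limit, bounded away from [0], solves
    the semilinear problem.  The [H^1] convergence then follows from the energy
    estimate for [Psi_n - Psi], and uniqueness from the monotonicity of
    [t^-theta]. *)

Require Import Defs.
From mathcomp Require Import all_boot all_order all_algebra.
From mathcomp Require Import all_classical all_reals all_analysis.
From mathcomp Require Import measurable_realfun ess_sup_inf.
From mathcomp Require Import ring lra.
Import Order.TTheory GRing.Theory Num.Theory.
Import numFieldNormedType.Exports.
Local Open Scope classical_set_scope.
Local Open Scope ring_scope.

Set Implicit Arguments.
Unset Strict Implicit.
Unset Printing Implicit Defensive.

(** * Square-integrable functions *)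

(** The obstacle is the first step: [kappa 0] comes from the datum, so nothing compares $k_0$ with
    the slope of $t^{-\theta}$ at $\Psi_0$, and each later step passes the resulting error on. Its
    decay is not visible in the plain $L^2$ norm, because the potential $b + \gamma k_n$ changes
    with $n$ and $\gamma$ may vanish. The quantity that contracts is $k_{n+1}^2 \int \gamma z_n^2$:
    the source of $z_n$ carries $k_n$, which is also the weight in the potential of $z_{n-1}$, so
    the weights chain up, and Poincare's inequality adds a fixed $\delta > 0$ to $k_{n+1}$ on the
    left. Hence a ratio $k/(\delta + k)$, squared, which stays away from 1 because the common lower
    bound of the iterates bounds the $k_n$. The same lower bound makes $t^{-\theta}$ Lipschitz on
    the range of the iterates, which is what allows the passage to the limit in the nonlinear term.
    All comparisons rest on a weak maximum principle. Test functions are only $C^1$, so the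
    truncation used there must itself be $C^1$ to send test functions to test functions, which
    excludes the negative part itself. *)

Section square_integrable.
Context d (T : measurableType d) (R : realType).
Variables (mu : {measure set T -> \bar R}) (D : set T) (mD : measurable D).
Implicit Types (u v w q : T -> R).

Definition ae_in (P : T -> Prop) : Prop := {ae mu, forall x, D x -> P x}.

Lemma ae_in_imply (P Q : T -> Prop) :
  (forall x, D x -> P x -> Q x) -> ae_in P -> ae_in Q.
Proof. by rewrite /ae_in => PQ; apply: filterS => x h Dx; exact/PQ/h. Qed.

Lemma ae_in_imply2 (P1 P2 Q : T -> Prop) :
  (forall x, D x -> P1 x -> P2 x -> Q x) -> ae_in P1 -> ae_in P2 -> ae_in Q.
Proof.
by rewrite /ae_in => PQ; apply: filterS2 => x h1 h2 Dx; apply: PQ; [|exact: h1|exact: h2].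
Qed.

Lemma ae_in_and P Q : ae_in P -> ae_in Q -> ae_in (fun x => P x /\ Q x).
Proof. by move=> hP hQ; apply: (ae_in_imply2 _ hP hQ) => x _; split. Qed.

Lemma ae_in_all (P : T -> Prop) : (forall x, D x -> P x) -> ae_in P.
Proof. by move=> h; apply: aeW. Qed.

Definition integ u := mu.-integrable D (EFin \o u).

Lemma integ_measurable u : integ u -> measurable_fun D u.
Proof. by move=> /measurable_int /measurable_EFinP. Qed.

Lemma integ_le_ae u v : measurable_fun D u ->
  ae_in (fun x => `|u x| <= v x) -> integ v -> integ u.
Proof.
move=> mu_ uv /integrableP[mv iv]; apply/integrableP; split.
  exact/measurable_EFinP.
apply: le_lt_trans iv; apply: ae_ge0_le_integral => //.
- by apply/measurable_EFinP; exact: measurableT_comp.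
- by apply/measurable_EFinP; apply: measurableT_comp => //; exact/measurable_EFinP.
- by apply: (ae_in_imply _ uv) => x Dx h; rewrite lee_fin (le_trans h)// ler_norm.
Qed.

Lemma integ_ae u v : measurable_fun D v -> integ u ->
  ae_in (fun x => u x = v x) -> integ v.
Proof.
move=> mv iu uv; apply: (@integ_le_ae _ (fun x => `|u x|)) => //.
  by apply: ae_in_imply uv => x _ ->.
exact: integrable_norm.
Qed.

Lemma integD u v : integ u -> integ v -> integ (fun x => u x + v x).
Proof.
by move=> iu iv; have := integrableD mD iu iv; apply: eq_integrable.
Qed.

Lemma integB u v : integ u -> integ v -> integ (fun x => u x - v x).
Proof.
by move=> iu iv; have := integrableB mD iu iv; apply: eq_integrable.
Qed.

Lemma integZ k u : integ u -> integ (fun x => k * u x).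
Proof.
by move=> iu; have := integrableZl mD k iu; apply: eq_integrable.
Qed.

Lemma Rintegral_ae u v : integ u -> integ v ->
  ae_in (fun x => u x = v x) ->
  \int[mu]_(x in D) u x = \int[mu]_(x in D) v x.
Proof.
move=> iu iv uv; rewrite /Rintegral; congr fine; apply: ae_eq_integral => //.
- by have [] := integrableP _ _ _ iu.
- by have [] := integrableP _ _ _ iv.
- by apply: (ae_in_imply _ uv) => x Dx /= ->.
Qed.

Lemma le_Rintegral_ae u v : integ u -> integ v ->
  ae_in (fun x => u x <= v x) ->
  \int[mu]_(x in D) u x <= \int[mu]_(x in D) v x.
Proof.
move=> iu iv uv; rewrite -subr_ge0 -RintegralB//.
have ivu : integ (fun x => v x - u x) by exact: integB.
rewrite (@Rintegral_ae _ (fun x => `|v x - u x|)) //; first exact: Rintegral_ge0.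
- by apply: integrable_norm.
- by apply: ae_in_imply uv => x _ h; rewrite ger0_norm// subr_ge0.
Qed.

Lemma Rintegral_eq0 u : integ u -> ae_in (fun x => 0 <= u x) ->
  \int[mu]_(x in D) u x <= 0 -> ae_in (fun x => u x = 0).
Proof.
move=> iu u0 I0.
have I1 : \int[mu]_(x in D) `|u x| <= 0.
  rewrite (@Rintegral_ae _ u) //; first exact: integrable_norm.
  by apply: ae_in_imply u0 => x _ h; rewrite ger0_norm.
have mu_ : measurable_fun D (EFin \o u) by have [] := integrableP _ _ _ iu.
have : (\int[mu]_(x in D) `|(EFin \o u) x|)%E = 0%E.
  have fin : (\int[mu]_(x in D) `|(EFin \o u) x|)%E \is a fin_num.
    have [_ h] := integrableP _ _ _ iu.
    by rewrite ge0_fin_numE// integral_ge0.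
  apply/eqP; rewrite eq_le integral_ge0// andbT -(fineK fin) lee_fin.
  exact: I1.
rewrite /ae_in => /ae_eq_integral_abs => /(_ mD mu_); apply: filterS => x h Dx.
by have [] := h Dx.
Qed.

(** Generic in the measure. For the Lebesgue measure on [Omega] it is convertible to [L2 Omega u],
    as [bdd] is to [Linfty] and [ae_in] to [ae_on]. *)
Definition sqint u := measurable_fun D u /\ mu.-integrable D (fun x => (u x ^+ 2)%:E).

Definition ip u v := \int[mu]_(x in D) (u x * v x).

Lemma sqint_measurable u : sqint u -> measurable_fun D u. Proof. by case. Qed.

Lemma sqint_integM u v : sqint u -> sqint v -> integ (fun x => u x * v x).
Proof.
move=> [mu_ iu] [mv iv].
apply: (@integ_le_ae _ (fun x => u x ^+ 2 + v x ^+ 2)).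
- exact: measurable_funM.
- apply: ae_in_all => x _; rewrite ler_norml.
  have := sqr_ge0 (u x + v x); have := sqr_ge0 (u x - v x).
  by have := sqr_ge0 (u x); have := sqr_ge0 (v x); move=> *; apply/andP; split; lra.
- exact: integD.
Qed.

Lemma sqint_le u v : measurable_fun D u ->
  ae_in (fun x => `|u x| <= v x) -> sqint v -> sqint u.
Proof.
move=> mu_ uv [mv iv]; split=> //.
apply: (@integ_le_ae _ (fun x => v x ^+ 2)) => //.
  exact: measurable_funX.
apply: ae_in_imply uv => x _ h; rewrite normrX lerXn2r ?nnegrE//.
exact: le_trans h.
Qed.

Lemma sqint_ae u v : measurable_fun D v -> sqint u ->
  ae_in (fun x => u x = v x) -> sqint v.
Proof.
move=> mv [mu_ iu] uv; split => //; apply: (@integ_ae (fun x => u x ^+ 2)) => //.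
  exact: measurable_funX.
by apply: ae_in_imply uv => x _ ->.
Qed.

Lemma sqintD u v : sqint u -> sqint v -> sqint (fun x => u x + v x).
Proof.
move=> Hu Hv; have iuv := sqint_integM Hu Hv.
have [mu_ iu] := Hu; have [mv iv] := Hv; split; first exact: measurable_funD.
apply: (@integ_le_ae _ (fun x => (u x ^+ 2 + v x ^+ 2) + (u x ^+ 2 + v x ^+ 2))).
- by apply: measurable_funX; exact: measurable_funD.
- apply: ae_in_all => x _; rewrite ger0_norm ?sqr_ge0//.
  by have := sqr_ge0 (u x - v x); lra.
- by apply: integD => //; exact: integD.
Qed.

Lemma sqintZ k u : sqint u -> sqint (fun x => k * u x).
Proof.
move=> [mu_ iu]; split; first exact: measurable_funM.
have := integrableZl mD (k ^+ 2) iu; apply: eq_integrable => // x _ /=.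
by rewrite -EFinM exprMn.
Qed.

Lemma sqintN u : sqint u -> sqint (fun x => - u x).
Proof.
move=> [mu_ iu]; split; first exact: measurableT_comp.
by apply: eq_integrable iu => // x _ /=; rewrite sqrrN.
Qed.

Lemma sqintB u v : sqint u -> sqint v -> sqint (fun x => u x - v x).
Proof. by move=> Hu Hv; apply: sqintD => //; exact: sqintN. Qed.

Lemma sqint0 : sqint (fun=> 0).
Proof.
split; first exact: measurable_cst.
by under eq_fun do rewrite expr0n /=; exact: integrable0.
Qed.

Lemma sqint_sum (I : Type) (s : seq I) (F : I -> T -> R) :
  (forall i, sqint (F i)) -> sqint (fun x => \sum_(i <- s) F i x).
Proof.
move=> h; elim: s => [|i s IH].
  by under eq_fun do rewrite big_nil; exact: sqint0.
by under eq_fun do rewrite big_cons; exact: sqintD.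
Qed.

Definition bdd q := measurable_fun D q /\ exists M : R, ae_in (fun x => `|q x| <= M).

Lemma sqintMl q u : bdd q -> sqint u -> sqint (fun x => q x * u x).
Proof.
move=> [mq [M qM]] Hu; have [mu_ iu] := Hu.
have M0 := ler_norm M.
apply: (@sqint_le _ (fun x => `|M| * `|u x|)).
- exact: measurable_funM.
- apply: ae_in_imply qM => x _ h; rewrite normrM ler_wpM2r//.
  exact: le_trans M0.
- apply: sqintZ; split; first exact: measurableT_comp.
  by apply: eq_integrable iu => // x _ /=; rewrite real_normK ?num_real.
Qed.

Lemma ipC u v : ip u v = ip v u.
Proof. by rewrite /ip; apply: eq_Rintegral => x _; rewrite mulrC. Qed.

Lemma ip_ae u u' v v' : sqint u -> sqint u' -> sqint v -> sqint v' ->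
  ae_in (fun x => u x = u' x) -> ae_in (fun x => v x = v' x) ->
  ip u v = ip u' v'.
Proof.
move=> Hu Hu' Hv Hv' uu' vv'; apply: Rintegral_ae; try exact: sqint_integM.
by apply: ae_in_imply2 uu' vv' => x _ -> ->.
Qed.

Lemma ipDl u v w : sqint u -> sqint v -> sqint w ->
  ip (fun x => u x + v x) w = ip u w + ip v w.
Proof.
move=> Hu Hv Hw; rewrite /ip -RintegralD//; try exact: sqint_integM.
by apply: eq_Rintegral => x _; rewrite mulrDl.
Qed.

Lemma ipZl k u v : sqint u -> sqint v -> ip (fun x => k * u x) v = k * ip u v.
Proof.
move=> Hu Hv; rewrite /ip -RintegralZl//; last exact: sqint_integM.
by apply: eq_Rintegral => x _; rewrite mulrA.
Qed.

Lemma ipNl u v : sqint u -> sqint v -> ip (fun x => - u x) v = - ip u v.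
Proof.
move=> Hu Hv; rewrite -mulN1r -ipZl//.
by apply: eq_Rintegral => x _; rewrite mulN1r.
Qed.

Lemma ipBl u v w : sqint u -> sqint v -> sqint w ->
  ip (fun x => u x - v x) w = ip u w - ip v w.
Proof.
by move=> Hu Hv Hw; rewrite ipDl ?ipNl//; exact: sqintN.
Qed.

Lemma ipDr u v w : sqint u -> sqint v -> sqint w ->
  ip w (fun x => u x + v x) = ip w u + ip w v.
Proof. by move=> *; rewrite ipC ipDl// !(ipC w). Qed.

Lemma ipZr k u v : sqint u -> sqint v -> ip u (fun x => k * v x) = k * ip u v.
Proof. by move=> *; rewrite ipC ipZl// ipC. Qed.

Lemma ipBr u v w : sqint u -> sqint v -> sqint w ->
  ip w (fun x => u x - v x) = ip w u - ip w v.
Proof. by move=> *; rewrite ipC ipBl// !(ipC w). Qed.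

Lemma ip_ge0 u : 0 <= ip u u.
Proof. by apply: Rintegral_ge0 => x _; rewrite -expr2 sqr_ge0. Qed.

Lemma ip_le u v u' v' : sqint u -> sqint v -> sqint u' -> sqint v' ->
  ae_in (fun x => u x * v x <= u' x * v' x) -> ip u v <= ip u' v'.
Proof. by move=> *; apply: le_Rintegral_ae => //; exact: sqint_integM. Qed.

Lemma ip_eq0 u : sqint u -> ip u u <= 0 -> ae_in (fun x => u x = 0).
Proof.
move=> Hu /Rintegral_eq0 h.
have := h (sqint_integM Hu Hu) (ae_in_all (fun x _ => sqr_ge0 (u x))).
by apply: ae_in_imply => x _ /eqP; rewrite mulf_eq0 orbb => /eqP.
Qed.

Lemma ip0l u v : ae_in (fun x => u x = 0) -> sqint u -> sqint v -> ip u v = 0.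
Proof.
move=> u0 Hu Hv; rewrite (@ip_ae _ (fun=> 0) _ v) //.
- by rewrite /ip; under eq_Rintegral do rewrite mul0r;
    rewrite /Rintegral integral0.
- exact: sqint0.
- exact: ae_in_all.
Qed.

Lemma ip_sqrB u v : sqint u -> sqint v ->
  ip (fun x => u x - v x) (fun x => u x - v x) = ip u u - 2 * ip u v + ip v v.
Proof.
move=> Hu Hv; have Huv := sqintB Hu Hv.
by rewrite ipBl// !ipBr// (ipC v u); ring.
Qed.

Lemma ip_sqrD_le u v : sqint u -> sqint v ->
  ip (fun x => u x + v x) (fun x => u x + v x) <= 2 * ip u u + 2 * ip v v.
Proof.
move=> Hu Hv; have Huv := sqintD Hu Hv.
have := ip_ge0 (fun x => u x - v x).
rewrite ip_sqrB// ipDl// !ipDr// (ipC v u); lra.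
Qed.

(** Stated for scalars because every Cauchy-Schwarz inequality below, for $L^2$, for a weight and
    for an abstract form, reduces to it, as does the near-optimality estimate in the Riesz argument.
    For [0 < C] the choice [t = B / C] gives the claim. *)
Lemma quad_disc (A B C : R) : 0 <= A -> 0 <= C ->
  (forall t, 0 <= A - 2 * t * B + t ^+ 2 * C) -> B ^+ 2 <= A * C.
Proof.
move=> A0 C0 h; have [Cp|] := ltP 0 C.
  have := h (B / C).
  have -> : A - 2 * (B / C) * B + (B / C) ^+ 2 * C = A - B ^+ 2 / C.
    by field; exact: lt0r_neq0.
  by rewrite subr_ge0 ler_pdivrMr.
move=> C1; have {C0 C1} C0 : C = 0 by apply/eqP; rewrite eq_le C1.
rewrite C0 mulr0; have [->|B0] := eqVneq B 0; first by rewrite expr0n.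
(* With [C = 0] the polynomial is affine in [t], and this [t] gives it the value -1. *)
have := h ((A + 1) / (2 * B)); rewrite C0 mulr0 addr0.
have -> : 2 * ((A + 1) / (2 * B)) * B = A + 1 by field.
lra.
Qed.

Lemma ip_CS u v : sqint u -> sqint v -> ip u v ^+ 2 <= ip u u * ip v v.
Proof.
move=> Hu Hv; apply: quad_disc; try exact: ip_ge0.
move=> t; have := ip_ge0 (fun x => u x - t * v x); have Htv := sqintZ t Hv.
by rewrite ip_sqrB// ipZl// !ipZr//; lra.
Qed.

Lemma ip_MlC q u v : ip (fun x => q x * u x) v = ip u (fun x => q x * v x).
Proof. by apply: eq_Rintegral => x _; ring. Qed.

End square_integrable.

(** * Completeness of $L^2$ by rapidly converging subsequences *)

Section completeness.
Context d (T : measurableType d) (R : realType).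
Variables (mu : {measure set T -> \bar R}) (D : set T) (mD : measurable D).
Implicit Types (u v w q : T -> R).
Local Notation sqint := (sqint mu D).
Local Notation ip := (ip mu D).
Local Notation ae_in := (ae_in mu D).

(** The series $S = \sum_k 4^k v_k^2$ has integral at most $\sum_k 2^{-k}$, so it is finite almost
    everywhere, and each of its terms is at most $S$. The dominating function is $\sqrt S$. *)
Lemma geometric_dominated (v : nat -> T -> R) :
  (forall k, sqint (v k)) -> (forall k, ip (v k) (v k) <= 8^-1 ^+ k) ->
  exists G, sqint G /\ ae_in (fun x => forall k, `|v k x| <= G x * 2^-1 ^+ k).
Proof.
move=> Hv v8.
pose F k x : \bar R := (4 ^+ k * (v k x * v k x))%:E.
pose S x := (\sum_(k <oo) F k x)%E.
have F0 k x : (0 <= F k x)%E.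
  by rewrite lee_fin mulr_ge0 ?exprn_ge0// -expr2 sqr_ge0.
have mF k : measurable_fun D (F k).
  apply/measurable_EFinP; apply: measurable_funM => //.
  by apply: measurable_funM; have [] := Hv k.
have mS : measurable_fun D S by exact: ge0_emeasurable_sum.
have S0 x : (0 <= S x)%E by exact: nneseries_ge0.
have IS : (\int[mu]_(x in D) S x < +oo)%E.
  rewrite integral_nneseries//.
  apply: (@le_lt_trans _ _ (\sum_(k <oo) (2^-1 ^+ k)%:E)%E).
    apply: lee_nneseries => [k _ _|k _]; first exact: integral_ge0.
    have ivk : mu.-integrable D (EFin \o (fun x => v k x * v k x)).
      by have [] := Hv k.
    under eq_integral do rewrite /F EFinM.
    rewrite integralZl// -(fineK (integrable_fin_num mD ivk)) -EFinM lee_fin.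
    rewrite (_ : 2^-1 = 4 * 8^-1 :> R); last by field.
    by rewrite exprMn ler_wpM2l ?exprn_ge0//; exact: v8.
  have -> : (fun n => \sum_(0 <= k < n) (2^-1 ^+ k)%:E)%E =
            EFin \o series (geometric 1 (2^-1 : R)).
    apply/funext => n; rewrite /= sumEFin; congr (_%:E).
    by apply: eq_bigr => k _; rewrite /= mul1r.
  have c : series (geometric 1 (2^-1 : R)) @ \oo --> (1 * (1 - 2^-1)^-1 : R).
    by apply: cvg_geometric_series; rewrite ger0_norm ?invf_lt1 ?ltr1n.
  by rewrite EFin_lim ?ltry//; apply/cvg_ex; eexists; exact: c.
have iS : mu.-integrable D S.
  apply/integrableP; split => //.
  by under eq_integral do rewrite gee0_abs//.
have fS := integrable_ae mD iS.
have mfS : measurable_fun D (fun x => fine (S x)).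
  by apply: measurableT_comp.
have ifS : mu.-integrable D (EFin \o (fun x => fine (S x))).
  apply/integrableP; split; first exact/measurable_EFinP.
  apply: le_lt_trans IS; apply: ge0_le_integral => //.
  - by apply/measurable_EFinP; apply: measurableT_comp.
  - move=> x Dx /=; rewrite ger0_norm ?fine_ge0//.
    by case: (S x) (S0 x) => //=; rewrite ?leey.
pose G x := Num.sqrt (fine (S x)).
have GG x : G x ^+ 2 = fine (S x) by rewrite sqr_sqrtr// fine_ge0.
exists G; split.
  split.
    apply: (measurableT_comp _ mfS); apply: continuous_measurable_fun.
    exact: sqrt_continuous.
  by under eq_fun do rewrite GG.
move: fS; apply: ae_in_imply => x Dx fx k.
rewrite -(@ler_sqr _ _ (G x * _)) ?nnegrE ?mulr_ge0 ?exprn_ge0 ?sqrtr_ge0//.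
rewrite exprMn GG real_normK ?num_real// -exprM mulnC exprM.
rewrite -[leLHS]mul1r -{1}(@mulVf _ (4 ^+ k : R)) ?expf_neq0//.
rewrite (_ : 2^-1 ^+ 2 = 4^-1); last by field.
rewrite exprVn -mulrA mulrC ler_wpM2r ?invr_ge0 ?exprn_ge0//.
rewrite -lee_fin fineK//.
have := @nneseries_lim_ge R (F^~ x) xpredT 0%N k.+1 (fun n _ _ => F0 n x).
apply: le_trans; rewrite big_nat_recr//= leeDr//.
exact: sume_ge0.
Qed.

(** The sequences $a_n - 2g2^{-n}$ and $a_n + 2g2^{-n}$ are monotone in opposite directions and
    enclose the limit. This yields convergence and the error bound at once. *)
Lemma geometric_cvg (a : nat -> R) g :
  (forall k, `|a k.+1 - a k| <= g * 2^-1 ^+ k) ->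
  cvgn a /\ forall n, `|limn a - a n| <= 2 * g * 2^-1 ^+ n.
Proof.
move=> h.
pose e n := 2 * g * 2^-1 ^+ n : R.
have e0 : e @ \oo --> (0 : R).
  by apply: cvg_geometric; rewrite ger0_norm ?invf_lt1 ?ltr1n.
have eS n : e n = e n.+1 + g * 2^-1 ^+ n by rewrite /e exprS; field.
have nb : nondecreasing_seq (fun n => a n - e n).
  apply/nondecreasing_seqP => n; have := h n; rewrite ler_norml => /andP[h1 _].
  by have := eS n; lra.
have nc : nonincreasing_seq (fun n => a n + e n).
  apply/nonincreasing_seqP => n; have := h n; rewrite ler_norml => /andP[_ h1].
  by have := eS n; lra.
have en0 n : 0 <= e n.
  have : 0 <= g * 2^-1 ^+ 0 by apply: le_trans (h 0%N).
  rewrite expr0 mulr1 => g0; by rewrite /e !mulr_ge0// exprn_ge0.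
have bc n m : a n - e n <= a m + e m.
  apply: (@le_trans _ _ (a (maxn n m) - e (maxn n m))).
    by apply: nb; exact: leq_maxl.
  apply: (@le_trans _ _ (a (maxn n m) + e (maxn n m))).
    by have := en0 (maxn n m); lra.
  by apply: nc; exact: leq_maxr.
have cb : cvgn (fun n => a n - e n).
  apply: nondecreasing_is_cvgn => //.
  by exists (a 0%N + e 0%N) => _ [n _ <-]; exact: bc.
have ca := cvgD cb e0; rewrite addr0 in ca.
have ae : (fun n => a n - e n) \+ e = a by apply/funext => n /=; rewrite subrK.
rewrite [X in X @ _](_ : _ = a) in ca; last exact: ae.
have {}ca : a @ \oo --> limn (fun n => a n - e n) by exact: ca.
split; first by apply/cvg_ex; eexists; exact: ca.
move=> n; rewrite (cvg_lim _ ca)// ler_norml -/(e n); apply/andP; split.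
  by have := nondecreasing_cvgn_le nb cb n; lra.
rewrite lerBlDr addrC; apply: limr_le => //.
by apply: nearW => k; exact: bc.
Qed.

Lemma sqint_fast_cvg (u : nat -> T -> R) :
  (forall k, sqint (u k)) ->
  (forall k, ip (fun x => u k.+1 x - u k x) (fun x => u k.+1 x - u k x)
             <= 8^-1 ^+ k) ->
  exists w, [/\ sqint w, ae_in (fun x => u ^~ x @ \oo --> w x) &
    (fun n => ip (fun x => u n x - w x) (fun x => u n x - w x)) @ \oo --> (0:R)].
Proof.
move=> Hu u8; have Hd k : sqint (fun x => u k.+1 x - u k x) by exact: sqintB.
have [G [HG hG]] := geometric_dominated Hd u8.
(* The upper limit is measurable whether or not the sequence converges, and [fine] makes it real on
   the null set where it may be infinite. *)
pose w x := fine (limn_esup (fun k => (u k x)%:E)).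
have mw : measurable_fun D w.
  apply: measurableT_comp => //; apply: measurable_fun_limn_esup => k.
  by apply/measurable_EFinP; have [] := Hu k.
have hw : ae_in (fun x => u ^~ x @ \oo --> w x /\
    forall n, `|w x - u n x| <= 2 * G x * 2^-1 ^+ n).
  move: hG; apply: ae_in_imply => x Dx /geometric_cvg[c b].
  suff -> : w x = limn (u ^~ x) by [].
  rewrite /w; have /(cvg_limn_einf_sup)[_ ->] : (EFin \o u^~ x) @ \oo --> (limn (u^~ x))%:E.
    by apply/fine_cvgP; split; [exact: nearW|exact: c].
  by [].
have hb n : ae_in (fun x => `|w x - u n x| <= 2 * 2^-1 ^+ n * G x).
  by move: hw; apply: ae_in_imply => x _ [_ /(_ n)]; rewrite mulrAC.
have HwB n : sqint (fun x => w x - u n x).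
  apply: (sqint_le mD _ (hb n)); last exact: sqintZ.
  by apply: measurable_funB => //; have [] := Hu n.
have Hw : sqint w.
  apply: (sqint_ae mD mw (sqintD mD (HwB 0%N) (Hu 0%N))).
  by apply: ae_in_all => x _; rewrite subrK.
exists w; split => //; first by move: hw; apply: ae_in_imply => x _ [].
have bnd n : 0 <= ip (fun x => u n x - w x) (fun x => u n x - w x) <=
    (4 * ip G G) * 4^-1 ^+ n.
  rewrite ip_ge0/=.
  have -> : (4 * ip G G) * 4^-1 ^+ n =
     ip (fun x => 2 * 2^-1 ^+ n * G x) (fun x => 2 * 2^-1 ^+ n * G x).
    rewrite ipZl ?ipZr//; last exact: sqintZ.
    rewrite (_ : 4^-1 = 2^-1 ^+ 2 :> R); last by field.
    by rewrite -exprM mulnC exprM; ring.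
  apply: ip_le => //; try exact: sqintB; try exact: sqintZ.
  move: (hb n); apply: ae_in_imply => x _ h.
  have := h; rewrite distrC => h'.
  by rewrite -!expr2 -(real_normK (num_real (u n x - w x))) lerXn2r ?nnegrE// (le_trans _ h').
apply: (@squeeze_cvgr _ _ _ _ (fun=> 0) (fun n => (4 * ip G G) * 4^-1 ^+ n)).
- exact: nearW.
- exact: cvg_cst.
- by apply: cvg_geometric; rewrite ger0_norm ?invf_lt1 ?ltr1n.
Qed.

End completeness.

Lemma cvg0_le (R : realType) (a : nat -> R) e : a @ \oo --> (0 : R) -> 0 < e ->
  exists N, forall n, (N <= n)%N -> a n <= e.
Proof.
move=> /cvgrPdist_le /(_ e) h e0; have [N _ HN] := h e0.
exists N => n Nn; have := HN n Nn; rewrite sub0r normrN; apply: le_trans.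
exact: ler_norm.
Qed.

Lemma cvg0_ge0 (R : realType) (a : nat -> R) : (forall n, 0 <= a n) ->
  (forall e, 0 < e -> exists N, forall n, (N <= n)%N -> a n <= e) ->
  a @ \oo --> (0 : R).
Proof.
move=> a0 h; apply/cvgrPdist_le => e e0; have [N HN] := h e e0.
by exists N => // n /= Nn; rewrite sub0r normrN ger0_norm// HN.
Qed.

Section subsequences.
Context d (T : measurableType d) (R : realType).
Variables (mu : {measure set T -> \bar R}) (D : set T) (mD : measurable D).
Local Notation sqint := (sqint mu D).
Local Notation ip := (ip mu D).
Local Notation ae_in := (ae_in mu D).

Definition sqdist (u v : T -> R) := ip (fun x => u x - v x) (fun x => u x - v x).

Lemma sqdist_ge0 u v : 0 <= sqdist u v. Proof. exact: ip_ge0. Qed.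

Lemma sqdistC u v : sqdist u v = sqdist v u.
Proof. by apply: eq_Rintegral => x _; ring. Qed.

Lemma sqdist_tri w u v : sqint u -> sqint v -> sqint w ->
  sqdist u v <= 2 * sqdist u w + 2 * sqdist w v.
Proof.
move=> Hu Hv Hw; have := ip_sqrD_le mD (sqintB mD Hu Hw) (sqintB mD Hw Hv).
by congr (_ <= _); apply: eq_Rintegral => x _; rewrite subrKA.
Qed.

Lemma sqint_complete (u : nat -> T -> R) : (forall n, sqint (u n)) ->
  (forall e, 0 < e -> exists N, forall m n, (N <= m)%N -> (N <= n)%N ->
    sqdist (u m) (u n) <= e) ->
  exists w, sqint w /\ (fun n => sqdist (u n) w) @ \oo --> (0 : R).
Proof.
move=> Hu cu.
have e0 k : 0 < 8^-1 ^+ k :> R by rewrite exprn_gt0.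
have [N HN] := choice (fun k => cu _ (e0 k)).
(* The running maximum makes [s k] and [s k.+1] both exceed the modulus [N k], so consecutive terms
   of the subsequence are within $8^{-k}$. *)
pose s k := (\max_(i < k.+1) N i)%N.
have Ns i k : (i <= k)%N -> (N i <= s k)%N.
  move=> ik; have ik' : (i < k.+1)%N by rewrite ltnS.
  by apply: (@leq_bigmax_cond _ _ (fun j : 'I_k.+1 => N j) (Ordinal ik')).
have [w [Hw _ cw]] := sqint_fast_cvg mD (fun k => Hu (s k))
  (fun k => HN k _ _ (Ns k k.+1 (leqnSn k)) (Ns k k (leqnn k))).
exists w; split => //; apply: cvg0_ge0 => [n|e e_gt0]; first exact: sqdist_ge0.
have e4 : 0 < e / 4 by rewrite divr_gt0.
have [N1 HN1] := cu _ e4; have [N2 HN2] := cvg0_le cw e4.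
have c8 : (fun k => 8^-1 ^+ k : R) @ \oo --> (0 : R).
  have := @cvg_geometric R 1 8^-1; rewrite -exprn_geometric; apply.
  by rewrite ger0_norm ?invf_lt1 ?ltr1n.
have [N3 HN3] := cvg0_le c8 e4.
pose k := maxn N2 N3; exists (N k) => n Nn.
have h1 : sqdist (u n) (u (s k)) <= e / 4.
  by apply: le_trans (HN k _ _ Nn (Ns _ _ (leqnn k))) (HN3 _ (leq_maxr _ _)).
have h2 : sqdist (u (s k)) w <= e / 4 by exact: HN2 (leq_maxl _ _).
have := sqdist_tri (Hu n) Hw (Hu (s k)); lra.
Qed.

Lemma ae_subsequence (u : nat -> T -> R) w : (forall n, sqint (u n)) ->
  sqint w -> (fun n => sqdist (u n) w) @ \oo --> (0 : R) ->
  exists s : nat -> nat, (forall k, (k <= s k)%N) /\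
    ae_in (fun x => (fun k => u (s k) x) @ \oo --> w x).
Proof.
move=> Hu Hw cu.
have e0 k : 0 < 8^-1 ^+ k :> R by rewrite exprn_gt0.
have [N HN] := choice (fun k => cvg0_le cu (e0 k)).
exists (fun k => maxn k (N k)); split; first by move=> k; exact: leq_maxl.
have := @geometric_dominated _ _ _ mu _ mD
  (fun k x => u (maxn k (N k)) x - w x) (fun k => sqintB mD (Hu _) Hw)
  (fun k => HN k _ (leq_maxr _ _)).
move=> [G [_]]; apply: ae_in_imply => x _ h.
apply/subr_cvg0; apply/norm_cvg0P.
apply: (@squeeze_cvgr _ _ _ _ (fun=> 0) (fun n => G x * 2^-1 ^+ n)).
- by apply: nearW => n; rewrite normr_ge0/=; exact: h.
- exact: cvg_cst.
- by apply: cvg_geometric; rewrite ger0_norm ?invf_lt1 ?ltr1n.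
Qed.

End subsequences.

(** * Riesz representation for a semidefinite symmetric form *)

Section riesz.
Context (R : realType) (V : lmodType R).
Variables (E : set V) (B : V -> V -> R) (l : V -> R) (C : R).
Hypothesis E0 : E 0.
Hypothesis EP : forall k u v, E u -> E v -> E (k *: u + v).
Hypothesis BC : forall u v, E u -> E v -> B u v = B v u.
Hypothesis BP : forall k u v w, E u -> E v -> E w ->
  B (k *: u + v) w = k * B u w + B v w.
Hypothesis B_ge0 : forall u, E u -> 0 <= B u u.
Hypothesis lP : forall k u v, E u -> E v -> l (k *: u + v) = k * l u + l v.
Hypothesis C0 : 0 <= C.
Hypothesis lB : forall u, E u -> l u ^+ 2 <= C * B u u.
Hypothesis B_complete : forall u : nat -> V, (forall n, E (u n)) ->
  (forall e, 0 < e -> exists N, forall m n, (N <= m)%N -> (N <= n)%N ->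
    B (u m - u n) (u m - u n) <= e) ->
  exists2 w, E w & (fun n => B (u n - w) (u n - w)) @ \oo --> (0 : R).

Let EB u v : E u -> E v -> E (u - v).
Proof. by move=> Eu Ev; rewrite addrC -scaleN1r; exact: EP. Qed.

Let BBl u v w : E u -> E v -> E w -> B (u - v) w = B u w - B v w.
Proof. by move=> *; rewrite addrC -scaleN1r BP// mulN1r addrC. Qed.

Let quad k u v : E u -> E v ->
  B (k *: u + v) (k *: u + v) = k ^+ 2 * B u u + 2 * k * B u v + B v v.
Proof.
move=> Eu Ev; have Euv := EP k Eu Ev.
by rewrite BP// !(BC _ Euv)// !BP// (BC Ev Eu); ring.
Qed.

Lemma form_CS u v : E u -> E v -> B u v ^+ 2 <= B u u * B v v.
Proof.
move=> Eu Ev; rewrite mulrC; apply: quad_disc; try exact: B_ge0.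
by move=> t; have := B_ge0 (EP (- t) Eu Ev); rewrite quad// sqrrN; lra.
Qed.

Lemma riesz_representation : exists2 u, E u & forall v, E v -> B u v = l v.
Proof.
pose J u := B u u - 2 * l u.
(* If [2 * l u] exceeded [B u u + C], squaring and using [lB] would contradict $(b + C)^2 \ge
   4bC$. *)
have JC u : E u -> - C <= J u.
  move=> Eu; have := lB Eu; have := B_ge0 Eu; rewrite /J.
  set b := B u u; set m := l u => b0 h.
  rewrite leNgt; apply/negP => h1.
  have h2 : 0 <= b + C by exact: addr_ge0.
  have h3 : b + C < 2 * m by lra.
  have h4 : (b + C) * (b + C) <= (b + C) * (2 * m) by rewrite ler_wpM2l// ltW.
  have h5 : (b + C) * (2 * m) < (2 * m) * (2 * m).
    by rewrite ltr_pM2r// (le_lt_trans h2).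
  have := sqr_ge0 (b - C); lra.
have hJ : has_inf (J @` E).
  split; first by exists (J 0), 0.
  by exists (- C) => _ [u Eu <-]; exact: JC.
pose m := inf (J @` E).
have Jm u : E u -> m <= J u.
  by move=> Eu; apply: ge_inf; [by case: hJ|exists u].
have e_gt0 n : 0 < n.+1%:R^-1 :> R by rewrite invr_gt0.
have /choice[u_ hu] : forall n, exists u, E u /\ J u <= m + n.+1%:R^-1.
  move=> n; have [_ [u Eu <-] h] := inf_adherent (e_gt0 n) hJ.
  by exists u; split => //; exact: ltW.
have Eu_ n : E (u_ n) by case: (hu n).
have Ju_ n : J (u_ n) <= m + n.+1%:R^-1 by case: (hu n).
have le_eps n k : (n <= k)%N -> k.+1%:R^-1 <= n.+1%:R^-1 :> R.
  by move=> nk; rewrite lef_pV2 ?posrE// ler_nat.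
have eps0 : (fun n => n.+1%:R^-1 : R) @ \oo --> (0 : R) by exact: cvg_harmonic.
have J_half u v : E u -> E v ->
    B (u - v) (u - v) <= 2 * (J u - m) + 2 * (J v - m).
  move=> Eu Ev; have Ew := EP 2^-1 Eu (EP 2^-1 Ev E0).
  have := Jm _ Ew; rewrite /J quad ?quad//; try exact: EP.
  rewrite !lP//; last exact: EP.
  have -> : l 0 = 0 by have := lP 1 E0 E0; rewrite scaler0 addr0 mul1r; lra.
  have B0 w : E w -> B 0 w = 0.
    by move=> Ew'; have := BP 1 E0 E0 Ew'; rewrite scaler0 addr0 mul1r; lra.
  rewrite (BC Ev E0) !B0// (BC Eu) ?BP//; try exact: EP.
  rewrite B0// (BC Ev Eu).
  have := quad (-1) Ev Eu; rewrite scaleN1r addrC (BC Ev Eu) => ->.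
  rewrite /J; lra.
have [||u Eu cu] := B_complete (u := u_) => //.
  move=> e e0; have e4 : 0 < e / 4 by rewrite divr_gt0.
  have [N HN] := cvg0_le eps0 e4; exists N => a b Na Nb.
  apply: le_trans (J_half _ _ (Eu_ a) (Eu_ b)) _.
  have := Ju_ a; have := Ju_ b; have /= := HN _ Na; have /= := HN _ Nb.
  set p := a.+1%:R^-1; set q := b.+1%:R^-1; lra.
exists u => // v Ev; apply/eqP; rewrite -subr_eq0 -sqrf_eq0 eq_le sqr_ge0 andbT.
(* Near-minimality of [u_ n] against [u_ n - t v] says that a quadratic polynomial in [t], with
   constant term $1/(n+1)$, is nonnegative. Its discriminant bounds the defect in the Euler
   equation. *)
have key n : (B (u_ n) v - l v) ^+ 2 <= n.+1%:R^-1 * B v v.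
  apply: quad_disc; [exact: ltW|exact: B_ge0|move=> t].
  have := Jm _ (EP (- t) Ev (Eu_ n)); rewrite /J quad// lP// (BC Ev (Eu_ n))//.
  by have := Ju_ n; rewrite /J sqrrN; set p := n.+1%:R^-1; lra.
have key2 n : (B u v - l v) ^+ 2 <=
    2 * (B (u_ n - u) (u_ n - u) * B v v) + 2 * (n.+1%:R^-1 * B v v).
  have := key n; have := form_CS (EB (Eu_ n) Eu) Ev; rewrite (BBl (Eu_ n) Eu Ev).
  set p := B u v; set q := B (u_ n) v; set r := l v.
  by have := sqr_ge0 ((q - r) + (q - p)); set P := _ * B v v; set Q := _ * B v v; lra.
apply/ler_addgt0Pr => e e0; rewrite add0r.
have Bv := B_ge0 Ev.
have e1 : 0 < e / (4 * (B v v + 1)).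
  by rewrite divr_gt0// mulr_gt0// ltr_wpDl.
have [N1 HN1] := cvg0_le cu e1; have [N2 HN2] := cvg0_le eps0 e1.
pose n := maxn N1 N2; apply: le_trans (key2 n) _.
have h1 := HN1 n (leq_maxl _ _); have h2 := HN2 n (leq_maxr _ _).
have h3 : e / (4 * (B v v + 1)) * B v v <= e / 4.
  rewrite mulrAC ler_pdivrMr ?mulr_gt0 ?ltr_wpDl//.
  rewrite (_ : e / 4 * (4 * (B v v + 1)) = e * (B v v + 1)); last by field.
  by rewrite ler_pM2l//; lra.
have /= := ler_wpM2r Bv h1; have /= := ler_wpM2r Bv h2.
set P := _ * B v v; set Q := _ * B v v; set S := _ * B v v; move: h3; rewrite -/S -/P -/Q; clear -e0 R => h3 *; lra.
Qed.

End riesz.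

(** * Lebesgue measure on row vectors *)

Section rV_measure.
Variable R : realType.

Definition box n (c : 'rV[R]_n) (r : R) : set 'rV[R]_n :=
  [set x | forall i, `|x 0 i - c 0 i| < r].

Lemma measurable_coord n (i : 'I_n) D :
  measurable_fun D (fun x : 'rV[R]_n => x 0 i).
Proof.
by apply: (@measurable_funS _ _ _ _ setT) => //; exact: (@measurable_coord_rV R n i).
Qed.

Lemma measurable_box n (c : 'rV[R]_n) r : measurable (box c r).
Proof.
rewrite (_ : box c r = \bigcap_(i in [set: 'I_n])
    ((fun x : 'rV[R]_n => x 0 i) @^-1` (ball (c 0 i) r))).
  apply: fin_bigcap_measurable => // i _.
  rewrite -[X in measurable X]setTI; apply: measurable_coord => //.
  exact: measurable_ball.
apply/seteqP; split => [x h i _|x h i].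
  by rewrite /= /ball/= distrC; exact: h.
by have := h i I; rewrite /= /ball/= distrC.
Qed.

Lemma box_ball n (c : 'rV[R]_n) r : 0 < r -> box c r = ball c r.
Proof.
move=> r0; apply/seteqP; split => [x h|x [_ h] i].
  by split => // i j; rewrite (ord1 i) /ball/= distrC; exact: h.
by have := h 0 i; rewrite /ball/= distrC.
Qed.

Definition rbox n (cq : 'rV[rat]_n * rat) : set 'rV[R]_n :=
  box (map_mx ratr cq.1) (ratr cq.2).

(** The closed rational cube, and not only the open one, lies in [U]: the fundamental lemma needs
    compact boxes inside [Omega], and only countably many of them. *)
Lemma rbox_sub n (U : set 'rV[R]_n) x : open U -> U x ->
  exists cq : 'rV[rat]_n * rat, 0 < cq.2 /\ rbox cq x /\
    forall y : 'rV[R]_n,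
      (forall i, `|y 0 i - ratr (cq.1 0 i)| <= ratr cq.2) -> U y.
Proof.
move=> oU Ux; have /nbhs_ballP[e /= e0 eU] : nbhs x U by exact: open_nbhs_nbhs.
have [q /andP[q0 qe]] : exists q : rat, (0 < (ratr q : R)) && ((ratr q : R) < e / 2).
  have [q] := rat_in_itvoo (divr_gt0 e0 (@ltr0n R 2)).
  by rewrite in_itv/= => ?; exists q.
have hc i : exists c : rat, `|x 0 i - ratr c| < ratr q.
  have xq : x 0 i - ratr q < x 0 i + ratr q by lra.
  have [c] := rat_in_itvoo xq; rewrite in_itv/= => /andP[h1 h2]; exists c.
  by rewrite ltr_norml; apply/andP; split; lra.
have [c Hc] := choice hc.
exists (\row_i c i, q) => /=; split; first by rewrite -(ltr0q R).
split; first by move=> i; rewrite !mxE; exact: Hc.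
move=> y hy; apply: eU; rewrite -box_ball// => i.
have := hy i; have := Hc i; rewrite !mxE => h1 h2.
by have := ler_distD (ratr (c i)) (y 0 i) (x 0 i); rewrite (distrC (ratr (c i)) (x 0 i)); lra.
Qed.

(** The sigma-algebra is generated by the coordinates, so open sets are not measurable by
    definition. They are countable unions of rational cubes. *)
Lemma open_measurable_rV n (U : set 'rV[R]_n) : open U -> measurable U.
Proof.
move=> oU.
rewrite (_ : U = \bigcup_(cq : 'rV[rat]_n * rat)
    (if `[< rbox cq `<=` U >] then rbox cq else set0)).
  apply: countable_bigcupT_measurable => // cq.
  by case: ifPn => // _; exact: measurable_box.
apply/seteqP; split => [x Ux|x [cq _]]; last by case: ifPn => // /asboolP; exact.
have [cq [_ [cx cU]]] := rbox_sub oU Ux; exists cq => //.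
by case: asboolP => // /(_ _)[]; move=> y hy; apply: cU => i; have := hy i; rewrite mxE => /ltW.
Qed.

Lemma measurable_fun_open n (U : set 'rV[R]_n) (f : 'rV[R]_n -> R) :
  open U -> (forall x, U x -> {for x, continuous f}) -> measurable_fun U f.
Proof.
move=> oU cf; apply: (measurability _ (RGenOpens.measurableE R)).
move=> _ [_ [a [b ->] <-]]; apply: open_measurable_rV.
rewrite openE => x [Ux fx]; apply: filterI; first exact: open_nbhs_nbhs.
by apply: (cf x Ux); apply: open_nbhs_nbhs; split => //; exact: interval_open.
Qed.

Lemma measurable_fun_rV_continuous n (f : 'rV[R]_n -> R) D :
  measurable D -> continuous f -> measurable_fun D f.
Proof.
move=> mD cf; apply: (@measurable_funS _ _ _ _ setT) => //.
by apply: measurable_fun_open => [|x _]; [exact: openT|exact: cf].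
Qed.

Lemma lebesgue_measure_translation (h : R) (A : set R) : measurable A ->
  lebesgue_measure ((fun x => x + h) @^-1` A) = lebesgue_measure A.
Proof.
move=> mA.
have mh : measurable_fun setT (fun x : R => x + h : measurableTypeR R).
  exact: measurable_funD.
have := @lebesgue_measure_unique R (pushforward lebesgue_measure (fun x : R => x + h : measurableTypeR R)).
move=> /(_ mh) H; apply: esym; apply: (H _ A mA) => _ [[a b]] _ <-.
have E : (fun x : R => x + h) @^-1` `]a, b]%classic = `]a - h, b - h]%classic.
  by apply/seteqP; split => x /=; rewrite !in_itv/= => /andP[? ?]; apply/andP; split; lra.
rewrite /pushforward [X in _ = lebesgue_measure X]E.
by rewrite !lebesgue_measure_itv/= !lte_fin ltrD2r; case: ifPn => // _; rewrite -!EFinD; congr (_%:E); ring.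
Qed.

Lemma cons_rVl n p (j : 'I_1) : @cons_rV R n p 0 (lshift n j) = p.1.
Proof.
by transitivity ((const_mx p.1 : 'rV[R]_1) 0 j); [exact: row_mxEl|rewrite mxE].
Qed.

Lemma cons_rVr n p j : @cons_rV R n p 0 (rshift 1 j) = p.2 0 j.
Proof. exact: row_mxEr. Qed.

Lemma lebesgue_rV_translation n (h : 'rV[R]_n) (A : set 'rV[R]_n) :
  measurable A ->
  lebesgue_rV R n ((fun x => x + h) @^-1` A) = lebesgue_rV R n A.
Proof.
elim: n h A => [|n IH] h A mA.
  by congr (lebesgue_rV R 0 _); apply/seteqP; split => x /=; rewrite (thinmx0 (x + h)) (thinmx0 x).
pose s : R := h 0 0.
pose t : 'rV[R]_n := rsubmx (h : 'rV_(1 + n)).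
have ms : measurable_fun setT (fun x : measurableTypeR R => (x : R) + s : measurableTypeR R).
  exact: measurable_funD.
have mt : measurable_fun setT (fun x : 'rV[R]_n => x + t).
  apply: measurable_fun_rVP => i; rewrite /coord_rV.
  under eq_fun do rewrite mxE.
  by apply: measurable_funD => //; exact: measurable_coord.
pose T (p : measurableTypeR R * 'rV[R]_n) : measurableTypeR R * 'rV[R]_n :=
  ((p.1 : R) + s : measurableTypeR R, p.2 + t).
have mT : measurable_fun setT T.
  apply/measurable_fun_pairP; split.
    exact: (measurableT_comp ms measurable_fst).
  exact: (measurableT_comp mt measurable_snd).
have mB : measurable (@cons_rV R n @^-1` A).
  by rewrite -[X in measurable X]setTI; exact: measurable_cons_rV.
change ((lebesgue_measure \x lebesgue_rV R n)%E (@cons_rV R n @^-1` ((fun x => x + h) @^-1` A)) =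
  (lebesgue_measure \x lebesgue_rV R n)%E (@cons_rV R n @^-1` A)).
have E p : cons_rV p + h = cons_rV (T p).
  apply/rowP => i; rewrite mxE.
  have [j ->|j ->] := split_ordP (i : 'I_(1 + n)).
    by rewrite !cons_rVl (ord1 j) /s; congr (_ + h _ _); apply/val_inj.
  by rewrite !cons_rVr /T/= !mxE.
have -> : @cons_rV R n @^-1` ((fun x => x + h) @^-1` A) = T @^-1` (@cons_rV R n @^-1` A).
  by apply/funext => p; rewrite /preimage/= E.
rewrite [RHS](product_measure_unique (m' := pushforward (lebesgue_measure \x lebesgue_rV R n)%E T))//.
move=> A1 A2 mA1 mA2; rewrite /pushforward.
transitivity ((lebesgue_measure \x lebesgue_rV R n)%E
  (((fun x : R => x + s) @^-1` A1) `*` ((fun x => x + t) @^-1` A2))); first by [].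
have mA1' : measurable ((fun x : measurableTypeR R => (x : R) + s : measurableTypeR R) @^-1` A1).
  by rewrite -[X in measurable X]setTI; exact: ms.
have mA2' : measurable ((fun x => x + t) @^-1` A2).
  by rewrite -[X in measurable X]setTI; exact: mt.
rewrite product_measure1E// IH//; congr (_ * _)%E.
exact: lebesgue_measure_translation.
Qed.

End rV_measure.

Section lebesgue_rV_theory.
Variable R : realType.

Lemma lebesgue_rV_box n (c : 'rV[R]_n) r : 0 < r ->
  lebesgue_rV R n (box c r) = ((2 * r) ^+ n)%:E.
Proof.
move=> r0; elim: n c => [|n IH] c.
  rewrite /= diracE mem_set//; by case.
pose c' : 'rV[R]_n := rsubmx (c : 'rV_(1 + n)).
have E : @cons_rV R n @^-1` box c r = ball (c 0 0) r `*` box c' r.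
  apply/seteqP; split => -[x y].
    move=> h; split => [|j].
      have := h (lshift n (0 : 'I_1)); rewrite cons_rVl /ball/= distrC.
      by congr (`|c _ _ - _| < _); apply/val_inj.
    by have := h (rshift 1 j); rewrite cons_rVr mxE.
  move=> [/= hx hy] i.
  have [j ->|j ->] := split_ordP (i : 'I_(1 + n)).
    rewrite cons_rVl /= distrC; move: hx; rewrite /ball/=.
    by congr (`|c _ _ - _| < _); apply/val_inj; rewrite (ord1 j).
  by rewrite cons_rVr; have := hy j; rewrite mxE.
transitivity ((lebesgue_measure \x lebesgue_rV R n)%E (@cons_rV R n @^-1` box c r)).
  by [].
rewrite E product_measure1E//; last exact: measurable_box.
  rewrite IH exprS.
  have -> : (((2 * r) * (2 * r) ^+ n)%:E = (2 * r)%:E * ((2 * r) ^+ n)%:E)%E by rewrite EFinM.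
  congr (_ * _)%E.
  by rewrite -[LHS]/(lebesgue_measure (ball (c 0 0) r)) lebesgue_measure_ball ?ltW// mulr_natl.
exact: measurable_ball.
Qed.

Lemma bounded_box n (D : set 'rV[R]_n) : bounded_set D ->
  exists M, 0 < M /\ D `<=` box 0 M.
Proof.
move=> [M [_ hM]]; exists (`|M| + 2); split; first by rewrite ltr_wpDl.
move=> x Dx; have h := hM (`|M| + 1) _ x Dx.
have h1 : `|x| <= `|M| + 1.
  by apply: h; rewrite (le_lt_trans (ler_norm M))// ltrDl.
rewrite box_ball ?ltr_wpDl// -ball_normE/= sub0r normrN.
by apply: le_lt_trans h1 _; rewrite ltrD2l ltr1n.
Qed.

Lemma lebesgue_rV_bounded n (D : set 'rV[R]_n) : measurable D -> bounded_set D ->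
  (lebesgue_rV R n D < +oo)%E.
Proof.
move=> mD /bounded_box[M [M0 DM]].
apply: (@le_lt_trans _ _ (lebesgue_rV R n (box 0 M))).
  by apply: le_measure => //; rewrite inE//; exact: measurable_box.
by rewrite lebesgue_rV_box// ltry.
Qed.

Lemma lebesgue_rV_open n (D : set 'rV[R]_n) : open D -> D !=set0 ->
  (0 < lebesgue_rV R n D)%E.
Proof.
move=> oD [x Dx]; have /nbhs_ballP[e /= e0 eD] : nbhs x D by exact: open_nbhs_nbhs.
apply: (@lt_le_trans _ _ (lebesgue_rV R n (box x e))).
  by rewrite lebesgue_rV_box// lte_fin exprn_gt0// mulr_gt0.
apply: le_measure; rewrite ?inE//; [exact: measurable_box|exact: open_measurable_rV|].
by rewrite box_ball.
Qed.

Lemma measurable_translation n (h : 'rV[R]_n) : measurable_fun setT (fun x : 'rV[R]_n => x + h).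
Proof.
apply: measurable_fun_rVP => i; rewrite /coord_rV.
under eq_fun do rewrite mxE.
by apply: measurable_funD => //; exact: measurable_coord.
Qed.

Lemma integral_translation n (h : 'rV[R]_n) (f : 'rV[R]_n -> R) :
  integ (lebesgue_rV R n) setT f ->
  integ (lebesgue_rV R n) setT (fun x : 'rV[R]_n => f (x + h)) /\
  \int[lebesgue_rV R n]_x f (x + h) = \int[lebesgue_rV R n]_x f x.
Proof.
move=> intf; pose mu := lebesgue_rV R n.
have mt := measurable_translation h.
have mf : measurable_fun setT f by exact: integ_measurable intf.
have mEf : measurable_fun setT (EFin \o f) by apply/measurable_EFinP.
have mfh : measurable_fun setT (fun x : 'rV[R]_n => f (x + h)) by exact: measurableT_comp.
have eqI (g : 'rV[R]_n -> \bar R) : (\int[mu]_x g x =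
    \int[pushforward mu (fun x : 'rV[R]_n => (x + h)%R)]_x g x)%E.
  by apply: esym; apply: eq_measure_integral => A mA _; exact: lebesgue_rV_translation.
have iN : mu.-integrable setT (EFin \o (fun x : 'rV[R]_n => f (x + h))).
  apply/integrableP; split; first exact/measurable_EFinP.
  have /integrableP[_] := intf; congr (_ < _)%E.
  rewrite eqI ge0_integral_pushforward//.
  by apply: measurableT_comp.
split => //; rewrite /Rintegral; congr fine.
by rewrite [RHS]eqI (integral_pushforward mt mEf).
Qed.

End lebesgue_rV_theory.

(** * Test functions *)

Section C1_functions.
Variables (R : realType) (d : nat).
Local Notation rV := 'rV[R]_d.
Local Notation e_ i := (delta_mx 0 i : 'rV[R]_d).
Implicit Types (f : rV -> R) (g : 'I_d -> rV -> R).

Lemma is_derive_line (f : rV -> R) x v l :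
  is_derive x v f l <-> is_derive (0 : R) 1 (fun h : R => f (h *: v + x)) l.
Proof.
have E : 'D_v f x = 'D_1 (fun h : R => f (h *: v + x)) 0.
  rewrite /derive; set g1 := fun h => h^-1 *: _; set g2 := fun h => h^-1 *: _.
  suff -> : g1 = g2 by [].
  by rewrite funeqE /g1 /g2 => h /=; rewrite addr0 scale0r add0r [_%:A]mulr1.
split=> -[df Df]; split.
- exact: (derivable1P f x v).1 df.
- by rewrite -E.
- exact: (derivable1P f x v).2 df.
- by rewrite E.
Qed.

Lemma is_derive_comp1 (F : R -> R) f x v F' l :
  is_derive x v f l -> is_derive (f x) 1 F F' ->
  is_derive x v (fun y => F (f y)) (F' * l).
Proof.
move=> /is_derive_line df dF; apply/is_derive_line.
by apply: (is_derive1_comp _ df); rewrite scale0r add0r.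
Qed.

(** The gradient is carried as data, so that the product and chain rules compute it, and the
    condition is pointwise, so that it applies to functions that are $C^1$ only inside [Omega]. *)
Definition C1at f g (x : rV) :=
  {for x, continuous f} /\
  forall i, is_derive x (e_ i) f (g i x) /\ {for x, continuous (g i)}.

Lemma C1at_cst c x : C1at (fun=> c) (fun _ _ => 0) x.
Proof.
split; first exact: cst_continuous.
by move=> i; split; [exact: is_derive_cst|exact: cst_continuous].
Qed.

Lemma C1at_coord j x : C1at (fun y => y 0 j) (fun i _ => (i == j)%:R) x.
Proof.
split; first exact: coord_continuous.
move=> i; split; last exact: cst_continuous.
apply/is_derive_line.
rewrite (_ : (fun h : R => _) = (fun h => (i == j)%:R * h + x 0 j)).
  apply: is_derive_eq; rewrite /GRing.scale/=; ring.
by apply/funext => h; rewrite !mxE/= eq_sym mulrC.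
Qed.

Lemma C1atD f f' g g' x : C1at f g x -> C1at f' g' x ->
  C1at (fun y => f y + f' y) (fun i y => g i y + g' i y) x.
Proof.
move=> [cf hf] [cf' hf']; split; first exact: (continuousD cf cf').
move=> i; have [h1 h2] := hf i; have [h1' h2'] := hf' i.
by split; [exact: (is_deriveD h1 h1')|exact: (continuousD h2 h2')].
Qed.

Lemma C1atM f f' g g' x : C1at f g x -> C1at f' g' x ->
  C1at (fun y => f y * f' y) (fun i y => f y * g' i y + g i y * f' y) x.
Proof.
move=> [cf hf] [cf' hf']; split; first exact: (continuousM cf cf').
move=> i; have [h1 h2] := hf i; have [h1' h2'] := hf' i; split.
  have := is_deriveM h1 h1'; congr is_derive.
  by rewrite /GRing.scale/= (mulrC (f' x)).
by apply: continuousD; [exact: (continuousM cf h2')|exact: (continuousM h2 cf')].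
Qed.

Lemma C1at_comp (F F' : R -> R) f g x : C1at f g x ->
  is_derive (f x) 1 F (F' (f x)) -> {for f x, continuous F} ->
  {for f x, continuous F'} ->
  C1at (fun y => F (f y)) (fun i y => F' (f y) * g i y) x.
Proof.
move=> [cf hf] dF cF cF'; split; first exact: continuous_comp.
move=> i; have [h1 h2] := hf i; split; first exact: is_derive_comp1.
by apply: continuousM => //; exact: (continuous_comp (f := f)).
Qed.

Lemma C1at_near f f' g g' (x : rV) : (\near x, f x = f' x) ->
  (forall i, \near x, g i x = g' i x) -> C1at f g x -> C1at f' g' x.
Proof.
move=> ff' gg' [cf hf].
have cnear (u w : rV -> R) : (\near x, u x = w x) -> {for x, continuous u} ->
    {for x, continuous w}.
  move=> uw; rewrite /prop_for /continuous_at (nbhs_singleton uw) => cu.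
  move=> A nA; have h : \forall y \near x, A (u y) by exact: cu A nA.
  suff : \forall y \near x, A (w y) by [].
  by near=> y; rewrite -(near uw y)//; near: y; exact: h.
split; first exact: cnear cf.
move=> i; have [h1 h2] := hf i; split; last exact: cnear (gg' i) h2.
by rewrite -(nbhs_singleton (gg' i)); exact: near_eq_is_derive ff' h1.
Unshelve. all: by end_near.
Qed.

Lemma Ck1P f : Ck 1 f <-> forall x, C1at f (fun i => pderiv i f) x.
Proof.
split => [[cf hf] x|h].
  split; first exact: cf.
  move=> i; have [h1 h2] := hf i; split; last exact: h2.
  exact/derivableP/h1.
split; first by move=> x; have [] := h x.
move=> i; split => x; first by have [_ /(_ i)[[]]] := h x.
by have [_ /(_ i)[]] := h x.
Qed.

Lemma C1at_pderiv f g i x : C1at f g x -> pderiv i f x = g i x.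
Proof. by move=> [_ /(_ i)[[_ <-]]]. Qed.

Lemma Ck1_C1at f g : (forall x, C1at f g x) -> Ck 1 f.
Proof.
move=> h; apply/Ck1P => x; apply: C1at_near (h x); first by near=> y.
by move=> i; near=> y; rewrite (C1at_pderiv i (h y)).
Unshelve. all: by end_near. Qed.

Variable Omega : set rV.
Hypothesis oO : open Omega.

Definition tfun f g := test_fun Omega f /\ forall i x, g i x = pderiv i f x.

Lemma tfun_C1at f g x : tfun f g -> C1at f g x.
Proof.
move=> [[/Ck1P h _] E]; apply: C1at_near (h x); first by near=> y.
by move=> i; near=> y; rewrite E.
Unshelve. all: by end_near. Qed.

Lemma test_fun_tfun f : test_fun Omega f -> tfun f (fun i => pderiv i f).
Proof. by []. Qed.

(** Around a point outside the closed set [K] the function is locally zero, hence $C^1$ with zero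
    gradient. The given [g] may be arbitrary outside [Omega], so it is cut off there before it can
    serve as a global gradient. *)
Lemma tfun_intro f g K : (forall x, Omega x -> C1at f g x) ->
  compact K -> K `<=` Omega -> (forall x, ~ K x -> f x = 0) ->
  exists h, tfun f h /\ (forall i x, Omega x -> h i x = g i x).
Proof.
move=> C1 cK KO f0.
have clK : closed K by apply: compact_closed => //; exact: norm_hausdorff.
have oK : open (~` K) by exact: closed_openC.
pose h i x := if `[< Omega x >] then g i x else 0.
have hO i x : Omega x -> h i x = g i x by rewrite /h => Ox; case: asboolP.
have hK i x : ~ K x -> h i x = 0.
  rewrite /h => Kx; case: asboolP => // Ox.
  have [_ /(_ i)[[_ <-] _]] := C1 x Ox.
  rewrite (@near_eq_derive _ _ _ _ (cst 0)) ?derive_cst//.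
  by near=> y; apply: f0; near: y; exact: open_nbhs_nbhs.
have C1h x : C1at f h x.
  have [Kx|Kx] := pselect (K x).
    apply: C1at_near (C1 x (KO _ Kx)) => [|i]; near=> y => //.
    rewrite hO//; near: y; apply: open_nbhs_nbhs; split => //; exact: KO.
  apply: C1at_near (C1at_cst 0 x) => [|i]; near=> y.
    by rewrite f0//; near: y; exact: open_nbhs_nbhs.
  by rewrite hK//; near: y; exact: open_nbhs_nbhs.
exists h; split => //; split; last by move=> i x; rewrite (C1at_pderiv i (C1h x)).
have sK : closure [set x | f x != 0] `<=` K.
  rewrite [X in _ `<=` X]((closure_id K).1 clK); apply: closure_subset => x /=.
  by apply: contra_neqP => /f0.
split; first exact: Ck1_C1at C1h.
split; last exact: subset_trans KO.
by apply: subclosed_compact cK sK; exact: closed_closure.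
Unshelve. all: by end_near. Qed.

Definition tsupp f := closure [set x : rV | f x != 0].

Lemma tfun_out f g x : tfun f g -> ~ tsupp f x -> f x = 0.
Proof.
by move=> _ h; apply: contrapT => /eqP fx; apply: h; exact: subset_closure.
Qed.

Lemma tfun_outg f g i x : tfun f g -> ~ tsupp f x -> g i x = 0.
Proof.
move=> tf h; have [_ /(_ i)[[_ <-] _]] := tfun_C1at x tf.
rewrite (@near_eq_derive _ _ _ _ (cst 0)) ?derive_cst//.
near=> y; apply: (tfun_out tf); near: y; apply: open_nbhs_nbhs.
by split => //; apply: closed_openC; exact: closed_closure.
Unshelve. all: by end_near. Qed.

Lemma tfun_sub f g : tfun f g -> tsupp f `<=` Omega.
Proof. by move=> [[_ []]]. Qed.

Lemma tfun_compact f g : tfun f g -> compact (tsupp f).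
Proof. by move=> [[_ []]]. Qed.

Lemma tfun_mull z gz f g : (forall x, Omega x -> C1at z gz x) -> tfun f g ->
  exists h, tfun (fun x => z x * f x) h /\
    forall i x, Omega x -> h i x = z x * g i x + gz i x * f x.
Proof.
move=> C1z tf.
apply: (@tfun_intro _ (fun i x => z x * g i x + gz i x * f x) (tsupp f)).
- by move=> x Ox; apply: C1atM (tfun_C1at x tf); exact: C1z.
- exact: tfun_compact tf.
- exact: tfun_sub tf.
- by move=> x /(tfun_out tf) ->; rewrite mulr0.
Qed.

Lemma compact_supp_bounded (u : rV -> R) K : compact K -> continuous u ->
  (forall x, ~ K x -> u x = 0) -> exists M, 0 <= M /\ forall x, `|u x| <= M.
Proof.
move=> cK cu u0.
have : compact (u @` K) by apply: continuous_compact => //; exact: continuous_subspaceT.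
move=> /compact_bounded[M [_ hM]].
exists (`|M| + 1); split; first by rewrite addr_ge0.
move=> x; have [Kx|/u0 ->] := pselect (K x); last by rewrite normr0 addr_ge0.
by apply: (hM (`|M| + 1)); [rewrite (le_lt_trans (ler_norm M))// ltrDl|exists x].
Qed.

Lemma tfun_cont f g : tfun f g -> continuous f.
Proof. by move=> tf x; have [] := tfun_C1at x tf. Qed.

Lemma tfun_contg f g i : tfun f g -> continuous (g i).
Proof. by move=> tf x; have [_ /(_ i)[]] := tfun_C1at x tf. Qed.

Lemma tfun_bounded f g : tfun f g -> exists M, 0 <= M /\
  (forall x, `|f x| <= M) /\ forall i x, `|g i x| <= M.
Proof.
move=> tf.
have [M [M0 hM]] := compact_supp_bounded (tfun_compact tf) (@tfun_cont f g tf)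
  (fun x => @tfun_out f g x tf).
have /choice[N hN] := fun i => compact_supp_bounded (tfun_compact tf) (@tfun_contg f g i tf)
  (fun x => @tfun_outg f g i x tf).
exists (M + \sum_i N i); have N0 i : 0 <= N i by case: (hN i).
split; first by rewrite addr_ge0// sumr_ge0.
split => [x|i x]; first by rewrite (le_trans (hM x))// lerDl sumr_ge0.
have [_ /(_ x) h] := hN i; rewrite (le_trans h)//.
by rewrite (bigD1 i)//= addrCA lerDl addr_ge0// sumr_ge0.
Qed.

Lemma tfun_mvt f g (M : R) i (x : rV) (t : R) : tfun f g -> (forall y, `|g i y| <= M) ->
  `|f (t *: e_ i + x) - f x| <= `|t| * M.
Proof.
move=> tf hM.
pose p (s : R) := f (s *: e_ i + x).
have dp (s : R) : is_derive s 1 p (g i (s *: e_ i + x)).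
  have [_ /(_ i)[/is_derive_line h _]] := tfun_C1at (s *: e_ i + x) tf.
  have h' : is_derive (s - s) 1 (fun h : R => f (h *: e_ i + (s *: e_ i + x))) (g i (s *: e_ i + x)).
    by rewrite subrr.
  have ds : is_derive s 1 (fun s0 : R => s0 - s) 1.
    by apply: is_derive_eq; rewrite subr0.
  have := @is_derive1_comp _ _ (fun s0 : R => s0 - s) s _ _ h' ds; rewrite mulr1; congr is_derive.
  by apply/funext => s0 /=; rewrite /p addrA -scalerDl subrK.
have cp : continuous p.
  by move=> s; apply: differentiable_continuous; apply/derivable1_diffP; have [] := dp s.
have -> : f x = p 0 by rewrite /p scale0r add0r.
have key a b : a <= b -> `|p b - p a| <= (b - a) * M.
  move=> ab; have [|c _ ->] := MVT_segment ab (fun s _ => dp s).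
    exact: continuous_subspaceT.
  by rewrite normrM mulrC (ger0_norm (_ : 0 <= b - a)) ?subr_ge0// ler_wpM2l ?subr_ge0.
have [t0|t0] := leP 0 t.
  by rewrite (ger0_norm t0); have := key 0 t t0; rewrite subr0.
by rewrite (ltr0_norm t0); have := key t 0 (ltW t0); rewrite distrC sub0r.
Qed.

End C1_functions.

Lemma Rintegral_dominated_cvg d (T : measurableType d) (R : realType)
    (mu : {measure set T -> \bar R}) (D : set T) (mD : measurable D)
    (f_ : nat -> T -> R) (f g : T -> R) :
  (forall n, measurable_fun D (f_ n)) -> measurable_fun D f ->
  ae_in mu D (fun x => f_ ^~ x @ \oo --> f x) -> integ mu D g ->
  (forall n x, D x -> `|f_ n x| <= g x) ->
  (fun n => \int[mu]_(x in D) f_ n x) @ \oo --> \int[mu]_(x in D) f x.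
Proof.
move=> mf_ mf ff ig fg.
have [||||| fi _ c] := @dominated_convergence _ _ _ mu _ mD
  (fun n => EFin \o f_ n) (EFin \o f) (EFin \o g).
- by move=> n; exact/measurable_EFinP.
- exact/measurable_EFinP.
- apply: (ae_in_imply _ ff) => x Dx h.
  by apply/fine_cvgP; split; [exact: nearW|exact: h].
- exact: ig.
- by apply: aeW => x n Dx; rewrite /= lee_fin; exact: fg.
by apply: fine_cvg; rewrite fineK ?(integrable_fin_num mD fi).
Qed.

Lemma integ_indic d (T : measurableType d) (R : realType)
    (mu : {measure set T -> \bar R}) (A : set T) :
  measurable A -> (mu A < +oo)%E -> integ mu setT (\1_A : T -> R).
Proof.
move=> mA Aoo; apply/integrableP; split.
  by apply/measurable_EFinP; exact: measurable_indic.
under eq_integral do rewrite /= ger0_norm//.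
by rewrite integral_indic// setIT.
Qed.

Lemma integ_cst d (T : measurableType d) (R : realType)
    (mu : {measure set T -> \bar R}) (A : set T) (k : R) :
  measurable A -> (mu A < +oo)%E -> integ mu A (fun=> k).
Proof.
move=> mA Aoo; apply/integrableP; split.
  by apply/measurable_EFinP; exact: measurable_cst.
rewrite (_ : (fun _ => _) = cst `|k|%:E)//.
by rewrite integral_cst// lte_mul_pinfty.
Qed.

(** * Integration by parts and Poincare's inequality for test functions *)

Section integration_by_parts.
Variables (R : realType) (d : nat).
Local Notation rV := 'rV[R]_d.
Local Notation e_ i := (delta_mx 0 i : 'rV[R]_d).
Local Notation mu := (lebesgue_rV R d).
Variable Omega : set rV.
Hypothesis oO : open Omega.
Hypothesis bO : bounded_set Omega.

Let mO : measurable Omega := open_measurable_rV oO.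

Lemma lebesgue_rV_box_fin B : 0 < B -> (mu (box 0 B) < +oo)%E.
Proof. by move=> B0; rewrite lebesgue_rV_box// ltry. Qed.

Lemma integ_bounded_support (u : rV -> R) M B : measurable_fun setT u ->
  0 < B -> (forall x, `|u x| <= M) -> (forall x, ~ box 0 B x -> u x = 0) ->
  integ mu setT u.
Proof.
move=> mu_ B0 uM u0.
have mB : measurable (box (0 : rV) B) by exact: measurable_box.
apply: (@integ_le_ae _ _ _ _ _ _ _ (fun x : rV => M * \1_(box 0 B) x)) => //.
  apply: ae_in_all => x _; rewrite indicE.
  have [xB|xB] := boolP (x \in box 0 B); first by rewrite mulr1.
  by rewrite mulr0 u0 ?normr0// => h; move: xB; rewrite mem_set.
apply: integZ => //; apply: integ_indic => //.
exact: lebesgue_rV_box_fin.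
Qed.

Lemma tfun_support f g : tfun Omega f g ->
  exists B, 0 < B /\ (forall x, ~ box 0 B x -> f x = 0) /\
    forall x h, ~ box 0 (B + 1) x -> `|h| <= 1 -> forall i, f (h *: e_ i + x) = 0.
Proof.
move=> tf; have [B [B0 OB]] := bounded_box bO.
have f0 x : ~ box 0 B x -> f x = 0.
  by move=> h; apply: (tfun_out tf) => /(tfun_sub tf)/OB.
exists B; split => //; split => // x h Bx h1 i; apply: f0 => Bh; apply: Bx => j.
have := Bh j; rewrite !mxE !subr0 => h2.
have h3 : `|h * (delta_mx 0 i : rV) 0 j| <= 1.
  rewrite mxE; case: (_ && _); rewrite ?mulr1 ?mulr0 ?normr0//.
rewrite mxE in h3.
have := ler_normB (h * ((0 == 0 :> 'I_1) && (j == i))%:R + x 0 j)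
  (h * ((0 == 0 :> 'I_1) && (j == i))%:R).
rewrite addrC addKr; lra.
Qed.

Lemma cvg_harmonic_deleted : (fun n => n.+1%:R^-1 : R) @ \oo --> (0 : R)^'.
Proof.
move=> A A0; have A1 : \forall x \near (0 : R), x != 0 -> A x by exact: A0.
have A2 : \forall n \near \oo, (n.+1%:R^-1 : R) != 0 -> A n.+1%:R^-1.
  exact: (@cvg_harmonic R _ A1).
suff : \forall n \near \oo, A (n.+1%:R^-1 : R) by [].
by apply: filterS A2 => n; apply; rewrite invr_eq0 pnatr_eq0.
Qed.

(** Translation invariance moves the forward quotient of [f] to a backward quotient of [psi], which
    needs only be bounded and measurable. With [psi] constant this gives the vanishing of the
    integral of a derivative; with [psi] the flux of the barrier it replaces a differentiation of
    the coefficient. *)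
Lemma difference_quotient_cvg f g i (psi : rV -> R) P :
  tfun Omega f g -> measurable_fun setT psi -> (forall x, `|psi x| <= P) ->
  (fun n => \int[mu]_x ((psi (x - n.+1%:R^-1 *: e_ i) - psi x) / n.+1%:R^-1 * f x))
    @ \oo --> \int[mu]_x (psi x * g i x).
Proof.
move=> tf mpsi psiP.
have [B [B0 [f0 fh0]]] := tfun_support tf.
have [M [M0 [fM gM]]] := tfun_bounded tf.
have P0 : 0 <= P by exact: le_trans (psiP 0).
have cf : continuous f := @tfun_cont _ _ _ f g tf.
have mf : measurable_fun setT f by exact: measurable_fun_rV_continuous.
have mg : measurable_fun setT (g i).
  by apply: measurable_fun_rV_continuous => //; exact: (@tfun_contg _ _ _ f g i tf).
pose h n : R := n.+1%:R^-1.
have h0 n : 0 < h n by rewrite invr_gt0.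
have h1 n : h n <= 1 by rewrite invf_le1// ler1n.
have nh n : `|h n| <= 1 by rewrite ger0_norm// ltW.
have mfh n : measurable_fun setT (fun x : rV => f (h n *: e_ i + x)).
  under eq_fun do rewrite addrC.
  by apply: (measurableT_comp mf); exact: measurable_translation.
have mpsih n : measurable_fun setT (fun x : rV => psi (x - h n *: e_ i)).
  by apply: (measurableT_comp mpsi); exact: measurable_translation.
pose F n x := psi x * ((f (h n *: e_ i + x) - f x) / h n).
have i1 : integ mu setT (fun x : rV => psi x * f x).
  apply: (@integ_bounded_support _ (P * M) B) => //.
  - exact: measurable_funM.
  - by move=> x; rewrite normrM ler_pM.
  - by move=> x /f0 ->; rewrite mulr0.
have i2 n : integ mu setT (fun x : rV => psi (x - h n *: e_ i) * f x).
  apply: (@integ_bounded_support _ (P * M) B) => //.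
  - exact: measurable_funM.
  - by move=> x; rewrite normrM ler_pM.
  - by move=> x /f0 ->; rewrite mulr0.
have E n : \int[mu]_x F n x =
    \int[mu]_x ((psi (x - h n *: e_ i) - psi x) / h n * f x).
  have [i3 e3] := integral_translation (h n *: e_ i) (i2 n).
  have e3' : \int[mu]_x (psi (x - h n *: e_ i) * f x) =
      \int[mu]_x (psi x * f (h n *: e_ i + x)).
    rewrite -e3; apply: eq_Rintegral => x _.
    by rewrite addrK (addrC x).
  have i3' : integ mu setT (fun x : rV => psi x * f (h n *: e_ i + x)).
    move: i3; apply: eq_integrable => // x _ /=.
    by rewrite addrK (addrC x).
  transitivity ((h n)^-1 * \int[mu]_x (psi x * f (h n *: e_ i + x) - psi x * f x)).
    rewrite -RintegralZl//; last exact: integB.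
    by apply: eq_Rintegral => x _; rewrite /F; ring.
  rewrite RintegralB// -e3' -RintegralB//; last exact: i2.
  rewrite -RintegralZl//; last by apply: integB => //; exact: i2.
  by apply: eq_Rintegral => x _; ring.
under eq_fun do rewrite -/(h _) -E.
(* The mean value inequality bounds the quotient of [f] by [M]. The box is enlarged by 1 because the
   shifts [h n] are at most 1. *)
apply: (@Rintegral_dominated_cvg _ _ _ _ _ _ _ _
  (fun x : rV => P * M * \1_(box 0 (B + 1)) x)) => //.
- move=> n; apply: measurable_funM => //.
  by apply: measurable_funM => //; exact: measurable_funB.
- exact: measurable_funM.
- apply: ae_in_all => x _; apply: cvgMr.
  have [_ /(_ i)[[df Df] _]] := tfun_C1at x tf.
  have : (fun t => t^-1 *: (f (t *: e_ i + x) - f x)) @ (0 : R)^' --> g i x.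
    by rewrite -Df; exact: df.
  move=> /(cvg_comp _ _ cvg_harmonic_deleted); apply: cvg_trans.
  by apply: near_eq_cvg; apply: nearW => n /=; rewrite /GRing.scale/= mulrC.
- apply: integZ => //; apply: integ_indic => //; first exact: measurable_box.
  by apply: lebesgue_rV_box_fin; rewrite addr_gt0.
- move=> n x _; rewrite /F indicE.
  have [xB|xB] := boolP (x \in box 0 (B + 1)).
    rewrite mulr1 normrM ler_pM// normrM normfV (ger0_norm (ltW (h0 n))).
    rewrite ler_pdivrMr// mulrC -{2}(ger0_norm (ltW (h0 n))).
    exact: (tfun_mvt x (h n) tf (gM i)).
  have nB : ~ box 0 (B + 1) x by move=> hx; move: xB; rewrite mem_set.
  rewrite fh0// f0 ?subrr ?mul0r ?mulr0 ?normr0//.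
  by move=> hB; apply: nB => j; apply: lt_trans (hB j) _; rewrite ltrDl.
Qed.

Lemma Rintegral_tfun (u : rV -> R) : (forall x, ~ Omega x -> u x = 0) ->
  \int[mu]_(x in Omega) u x = \int[mu]_x u x.
Proof.
move=> u0; rewrite Rintegral_mkcond; apply: eq_Rintegral => x _.
rewrite patchE; case: ifPn => // /negP xO; rewrite u0// => Ox.
by apply: xO; rewrite inE.
Qed.

Lemma tfunO f g x : tfun Omega f g -> ~ Omega x -> f x = 0.
Proof. by move=> tf Ox; apply: (tfun_out tf) => /(tfun_sub tf). Qed.

Lemma tfungO f g i x : tfun Omega f g -> ~ Omega x -> g i x = 0.
Proof. by move=> tf Ox; apply: (tfun_outg i tf) => /(tfun_sub tf). Qed.

Lemma Rintegral_grad_tfun f g i : tfun Omega f g ->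
  \int[mu]_(x in Omega) g i x = 0.
Proof.
move=> tf; rewrite Rintegral_tfun; last by move=> x; exact: tfungO tf.
have n1 (x : rV) : `|1 : R| <= 1 by rewrite normr1.
have h := @difference_quotient_cvg f g i (fun=> 1) 1 tf (measurable_cst _) n1.
have E : (fun n => \int[mu]_x ((1 - 1) / n.+1%:R^-1 * f x)) = fun=> 0 :> R.
  apply/funext => n; under eq_Rintegral do rewrite subrr mul0r mul0r.
  by rewrite /Rintegral integral0.
rewrite E in h.
have -> : \int[mu]_x g i x = \int[mu]_x (1 * g i x).
  by under [RHS]eq_Rintegral do rewrite mul1r.
apply/esym; apply: (@cvg_unique _ (@Rhausdorff R) _ _ _ _ _ h).
exact: cvg_cst.
Qed.

Lemma finite_Omega : (mu Omega < +oo)%E.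
Proof. exact: lebesgue_rV_bounded. Qed.

Lemma sqint_bounded (u : rV -> R) M : measurable_fun Omega u ->
  (forall x, Omega x -> `|u x| <= M) -> sqint mu Omega u.
Proof.
move=> mu_ uM; apply: (@sqint_le _ _ _ _ _ mO _ (fun=> M)) => //.
  exact: ae_in_all.
by split => //; exact: integ_cst finite_Omega.
Qed.

Lemma tfun_sqint f g : tfun Omega f g -> sqint mu Omega f.
Proof.
move=> tf; have [M [_ [fM _]]] := tfun_bounded tf.
apply: (@sqint_bounded _ M) => //; apply: measurable_fun_rV_continuous => //.
exact: (@tfun_cont _ _ _ f g tf).
Qed.

Lemma tfun_sqintg f g i : tfun Omega f g -> sqint mu Omega (g i).
Proof.
move=> tf; have [M [_ [_ gM]]] := tfun_bounded tf.
apply: (@sqint_bounded _ M) => //; apply: measurable_fun_rV_continuous => //.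
exact: (@tfun_contg _ _ _ f g i tf).
Qed.

(** The product of [z] and [f] is again a test function, and the integral of its derivative
    vanishes. *)
Lemma by_parts z gz f g i : (forall x, Omega x -> C1at z gz x) ->
  sqint mu Omega z -> sqint mu Omega (gz i) -> tfun Omega f g ->
  ip mu Omega z (g i) = - ip mu Omega (gz i) f.
Proof.
move=> C1z sz sgz tf; apply/eqP; rewrite -addr_eq0; apply/eqP.
have sf := tfun_sqint tf; have sg := tfun_sqintg i tf.
rewrite /ip -RintegralD//; try exact: sqint_integM.
have [h [th hE]] := tfun_mull oO C1z tf.
rewrite -(Rintegral_grad_tfun i th); apply: eq_Rintegral => x Ox.
by rewrite hE// -inE.
Qed.

(** Integration by parts against the coordinate $x_i$, whose derivative is 1, gives $\int f^2 = -2
    \int x_i f \partial_i f$. Cauchy-Schwarz and the bound $|x_i| \le B$ on [Omega] then give the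
    constant $4B^2$. *)
Lemma poincare_tfun (i : 'I_d) : exists C, 0 < C /\ forall f g, tfun Omega f g ->
  ip mu Omega f f <= C * ip mu Omega (g i) (g i).
Proof.
have [B [B0 OB]] := bounded_box bO.
exists (4 * B ^+ 2); split; first by rewrite mulr_gt0// exprn_gt0.
move=> f g tf.
have sf := tfun_sqint tf; have sg := tfun_sqintg i tf.
have bx : bdd mu Omega (fun x : rV => x 0 i).
  split; first exact: measurable_coord.
  exists B; apply: ae_in_all => x /OB/(_ i); rewrite mxE subr0 => h.
  exact: ltW.
have sxf : sqint mu Omega (fun x : rV => x 0 i * f x) by exact: sqintMl.
have sxg : sqint mu Omega (fun x : rV => x 0 i * g i x) by exact: sqintMl.
have := @by_parts (fun x : rV => x 0 i * f x) _ f g i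
  (fun x Ox => C1atM (C1at_coord i x) (tfun_C1at x tf)) sxf _ tf.
rewrite eqxx; have s2 : sqint mu Omega (fun y => y 0 i * g i y + 1 * f y).
  by apply: sqintD => //; exact: sqintZ.
move=> /(_ s2); rewrite ipDl//; last exact: sqintZ.
rewrite ipZl// mul1r ip_MlC => h.
have {}h : ip mu Omega f f = - 2 * ip mu Omega f (fun x : rV => x 0 i * g i x).
  by move: h; rewrite (ipC _ _ (g i)) ip_MlC; lra.
have CS := ip_CS mO sf sxg.
set N := ip mu Omega f f in h CS *; set X := ip mu Omega f _ in h CS.
have N0 : 0 <= N by exact: ip_ge0.
have gB : ip mu Omega (fun x : rV => x 0 i * g i x) (fun x : rV => x 0 i * g i x) <=
    B ^+ 2 * ip mu Omega (g i) (g i).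
  rewrite -[leRHS](_ : ip mu Omega (fun x : rV => B * g i x) (fun x : rV => B * g i x) = _); last first.
    by rewrite ipZl ?ipZr//; [ring|exact: sqintZ].
  apply: ip_le => //; try exact: sqintZ.
  apply: ae_in_all => x /OB/(_ i); rewrite mxE subr0 => /ltW h1.
  rewrite -!expr2 !exprMn ler_wpM2r ?sqr_ge0//.
  by rewrite -[leLHS](real_normK (num_real _)) lerXn2r ?nnegrE// ltW.
set Y := ip mu Omega _ _ in CS gB; set G := ip mu Omega (g i) (g i) in gB *.
have [->|N1] := eqVneq N 0; first by rewrite mulr_ge0 ?ip_ge0// mulr_ge0// sqr_ge0.
have Np : 0 < N by rewrite lt0r N1.
rewrite -(ler_pM2l Np); have : N * N = 4 * X ^+ 2 by rewrite h; ring.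
have : N * Y <= N * (B ^+ 2 * G) by rewrite ler_wpM2l.
lra.
Qed.

End integration_by_parts.

Section positive_part_square.
Variable R : realType.

(** The square makes the positive part $C^1$, as both the bump functions and the truncation
    require. *)
Definition sqpos (t : R) := Num.max 0 t ^+ 2.

Lemma sqpos_gt0 t : (0 < sqpos t) = (0 < t).
Proof.
rewrite /sqpos; have [t0|t0] := ltP 0 t; first by rewrite exprn_gt0.
by rewrite expr0n ltxx.
Qed.

Lemma sqpos_ge0 t : 0 <= sqpos t. Proof. exact: sqr_ge0. Qed.

Lemma sqpos_eq0 t : t <= 0 -> sqpos t = 0.
Proof. by rewrite /sqpos; case: ltP => // _ _; rewrite expr0n. Qed.

Lemma continuous_max0 : continuous (fun t : R => Num.max 0 t).
Proof. by move=> t; apply: (@continuous_max R R (cst 0) id) => //; exact: cst_continuous. Qed.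

Lemma is_derive_sqpos t : is_derive t (1 : R) sqpos (2 * Num.max 0 t).
Proof.
have [t0|t0|<-] := ltgtP 0 t.
- apply: (@near_eq_is_derive _ _ _ (fun s : R => s ^+ 2)).
    near=> s; rewrite /sqpos; case: ltP => //; rewrite leNgt => /negP[].
    by near: s; exact: lt_nbhsr.
  by apply: is_derive_eq; rewrite /GRing.scale/=; ring.
- apply: (@near_eq_is_derive _ _ _ (cst 0)).
    near=> s; rewrite sqpos_eq0//; apply: ltW; near: s; exact: lt_nbhsl.
  by apply: is_derive_eq; rewrite mulr0.
- have E (h : R) : `|h^-1 *: (sqpos (h *: 1 + 0) - sqpos 0)| <= `|h|.
    have [->|h0] := eqVneq h 0; first by rewrite invr0 [_ *: _]mul0r !normr0.
    rewrite (sqpos_eq0 (lexx 0)) subr0 addr0 /sqpos normrM normfV.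
    rewrite [_%:A]mulr1 ler_pdivrMl ?normr_gt0// normrX -expr2 lerXn2r ?nnegrE//.
    by have [h1|h1] := ltP 0 h; rewrite ?normr0.
  have c : h^-1 *: (sqpos (h *: 1 + 0) - sqpos 0) @[h --> (0 : R)^'] --> (0 : R).
    apply/norm_cvg0P; apply: (@squeeze_cvgr _ _ _ _ (fun=> 0) (fun h : R => `|h|)).
    - by apply: nearW => y; rewrite normr_ge0; exact: E.
    - exact: cvg_cst.
    - rewrite -[X in _ --> X](@normr0 _ R); apply: cvg_norm; exact: nbhs_dnbhs.
  split; first by apply/cvg_ex; exists 0; exact: c.
  by rewrite ?maxxx mulr0; apply/cvg_lim.
Unshelve. all: by end_near. Qed.

End positive_part_square.

(** * The fundamental lemma of the calculus of variations *)

Section fundamental_lemma.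
Variables (R : realType) (d : nat).
Local Notation rV := 'rV[R]_d.
Local Notation mu := (lebesgue_rV R d).

Definition rect (a b : rV) : set rV := [set x | forall i, a 0 i < x 0 i < b 0 i].
Definition crect (a b : rV) : set rV := [set x | forall i, a 0 i <= x 0 i <= b 0 i].

Lemma measurable_rect a b : measurable (rect a b).
Proof.
rewrite (_ : rect a b = \bigcap_(i in [set: 'I_d])
    ((fun x : rV => x 0 i) @^-1` `]a 0 i, b 0 i[%classic)).
  apply: fin_bigcap_measurable => // i _.
  by rewrite -[X in measurable X]setTI; apply: measurable_coord.
apply/seteqP; split => [x h i _|x h i]; first by rewrite /= in_itv/=; exact: h.
by have := h i I; rewrite /= in_itv.
Qed.

Lemma compact_crect a b : compact (crect a b).
Proof.
rewrite (_ : crect a b =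
    [set x : rV | forall i, `[a 0 i, b 0 i]%classic (x ord0 i)]).
  have := @rV_compact R d (fun i => `[a 0 i, b 0 i]%classic).
  by apply => i; exact: segment_compact.
apply/seteqP; split => x h i; first by rewrite /= in_itv/=; exact: h.
by have := h i; rewrite /= in_itv.
Qed.

Lemma C1at_exp (f : rV -> R) g n : (forall x, C1at f g x) ->
  exists h, forall x, C1at (fun y => f y ^+ n) h x.
Proof.
move=> fg; elim: n => [|n [h IH]].
  by exists (fun _ _ => 0) => x; under eq_fun do rewrite expr0; exact: C1at_cst.
by eexists => x; under eq_fun do rewrite exprS; exact: C1atM.
Qed.

Variable Omega : set rV.
Hypothesis oO : open Omega.
Hypothesis bO : bounded_set Omega.
Let mO : measurable Omega := open_measurable_rV oO.

Definition bump (a b : rV) (x : rV) :=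
  \prod_(i < d) sqpos ((x 0 i - a 0 i) * (b 0 i - x 0 i)).

Lemma bump_C1 a b : exists g, forall x, C1at (bump a b) g x.
Proof.
have fC1 i : exists g, forall x : rV,
    C1at (fun x : rV => sqpos ((x 0 i - a 0 i) * (b 0 i - x 0 i))) g x.
  eexists => x.
  apply: (@C1at_comp _ _ (@sqpos R) (fun t => 2 * Num.max 0 t)
     (fun x : rV => (x 0 i - a 0 i) * (b 0 i - x 0 i))).
  - apply: C1atM.
      apply: C1atD; first exact: C1at_coord.
      exact: C1at_cst.
    rewrite (_ : (fun y : rV => b 0 i - y 0 i) = (fun y : rV => b 0 i + (-1) * y 0 i)).
      apply: C1atD; first exact: C1at_cst.
      by apply: C1atM; [exact: C1at_cst|exact: C1at_coord].
    by apply/funext => y; rewrite mulN1r.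
  - exact: is_derive_sqpos.
  - apply: differentiable_continuous; apply/derivable1_diffP.
    by have [] := @is_derive_sqpos R ((x 0 i - a 0 i) * (b 0 i - x 0 i)).
  - by apply: continuousM; [exact: cst_continuous|exact: continuous_max0].
rewrite /bump; elim: (index_enum _) => [|i s [g IH]].
  exists (fun _ _ => 0) => x; under eq_fun do rewrite big_nil; exact: C1at_cst.
have [gi hgi] := fC1 i; eexists => x.
under eq_fun do rewrite big_cons; apply: C1atM; [exact: hgi|exact: IH].
Qed.

Lemma bump_ge0 a b x : 0 <= bump a b x.
Proof. by apply: prodr_ge0 => i _; exact: sqpos_ge0. Qed.

Lemma bump_nrect (a b x : rV) : (forall i, a 0 i < b 0 i) -> ~ rect a b x ->
  bump a b x = 0.
Proof.
move=> ab h; have [i hi] : exists i, ~ (a 0 i < x 0 i < b 0 i).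
  by apply: contrapT => h2; apply: h => i; apply: contrapT => h3; apply: h2; exists i.
rewrite /bump (bigD1 i)//= sqpos_eq0 ?mul0r// leNgt; apply/negP => h2; apply: hi.
have abi := ab i; have [h3|h3] := ltP (a 0 i) (x 0 i).
  by move: h2; rewrite pmulr_rgt0 subr_gt0.
have h4 : 0 < b 0 i - x 0 i by lra.
by move: h2; rewrite pmulr_lgt0// subr_gt0 ltNge h3.
Qed.

Lemma bump_out (a b x : rV) : (forall i, a 0 i < b 0 i) -> ~ crect a b x ->
  bump a b x = 0.
Proof.
move=> ab h; apply: bump_nrect => // h1; apply: h => i.
by have /andP[/ltW -> /ltW ->] := h1 i.
Qed.

Lemma bump_rect a b x : rect a b x -> 0 < bump a b x.
Proof.
move=> h; apply: prodr_gt0 => i _; rewrite sqpos_gt0.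
by have /andP[? ?] := h i; rewrite mulr_gt0 ?subr_gt0.
Qed.

(** The indicator of the open box is the bounded pointwise limit of $1 - (1 - \beta/M)^n$, where
    $\beta$ is a bump positive exactly on the box and at most $M$. Each of these functions is a test
    function supported in the closed box, so dominated convergence applies. *)
Lemma integral_rect (h : rV -> R) a b : integ mu Omega h ->
  (forall f, test_fun Omega f -> \int[mu]_(x in Omega) (h x * f x) = 0) ->
  crect a b `<=` Omega -> (forall i, a 0 i < b 0 i) ->
  \int[mu]_(x in rect a b) h x = 0.
Proof.
move=> ih h0 abO ab; have [g gC1] := bump_C1 a b.
have mh := integ_measurable ih.
have b0 := bump_ge0 a b.
have [M [M0 bM]] : exists M, 0 < M /\ forall x, bump a b x <= M.
  have cb : continuous (bump a b) by move=> x; have [] := gC1 x.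
  have [M [M0 hM]] := compact_supp_bounded (@compact_crect a b) cb
    (fun x => @bump_out a b x ab).
  exists (M + 1); split => [|x]; first by rewrite ltr_wpDl.
  by rewrite (le_trans (ler_norm _))// (le_trans (hM x))// lerDl.
pose psi x := 1 - bump a b x / M.
have psi01 x : 0 <= psi x <= 1.
  rewrite /psi subr_ge0 ler_pdivrMr// mul1r bM/=.
  by rewrite lerBlDr lerDl divr_ge0// ltW.
pose phi n x := 1 - psi x ^+ n.
have phi_out n x : ~ crect a b x -> phi n x = 0.
  by move=> hx; rewrite /phi /psi bump_out// mul0r subr0 expr1n subrr.
have tphi n : test_fun Omega (phi n).
  have [gpsi Cpsi] : exists h, forall x, C1at psi h x.
    eexists => x; rewrite /psi.
    rewrite (_ : (fun _ => _) = (fun y => 1 + (- M^-1) * bump a b y)).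
      apply: C1atD; first exact: C1at_cst.
      by apply: C1atM; [exact: C1at_cst|exact: gC1].
    by apply/funext => y; rewrite mulNr mulrC.
  have [gn Cn] := C1at_exp n Cpsi.
  have C1 x : C1at (phi n) (fun i y => 0 + (-1 * gn i y + 0 * psi y ^+ n)) x.
    rewrite /phi (_ : (fun _ => _) = (fun y => 1 + (-1) * psi y ^+ n)).
      apply: C1atD; first exact: C1at_cst.
      by apply: C1atM; [exact: C1at_cst|exact: Cn].
    by apply/funext => y; rewrite mulN1r.
  by have [H [[]]] := tfun_intro oO (fun x _ => C1 x) (@compact_crect a b) abO
    (phi_out n).
have phi01 n x : `|phi n x| <= 1.
  have /andP[p0 p1] := psi01 x.
  rewrite /phi ger0_norm ?subr_ge0 ?exprn_ile1//.
  by rewrite lerBlDr lerDl exprn_ge0.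
have mR := @measurable_rect a b.
have mphi n : measurable_fun Omega (phi n).
  apply: measurable_fun_rV_continuous => //.
  exact: (@tfun_cont _ _ _ _ _ (test_fun_tfun (tphi n))).
have RO : rect a b `<=` Omega.
  by move=> x hx; apply: abO => i; have /andP[/ltW -> /ltW ->] := hx i.
have c : (fun n => \int[mu]_(x in Omega) (h x * phi n x)) @ \oo -->
    \int[mu]_(x in Omega) (h x * \1_(rect a b) x).
  apply: (@Rintegral_dominated_cvg _ _ _ _ _ mO _ _ (fun x => `|h x|)).
  - by move=> n; exact: measurable_funM.
  - by apply: measurable_funM.
  - apply: ae_in_all => x _; apply: cvgMr.
    rewrite indicE; have [hx|hx] := pselect (rect a b x).
      rewrite (mem_set hx) -[X in _ --> X]subr0; apply: cvgB; first exact: cvg_cst.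
      apply: cvg_expr; have /andP[p0 p1] := psi01 x; rewrite ger0_norm//.
      by rewrite /psi ltrBlDr ltrDl divr_gt0// bump_rect.
    rewrite (memNset hx) (_ : (fun _ => _) = fun=> 0); first exact: cvg_cst.
    by apply/funext => n; rewrite /phi /psi bump_nrect// mul0r subr0 expr1n subrr.
  - exact: integrable_norm.
  - by move=> n x _; rewrite normrM ler_piMr.
have {}c : (fun=> 0 : R) @ \oo --> \int[mu]_(x in Omega) (h x * \1_(rect a b) x).
  by apply: cvg_trans c; apply: near_eq_cvg; apply: nearW => n; rewrite h0.
have := @cvg_unique _ (@Rhausdorff R) _ _ _ _ c (cvg_cst _).
rewrite Rintegral_mkcond => E.
rewrite Rintegral_mkcond -[RHS]E; apply: eq_Rintegral => x _.
rewrite !patchE indicE; case: ifPn => [xR|]; last by rewrite mulr0; case: ifPn.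
by rewrite mem_set ?mulr1//; apply: RO; rewrite -inE.
Qed.

End fundamental_lemma.

Section fundamental_lemma.
Variables (R : realType) (d : nat).
Local Notation rV := 'rV[R]_d.
Local Notation mu := (lebesgue_rV R d).

Definition rects : set (set rV) := [set A | exists a b, A = rect a b].

Lemma rects_generate : @measurable _ rV = <<s rects >>.
Proof.
apply/seteqP; split; last first.
  apply: smallest_sub; first exact: sigma_algebra_measurable.
  by move=> _ [a [b ->]]; exact: measurable_rect.
pose coord i (x : g_sigma_algebraType rects) : R := (x : rV) 0 i.
have mcoord i : measurable_fun setT (coord i).
  apply: (measurability _ (RGenOpens.measurableE R)).
  move=> _ [_ [a [b ->] <-]]; rewrite setTI.
  (* A slab in one coordinate is not a box; it is exhausted by letting the other coordinates range
     over $]-n, n[$. *)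
  rewrite (_ : coord i @^-1` _ = \bigcup_n (rect
     (\row_j if j == i then a else - n%:R) (\row_j if j == i then b else n%:R))).
    apply: bigcupT_measurable => n; apply: sub_sigma_algebra.
    by exists (\row_j if j == i then a else - n%:R), (\row_j if j == i then b else n%:R).
  apply/seteqP; split => [x|x [n _ h]]; last first.
    by have := h i; rewrite !mxE eqxx /= in_itv.
  rewrite /= in_itv/= => xab.
  pose y : rV := x.
  have [n hn] : exists n : nat, forall j, `|y 0 j| < n%:R.
    exists (\sum_j Num.truncn `|y 0%R j|).+1 => j.
    apply: lt_le_trans (truncnS_gt _) _; rewrite ler_nat ltnS.
    by rewrite (bigD1 j)//= leq_addr.
  exists n => // j; rewrite !mxE; case: eqP => [->//|_].
  by have := hn j; rewrite ltr_norml.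
apply: smallest_sub; first exact: smallest_sigma_algebra.
rewrite -bigcup_seq => A [i _ [C mC <-]].
exact: (mcoord i measurableT C mC).
Qed.

Lemma rectI a b a' b' : rect a b `&` rect a' b' =
  rect (\row_i Num.max (a 0 i) (a' 0 i)) (\row_i Num.min (b 0 i) (b' 0 i)) :> set rV.
Proof.
apply/seteqP; split => x.
  move=> [h h'] i; rewrite !mxE gt_max lt_min.
  by have /andP[-> ->] := h i; have /andP[-> ->] := h' i.
move=> h; split => i; have := h i; rewrite !mxE gt_max lt_min;
  by move=> /andP[/andP[? ?] /andP[? ?]]; apply/andP.
Qed.

Variable Omega : set rV.
Hypothesis oO : open Omega.
Hypothesis bO : bounded_set Omega.
Let mO : measurable Omega := open_measurable_rV oO.

(** Boxes generate the sigma-algebra and are stable under intersection, so by Dynkin's theorem the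
    integral of [h] vanishes over every measurable part of the box. *)
Lemma fundamental_lemma_rect (h : rV -> R) a b : integ mu Omega h ->
  (forall f, test_fun Omega f -> \int[mu]_(x in Omega) (h x * f x) = 0) ->
  crect a b `<=` Omega -> ae_in mu (rect a b) (fun x => h x = 0).
Proof.
move=> ih h0 abO.
have mQ := measurable_rect a b.
have QO : rect a b `<=` Omega.
  by move=> x hx; apply: abO => i; have /andP[/ltW -> /ltW ->] := hx i.
have iQ : integ mu (rect a b) h by exact: integrableS ih.
have iS S : measurable S -> integ mu (S `&` rect a b) h.
  by move=> mS; apply: integrableS iQ => //; exact: measurableI.
have R0 a' b' : crect a' b' `<=` Omega -> \int[mu]_(x in rect a' b') h x = 0.
  move=> abO'; have [ab|] := pselect (forall i, a' 0 i < b' 0 i).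
    exact: (integral_rect oO ih h0 abO' ab).
  move=> nab; suff -> : rect a' b' = set0 by exact: Rintegral_set0.
  apply/seteqP; split => // x hx; apply: nab => i.
  by have /andP[] := hx i; exact: lt_trans.
have key S : measurable S -> \int[mu]_(x in S `&` rect a b) h x = 0.
  rewrite rects_generate; move: S.
  apply: (@dynkin_induction _ rV rects (fun S => \int[mu]_(x in S `&` rect a b) h x = 0)).
  - exact: rects_generate.
  - by move=> _ _ [a1 [b1 ->]] [a2 [b2 ->]]; rewrite rectI; do 2 eexists.
  - by rewrite setTI; exact: R0.
  - move=> _ [a1 [b1 ->]]; rewrite rectI; apply: R0 => x hx; apply: abO => i.
    have := hx i; rewrite !mxE ge_max le_min.
    by move=> /andP[/andP[_ ->] /andP[_ ->]].
  - move=> S mS S0.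
    have := @Rintegral_setU _ _ _ mu (S `&` rect a b) (~` S `&` rect a b) h.
    rewrite -setIUl setUv setTI (R0 a b abO) S0 add0r => <- //.
    + exact: measurableI.
    + by apply: measurableI => //; exact: measurableC.
    + by rewrite disj_set2E setIACA setICr set0I.
  - move=> F mF tF F0; rewrite setI_bigcupl /Rintegral integral_bigcup//.
    + rewrite eseries0// => k _ _.
      have := F0 k; rewrite /Rintegral => Fk.
      by rewrite -(fineK (integrable_fin_num (measurableI _ _ (mF k) mQ) (iS _ (mF k)))) Fk.
    + apply/trivIsetP => i j _ _ ij; rewrite setIACA.
      by move/trivIsetP : tF => /(_ _ _ I I ij) ->; rewrite set0I.
    + by move=> k; exact: measurableI.
    + by rewrite -setI_bigcupl; apply: iS; exact: bigcupT_measurable.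
have := @integral_ae_eq _ _ _ mu _ mQ (cst 0%E) (EFin \o h) iQ (measurable_cst _).
move=> H; have {}H : ae_eq mu (rect a b) (EFin \o h) (cst 0%E).
  apply: H => E ER mE; rewrite integral0.
  have iE : integ mu E h by apply: integrableS iQ.
  have := key E mE; rewrite (setIidl ER) /Rintegral => e0.
  by rewrite -[LHS](fineK (integrable_fin_num mE iE)) e0.
move: H; apply: filterS => x hx Qx.
by have [] := hx Qx.
Qed.

(** Every point of [Omega] lies in a rational cube with closure in [Omega]. The cubes are indexed
    through [unpickle], so that the exceptional sets form a sequence of null sets. *)
Lemma fundamental_lemma (h : rV -> R) : integ mu Omega h ->
  (forall f, test_fun Omega f -> \int[mu]_(x in Omega) (h x * f x) = 0) ->
  ae_in mu Omega (fun x => h x = 0).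
Proof.
move=> ih h0.
pose a (cq : 'rV[rat]_d * rat) : rV := \row_i (ratr (cq.1 0 i) - ratr cq.2).
pose b (cq : 'rV[rat]_d * rat) : rV := \row_i (ratr (cq.1 0 i) + ratr cq.2).
pose P n (x : rV) := if unpickle n is Some cq then
  crect (a cq) (b cq) `<=` Omega -> rect (a cq) (b cq) x -> h x = 0 else True.
have : \forall x \ae mu, forall n, P n x.
  apply: ae_foralln => n; rewrite /P; case: (unpickle n) => [cq|]; last exact: aeW.
  have [abO|nO] := pselect (crect (a cq) (b cq) `<=` Omega); last exact: aeW.
  have := fundamental_lemma_rect ih h0 abO.
  by rewrite /ae_in; apply: filterS => x hx _.
apply: filterS => x hx Ox.
have [cq [q0 [cx cO]]] := rbox_sub oO Ox.
have := hx (pickle cq); rewrite /P pickleK; apply.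
  move=> y hy; apply: cO => i; have := hy i; rewrite !mxE => /andP[h1 h2].
  by rewrite ler_norml; apply/andP; split; lra.
move=> i; have := cx i; rewrite !mxE ltr_norml => /andP[h1 h2].
by apply/andP; split; lra.
Qed.

End fundamental_lemma.

(** * Truncation and sequences *)

Lemma sqr_cvg (R : realType) (a : nat -> R) l :
  (fun n => (a n - l) ^+ 2) @ \oo --> (0 : R) -> a @ \oo --> l.
Proof.
move=> c; apply/cvgrPdist_le => e e0.
have [N HN] := cvg0_le c (exprn_gt0 2 e0); exists N => // n /= Nn.
have := HN n Nn; rewrite /= distrC -[X in X <= _](real_normK (num_real _)).
by rewrite ler_pXn2r// nnegrE ltW.
Qed.

Lemma cvg0_bound (R : realType) (a b : nat -> R) C : (forall n, 0 <= a n <= C * b n) ->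
  b @ \oo --> (0 : R) -> a @ \oo --> (0 : R).
Proof.
move=> ab cb; apply: (@squeeze_cvgr _ _ _ _ (fun=> 0) (fun n => C * b n)).
- exact: nearW.
- exact: cvg_cst.
- by rewrite -[X in _ --> X](mulr0 C); apply: cvgMr.
Qed.

Section ip_limits.
Context d (T : measurableType d) (R : realType).
Variables (mu : {measure set T -> \bar R}) (D : set T) (mD : measurable D).

Lemma ip_cvg (u_ : nat -> T -> R) u v : (forall n, sqint mu D (u_ n)) ->
  sqint mu D u -> sqint mu D v -> (fun n => sqdist mu D (u_ n) u) @ \oo --> (0 : R) ->
  (fun n => ip mu D (u_ n) v) @ \oo --> ip mu D u v.
Proof.
move=> su_ su sv c; apply: sqr_cvg; apply: (cvg0_bound (C := ip mu D v v)) c => n.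
by rewrite sqr_ge0/= -ipBl// mulrC; apply: ip_CS => //; exact: sqintB.
Qed.

Lemma ip_cvgr (u_ : nat -> T -> R) u v : (forall n, sqint mu D (u_ n)) ->
  sqint mu D u -> sqint mu D v -> (fun n => sqdist mu D (u_ n) u) @ \oo --> (0 : R) ->
  (fun n => ip mu D v (u_ n)) @ \oo --> ip mu D v u.
Proof.
move=> su_ su sv c; rewrite ipC; under eq_fun do rewrite ipC; exact: ip_cvg.
Qed.

Lemma sqint_integ u : (mu D < +oo)%E -> sqint mu D u -> integ mu D u.
Proof.
move=> Doo [mu_ iu]; apply: (@integ_le_ae _ _ _ _ _ _ _ (fun x => u x ^+ 2 + 1)) => //.
  apply: ae_in_all => x _; rewrite ler_norml.
  have := sqr_ge0 (u x - 1); have := sqr_ge0 (u x + 1).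
  by rewrite sqrrB1 sqrrD1 => h1 h2; apply/andP; split; have := sqr_ge0 (u x); lra.
by apply: integD => //; exact: integ_cst.
Qed.

End ip_limits.

Section negative_part.
Variable R : realType.

Definition negsq (t : R) := sqpos (- t).
(* A bounded [C^1] surrogate of the negative part: it vanishes on [t >= 0], and
   [dN ^+ 2 <= - dN], so that testing an equation with [nN w] controls the
   gradient of [nN w]. *)
Definition nN (t : R) := 1 - (1 + negsq t)^-1.
Definition dN (t : R) := - (2 * Num.max 0 (- t)) / (1 + negsq t) ^+ 2.

Lemma negsq_ge0 t : 0 <= negsq t. Proof. exact: sqpos_ge0. Qed.

Let den_gt0 t : 0 < 1 + negsq t. Proof. by rewrite ltr_wpDr// negsq_ge0. Qed.

Lemma is_derive_nN t : is_derive t (1 : R) nN (dN t).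
Proof.
have h1 : is_derive t (1 : R) negsq ((2 * Num.max 0 (- t)) * (-1)).
  by apply: (is_derive1_comp (is_derive_sqpos (- t))).
have dne : 1 + negsq t != 0 by exact: lt0r_neq0.
have h2 : is_derive t (1 : R) (fun s => (1 + negsq s)) ((2 * Num.max 0 (- t)) * (-1)).
  rewrite -[X in is_derive _ _ _ X]add0r.
  exact: (is_deriveD (is_derive_cst (1 : R) t (1 : R)) h1).
have h3 : is_derive t (1 : R) (fun s => (1 + negsq s)^-1)
    (- (1 + negsq t) ^- 2 *: ((2 * Num.max 0 (- t)) * (-1))).
  have [d2 D2] := h2; split; first exact: derivableV.
  by rewrite deriveV// D2.
have := is_deriveB (is_derive_cst (1 : R) t (1 : R)) h3.
congr is_derive; rewrite /dN /GRing.scale/=; by field.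
Qed.

Lemma nN_ge0 t : 0 <= nN t.
Proof. by rewrite subr_ge0 invf_le1// lerDl negsq_ge0. Qed.

Lemma nN_le1 t : nN t <= 1.
Proof. by rewrite lerBlDr lerDl invr_ge0 ltW. Qed.

Lemma nN_eq0 t : (nN t == 0) = (0 <= t).
Proof.
rewrite subr_eq0 eq_sym invr_eq1 -subr_eq0 addrC addKr.
apply/idP/idP => [/eqP h|h]; last by rewrite /negsq sqpos_eq0 ?oppr_le0.
rewrite leNgt; apply/negP => t0.
have : 0 < negsq t by rewrite sqpos_gt0 oppr_gt0.
by rewrite h ltxx.
Qed.

Lemma mul_nN_le0 t : t * nN t <= 0.
Proof.
have [t0|t0] := leP 0 t.
  by have := nN_eq0 t; rewrite t0 => /eqP ->; rewrite mulr0.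
by rewrite nmulr_rle0// nN_ge0.
Qed.

Lemma dN_le0 t : dN t <= 0.
Proof.
rewrite /dN mulNr oppr_le0 divr_ge0 ?exprn_ge0 ?(ltW (den_gt0 t))//.
by rewrite mulr_ge0// le_max lexx.
Qed.

Lemma dN_geN1 t : -1 <= dN t.
Proof.
rewrite /dN mulNr lerN2 ler_pdivrMr ?exprn_gt0// mul1r.
rewrite /negsq /sqpos; set s := Num.max 0 (- t).
have h1 : 2 * s <= 1 + s ^+ 2.
  by have := sqr_ge0 (s - 1); rewrite sqrrB1 mulr2n; lra.
have h2 : 1 <= 1 + s ^+ 2 by rewrite lerDl sqr_ge0.
apply: le_trans h1 _; rewrite -[leLHS]mulr1 [leRHS]expr2.
by rewrite ler_wpM2l// (le_trans ler01).
Qed.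

Lemma dN_sqr t : dN t ^+ 2 <= - dN t.
Proof. by have := dN_le0 t; have := dN_geN1 t; nra. Qed.

Lemma norm_dN t : `|dN t| <= 1.
Proof. by rewrite ler0_norm ?dN_le0//; have := dN_geN1 t; lra. Qed.

Lemma continuous_nN : continuous nN.
Proof.
move=> t; apply: differentiable_continuous; apply/derivable1_diffP.
by have [] := is_derive_nN t.
Qed.

Lemma continuous_dN : continuous dN.
Proof.
have cm : continuous (fun t : R => Num.max 0 (- t)).
  move=> t; apply: (@continuous_comp _ _ _ -%R (fun t : R => Num.max 0 t)).
    exact: opp_continuous.
  exact: continuous_max0.
have cs : continuous (fun t : R => 1 + negsq t).
  move=> t; apply: continuousD; first exact: cst_continuous.
  exact: (@continuousM _ _ _ _ t (cm t) (cm t)).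
move=> t; apply: (@continuousM _ _ (fun t : R => - (2 * Num.max 0 (- t))) (fun t => ((1 + negsq t) ^+ 2)^-1)).
  apply: continuousN; apply: continuousM; first exact: cst_continuous.
  exact: cm.
apply: continuousV; first by rewrite expf_neq0// lt0r_neq0.
exact: (@continuousM _ _ _ _ t (cs t) (cs t)).
Qed.

Lemma nN_lip s t : `|nN s - nN t| <= `|s - t|.
Proof.
wlog st : s t / t <= s.
  have [st|/ltW st] := leP t s; first exact.
  by move=> /(_ t s st); rewrite distrC (distrC t).
have [|c _ ->] := MVT_segment st (fun x _ => is_derive_nN x).
  by apply: continuous_subspaceT; exact: continuous_nN.
by rewrite normrM ler_piMl// norm_dN.
Qed.

End negative_part.

Lemma cvg_bigsum (R : realType) (I : Type) (s : seq I) (F : I -> nat -> R) (l : I -> R) :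
  (forall i, F i @ \oo --> l i) ->
  (fun n => \sum_(i <- s) F i n) @ \oo --> \sum_(i <- s) l i.
Proof.
move=> h; elim: s => [|i s IH].
  by rewrite big_nil; under eq_fun do rewrite big_nil; exact: cvg_cst.
by rewrite big_cons; under eq_fun do rewrite big_cons; exact: cvgD.
Qed.

Lemma ip_ge0_ae d (T : measurableType d) (R : realType)
    (mu : {measure set T -> \bar R}) (D : set T) (u v : T -> R) :
  measurable D -> sqint mu D u -> sqint mu D v ->
  ae_in mu D (fun x => 0 <= u x * v x) -> 0 <= ip mu D u v.
Proof.
move=> mD su sv h; have s0 := sqint0 mu D.
have <- : ip mu D (fun=> 0) (fun=> 0) = 0 by apply: ip0l => //; exact: ae_in_all.
apply: ip_le => //; apply: (ae_in_imply _ h) => x _.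
by rewrite mul0r.
Qed.

Lemma ip_le0_ae d (T : measurableType d) (R : realType)
    (mu : {measure set T -> \bar R}) (D : set T) (u v : T -> R) :
  measurable D -> sqint mu D u -> sqint mu D v ->
  ae_in mu D (fun x => u x * v x <= 0) -> ip mu D u v <= 0.
Proof.
move=> mD su sv h; rewrite -oppr_ge0 -ipNl//; apply: ip_ge0_ae => //.
  exact: sqintN.
by apply: (ae_in_imply _ h) => x _; rewrite mulNr oppr_ge0.
Qed.

Lemma cvg_seq_ge0 (R : realType) (a : nat -> R) l : a @ \oo --> l ->
  (forall n, 0 <= a n) -> 0 <= l.
Proof.
move=> c a0; rewrite -(cvg_lim _ c)//; apply: limr_ge; last exact: nearW.
by apply/cvg_ex; exists l.
Qed.

(** * Convexity and Lipschitz bounds for $t^{-\theta}$ *)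

Section negative_powers.
Variables (R : realType) (theta : R).
Hypothesis theta0 : 0 <= theta.

Lemma powRN_le (s t : R) : 0 < s -> s <= t -> t `^ (- theta) <= s `^ (- theta).
Proof.
move=> s0 st; have t0 : 0 < t by exact: lt_le_trans st.
rewrite !powRN lef_pV2 ?posrE ?powR_gt0//.
by apply: ge0_ler_powR => //; rewrite nnegrE ltW.
Qed.

(** By homogeneity it suffices to treat $r = t/s$, where $r^{-\theta} = e^{-\theta \ln r} \ge 1 -
    \theta \ln r \ge 1 - \theta(r - 1)$. *)
Lemma powRN_tangent (s t : R) : 0 < s -> 0 < t ->
  s `^ (- theta) - theta * s `^ (- (1 + theta)) * (t - s) <= t `^ (- theta).
Proof.
move=> s0 t0; pose r := t / s; have r0 : 0 < r by rewrite divr_gt0.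
have tE : t = r * s by rewrite /r mulfVK// lt0r_neq0.
have rE : 1 - theta * (r - 1) <= r `^ (- theta).
  rewrite /powR gt_eqF//; apply: le_trans (expR_ge1Dx _).
  have -> : ln r = ln (1 + (r - 1)) by rewrite subrKC.
  rewrite mulNr lerD2l lerN2 ler_wpM2l//; apply: le_ln1Dx; lra.
have -> : s `^ (- (1 + theta)) = s `^ (- theta) / s.
  rewrite opprD addrC powRB; last by rewrite lt0r_neq0// implybT.
  by rewrite powRr1// ltW.
rewrite tE powRM ?(ltW r0) ?(ltW s0)//.
have -> : s `^ (- theta) - theta * (s `^ (- theta) / s) * (r * s - s) =
    (1 - theta * (r - 1)) * s `^ (- theta) by field; exact: lt0r_neq0.
by rewrite ler_wpM2r// powR_ge0.
Qed.

(** The tangent inequality at the smaller point bounds the drop by the slope there, which is at most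
    the slope at [k]. *)
Lemma powRN_lip (k s t : R) : 0 < k -> k <= s -> k <= t ->
  `|s `^ (- theta) - t `^ (- theta)| <= theta * k `^ (- (1 + theta)) * `|s - t|.
Proof.
move=> k0; wlog st : s t / s <= t.
  move=> H ks kt; have [/H|/ltW /H] := leP s t; first exact.
  by move=> /(_ kt ks); rewrite distrC (distrC t).
move=> ks kt; have s0 : 0 < s by exact: lt_le_trans ks.
have t0 : 0 < t by exact: lt_le_trans kt.
rewrite ger0_norm ?subr_ge0 ?powRN_le// distrC ger0_norm ?subr_ge0//.
have h : s `^ (- (1 + theta)) <= k `^ (- (1 + theta)).
  rewrite !powRN lef_pV2 ?posrE ?powR_gt0//.
  by apply: ge0_ler_powR; rewrite ?nnegrE ?(ltW k0) ?(ltW s0)// addr_ge0.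
apply: (@le_trans _ _ (theta * s `^ (- (1 + theta)) * (t - s))).
  by have := powRN_tangent s0 t0; lra.
by rewrite ler_wpM2r ?subr_ge0// ler_wpM2l.
Qed.

End negative_powers.

Section square_integrable_sequences.
Context d (T : measurableType d) (R : realType).
Variables (mu : {measure set T -> \bar R}) (D : set T) (mD : measurable D).
Local Notation sqint := (sqint mu D).
Local Notation ip := (ip mu D).
Local Notation sqdist := (sqdist mu D).
Local Notation ae_in := (ae_in mu D).
Implicit Types u v : T -> R.

(** The free weight [t] keeps the factor of one term close to 1. With the factor 2 of [ip_sqrD_le],
    the recursion on tails below would close only for a ratio less than one half. *)
Lemma ip_sqrD_weighted t u v : 0 < t -> sqint u -> sqint v ->
  ip (fun x => u x + v x) (fun x => u x + v x) <=
  (1 + t^-1) * ip u u + (1 + t) * ip v v.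
Proof.
move=> t0 su sv; have suv := sqintD mD su sv.
rewrite ipDl// !ipDr// (ipC mu D v u).
have := ip_ge0 mu D (fun x => u x - t * v x); have stv := sqintZ mD t sv.
rewrite ip_sqrB// ipZl// !ipZr// => h.
have h2 : 0 <= t^-1 * (ip u u - 2 * (t * ip u v) + t * (t * ip v v)).
  by rewrite mulr_ge0// invr_ge0 ltW.
have h3 : t^-1 * (ip u u - 2 * (t * ip u v) + t * (t * ip v v)) =
  t^-1 * ip u u - 2 * ip u v + t * ip v v by field; exact: lt0r_neq0.
rewrite h3 in h2; move: h2; rewrite !mulrDl !mul1r.
set A := t^-1 * _; lra.
Qed.

Lemma sqint_partial_sum (z : nat -> T -> R) n : (forall n, sqint (z n)) ->
  sqint (fun x => \sum_(i < n) z i x).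
Proof. by move=> sz; apply: sqint_sum => // i; exact: sz. Qed.

(** The tail from [n] is the term [z n] plus the tail from [n.+1]. The constant [L] is the fixed
    point of $L = (1 + t^{-1})C + (1 + t)\rho L$, which makes the induction on the length of the
    tail close. *)
Lemma geometric_partial_sums (z : nat -> T -> R) C rho : 0 <= C -> 0 <= rho < 1 ->
  (forall n, sqint (z n)) -> (forall n, ip (z n) (z n) <= C * rho ^+ n) ->
  exists L, 0 <= L /\ forall j n,
    sqdist (fun x => \sum_(i < n + j) z i x) (fun x => \sum_(i < n) z i x)
    <= L * rho ^+ n.
Proof.
move=> C0 /andP[r0 r1] sz zC.
(* With this [t], $1 - (1 + t)\rho = (1 - \rho)(2 - \rho)/2 > 0$, so [L] is well defined and
   nonnegative. *)
pose t := (1 - rho) / 2; have t0 : 0 < t by rewrite divr_gt0// subr_gt0.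
have tr : 0 < 1 - (1 + t) * rho by rewrite /t; nra.
pose L := (1 + t^-1) * C / (1 - (1 + t) * rho).
have t1 : 0 <= 1 + t^-1 by rewrite addr_ge0// invr_ge0 ltW.
have L0 : 0 <= L by rewrite divr_ge0 ?(ltW tr)// mulr_ge0.
exists L; split => // j; elim: j => [|j IH] n.
  rewrite addn0 /sqdist /ip.
  under eq_Rintegral do rewrite subrr mul0r.
  by rewrite /Rintegral integral0 mulr_ge0// exprn_ge0.
have sS m := sqint_partial_sum m sz.
have -> : sqdist (fun x => \sum_(i < n + j.+1) z i x) (fun x => \sum_(i < n) z i x)
   = ip (fun x => z n x + (\sum_(i < n.+1 + j) z i x - \sum_(i < n.+1) z i x))
        (fun x => z n x + (\sum_(i < n.+1 + j) z i x - \sum_(i < n.+1) z i x)).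
  by apply: eq_Rintegral => x _; rewrite addnS -addSn [\sum_(i < n.+1) _]big_ord_recr/=; ring.
apply: le_trans (ip_sqrD_weighted t0 (sz n) (sqintB mD (sS _) (sS _))) _.
have h1 := IH n.+1.
apply: (@le_trans _ _ ((1 + t^-1) * (C * rho ^+ n) + (1 + t) * (L * rho ^+ n.+1))).
  by apply: lerD; apply: ler_wpM2l => //; rewrite addr_ge0// ltW.
have -> : (1 + t^-1) * (C * rho ^+ n) = L * (1 - (1 + t) * rho) * rho ^+ n.
  by rewrite /L mulfVK ?lt0r_neq0// mulrA.
rewrite exprS le_eqVlt; apply/orP; left; apply/eqP; ring.
Qed.

Lemma bounded_nondecreasing_cauchy (a : nat -> R) B : nondecreasing_seq a ->
  (forall n, a n <= B) -> forall e, 0 < e -> exists N, forall m n,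
    (N <= n)%N -> (n <= m)%N -> a m - a n <= e.
Proof.
move=> nd aB e e0.
have cv : cvgn a by apply: nondecreasing_is_cvgn => //; exists B => _ [n _ <-].
have /cvgrPdist_le /(_ e e0)[N _ HN] := cv.
exists N => m n Nn nm; have := HN n Nn; have := nondecreasing_cvgn_le nd cv m.
by rewrite ler_norml => h /andP[_ h2]; lra.
Qed.

(** For $0 \le v \le u$ one has $\int uv \ge \int v^2$, hence $\|u - v\|^2 \le \|u\|^2 - \|v\|^2$.
    The bounded nondecreasing sequence of squared norms therefore controls the distances. *)
Lemma nondecreasing_sqint_cauchy (u : nat -> T -> R) B : (forall n, sqint (u n)) ->
  ae_in (fun x => 0 <= u 0%N x) -> (forall n, ae_in (fun x => u n x <= u n.+1 x)) ->
  (forall n, ip (u n) (u n) <= B) -> forall e, 0 < e -> exists N, forall m n,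
    (N <= m)%N -> (N <= n)%N -> sqdist (u m) (u n) <= e.
Proof.
move=> su u0 uS uB.
have nd n j : ae_in (fun x => u n x <= u (n + j)%N x).
  elim: j => [|j IH]; first by rewrite addn0; exact: ae_in_all.
  rewrite addnS; apply: (ae_in_imply2 _ IH (uS _)) => x _; exact: le_trans.
have pos n : ae_in (fun x => 0 <= u n x).
  by apply: (ae_in_imply2 _ u0 (nd 0%N n)) => x _; rewrite add0n; exact: le_trans.
have key n j : sqdist (u (n + j)%N) (u n) <=
    ip (u (n + j)%N) (u (n + j)%N) - ip (u n) (u n).
  rewrite /sqdist ip_sqrB//.
  have : ip (u n) (u n) <= ip (u (n + j)%N) (u n).
    apply: ip_le => //; apply: (ae_in_imply2 _ (pos n) (nd n j)) => x _ h1 h2.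
    by rewrite ler_wpM2r.
  lra.
have ndN : nondecreasing_seq (fun n => ip (u n) (u n)).
  apply/nondecreasing_seqP => n; have := key n 1%N; rewrite addn1.
  by have := sqdist_ge0 mu D (u n.+1) (u n); lra.
move=> e e0; have [N HN] := bounded_nondecreasing_cauchy ndN uB e0.
exists N => m n; wlog nm : m n / (n <= m)%N.
  move=> H Nm Nn; have [/H|/ltnW /H] := leqP n m; first exact.
  by rewrite sqdistC; apply.
move=> Nm Nn; have := key n (m - n)%N; rewrite subnKC// => h.
exact: le_trans h (HN m n Nn nm).
Qed.

Lemma cvg_sqdist_shift (u : nat -> T -> R) w :
  (fun n => sqdist (u n.+1) w) @ \oo --> (0 : R) ->
  (fun n => sqdist (u n) w) @ \oo --> (0 : R).
Proof. by move=> c; rewrite -cvg_shiftS. Qed.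

Lemma ae_ge_limit (u : nat -> T -> R) w k : (forall n, sqint (u n)) -> sqint w ->
  (fun n => sqdist (u n) w) @ \oo --> (0 : R) ->
  (forall n, ae_in (fun x => k <= u n x)) -> ae_in (fun x => k <= w x).
Proof.
move=> su sw c uk; have [s [_ aes]] := ae_subsequence mD su sw c.
have aek : ae_in (fun x => forall n, k <= u n x).
  have : \forall x \ae mu, forall n, D x -> k <= u n x.
    by apply: ae_foralln => n; exact: uk.
  by rewrite /ae_in; apply: filterS => x h Dx n; exact: h.
apply: (ae_in_imply2 _ aek aes) => x _ h1 h2.
have : 0 <= w x - k.
  apply: (@cvg_seq_ge0 _ (fun n => u (s n) x - k)); last by move=> n; rewrite subr_ge0.
  by apply: cvgB; [exact: h2|exact: cvg_cst].
by rewrite subr_ge0.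
Qed.

Lemma sqdist_unique (u : nat -> T -> R) v w : (forall n, sqint (u n)) -> sqint v ->
  sqint w -> (fun n => sqdist (u n) v) @ \oo --> (0 : R) ->
  (fun n => sqdist (u n) w) @ \oo --> (0 : R) -> ae_in (fun x => v x = w x).
Proof.
move=> su sv sw cv cw.
have h : sqdist v w <= 0.
  apply/ler_addgt0Pr => e e0; rewrite add0r; have e4 : 0 < e / 4 by rewrite divr_gt0.
  have [N1 H1] := cvg0_le cv e4; have [N2 H2] := cvg0_le cw e4.
  pose n := maxn N1 N2; have h1 := H1 n (leq_maxl _ _); have h2 := H2 n (leq_maxr _ _).
  by have := sqdist_tri mD sv sw (su n); rewrite (sqdistC mu D v (u n)) /=; lra.
apply: (ae_in_imply _ (ip_eq0 mD (sqintB mD sv sw) h)) => x _ /eqP.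
by rewrite subr_eq0 => /eqP.
Qed.

End square_integrable_sequences.

Section bounded_coefficients.
Context d (T : measurableType d) (R : realType).
Variables (mu : {measure set T -> \bar R}) (D : set T) (mD : measurable D).
Implicit Types p q u v : T -> R.

Lemma bddD p q : bdd mu D p -> bdd mu D q -> bdd mu D (fun x => p x + q x).
Proof.
move=> [mp [M pM]] [mq [N qN]]; split; first exact: measurable_funD.
exists (M + N); apply: (ae_in_imply2 _ pM qN) => x _ h1 h2.
by apply: le_trans (ler_normD _ _) _; exact: lerD.
Qed.

Lemma bddZ r p : bdd mu D p -> bdd mu D (fun x => p x * r).
Proof.
move=> [mp [M pM]]; split; first exact: measurable_funM.
exists (M * `|r|); apply: (ae_in_imply _ pM) => x _ h.
by rewrite normrM ler_wpM2r.
Qed.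

Lemma weighted_CS p u v : bdd mu D p -> ae_in mu D (fun x => 0 <= p x) ->
  sqint mu D u -> sqint mu D v ->
  ip mu D (fun x => p x * u x) v ^+ 2 <=
  ip mu D (fun x => p x * u x) u * ip mu D (fun x => p x * v x) v.
Proof.
move=> bp p0 su sv.
have spu := sqintMl mD bp su; have spv := sqintMl mD bp sv.
have pos w : sqint mu D w -> 0 <= ip mu D (fun x => p x * w x) w.
  move=> sw; apply: ip_ge0_ae => //; first exact: sqintMl.
  by apply: (ae_in_imply _ p0) => x _ px; rewrite -mulrA mulr_ge0// -expr2 sqr_ge0.
apply: quad_disc; [exact: pos|exact: pos|move=> t].
have stv := sqintZ mD t sv; have stpv := sqintZ mD t spv.
have suv := sqintB mD su stv; have := pos _ suv.
have -> : (fun x => p x * (u x - t * v x)) = (fun x => p x * u x - t * (p x * v x)).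
  by apply/funext => x; ring.
rewrite (ipBl mD spu stpv suv) (ipBr mD su stv spu) (ipBr mD su stv stpv).
rewrite !ipZl// !ipZr//.
have -> : ip mu D (fun x => p x * v x) u = ip mu D (fun x => p x * u x) v.
  by apply: eq_Rintegral => x _; ring.
by lra.
Qed.

End bounded_coefficients.

Section essential_infimum.
Variables (R : realType) (d : nat) (Omega : set 'rV[R]_d).
Local Notation rV := 'rV[R]_d.
Local Notation mu := (lebesgue_rV R d).
Hypothesis oO : open Omega.
Hypothesis O0 : Omega !=set0.
Let mO : measurable Omega := open_measurable_rV oO.
Local Notation ae_in := (ae_in mu Omega).
Implicit Types u v : rV -> R.

Lemma essinf_ae u v : ae_in (fun x => u x = v x) -> essinf Omega u = essinf Omega v.
Proof.
move=> uv; congr fine; apply: eq_ess_inf.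
move: uv; rewrite /ae_in; apply: filterS => x h.
by rewrite /patch; case: ifPn => //; rewrite inE => Ox /=; rewrite h.
Qed.

(** The bound [k] and the positive measure of the nonempty open set [Omega] make the essential
    infimum finite. Otherwise [fine] would return its default value. *)
Lemma essinf_ge u k : ae_in (fun x => k <= u x) ->
  k <= essinf Omega u /\ ae_in (fun x => essinf Omega u <= u x).
Proof.
move=> ku; rewrite /essinf; set f := patch _ _ _.
have kf : (k%:E <= ess_inf mu f)%E.
  apply/ess_infP; move: ku; rewrite /ae_in; apply: filterS => x h.
  by rewrite /f /patch; case: ifPn => [|_]; [rewrite inE => Ox /=; rewrite lee_fin h|rewrite leey].
have fle : ae_in (fun x => (ess_inf mu f <= (u x)%:E)%E).
  have := ess_inf_le mu f; rewrite /ae_in; apply: filterS => x h Ox.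
  by move: h; rewrite /f /patch mem_set.
have fin : ess_inf mu f \is a fin_num.
  rewrite fin_numE; apply/andP; split.
    by apply/eqP => h; move: kf; rewrite h.
  apply/eqP => h; have := lebesgue_rV_open oO O0; rewrite lt0e => /andP[/eqP + _]; apply.
  move: fle; rewrite h => [[N [mN N0 sN]]].
  apply/eqP; rewrite -measure_le0 -N0; apply: le_measure; rewrite ?inE//.
  by move=> x Ox; apply: sN => /= /(_ Ox); rewrite leye_eq.
split; first by rewrite -lee_fin fineK.
by apply: (ae_in_imply _ fle) => x _; rewrite -lee_fin fineK.
Qed.

End essential_infimum.

(** * Weak gradients and linear problems *)

Section sobolev.
Variables (R : realType) (d : nat) (Omega : set 'rV[R]_d).
Local Notation rV := 'rV[R]_d.
Local Notation mu := (lebesgue_rV R d).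
Hypothesis oO : open Omega.
Hypothesis bO : bounded_set Omega.
Let mO : measurable Omega := open_measurable_rV oO.
Local Notation sqint := (sqint mu Omega).
Local Notation ip := (ip mu Omega).
Local Notation sqdist := (sqdist mu Omega).
Local Notation ae_in := (ae_in mu Omega).
Local Notation bdd := (bdd mu Omega).
Local Notation is_wgrad := (is_wgrad Omega).
Implicit Types (u v : rV -> R) (g h : 'I_d -> rV -> R).

Definition sqint_pair u g := sqint u /\ forall i, sqint (g i).

Definition pdist u g v h := sqdist u v + \sum_i sqdist (g i) (h i).

Lemma pdist_ge0 u g v h : 0 <= pdist u g v h.
Proof. by rewrite addr_ge0 ?sqdist_ge0// sumr_ge0// => i _; exact: sqdist_ge0. Qed.

Lemma pdist_tri v h u g w k : sqint_pair u g -> sqint_pair v h ->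
  sqint_pair w k -> pdist u g w k <= 2 * pdist u g v h + 2 * pdist v h w k.
Proof.
move=> [su sg] [sv sh] [sw sk]; rewrite /pdist.
have h1 := sqdist_tri mO su sw sv.
have h2 : \sum_i sqdist (g i) (k i) <=
    2 * (\sum_i sqdist (g i) (h i)) + 2 * (\sum_i sqdist (h i) (k i)).
  by rewrite !mulr_sumr -big_split/=; apply: ler_sum => i _; exact: sqdist_tri.
lra.
Qed.

Lemma sqdist_le_pdist u g v h : sqdist u v <= pdist u g v h.
Proof. by rewrite lerDl sumr_ge0// => i _; exact: sqdist_ge0. Qed.

Lemma sqdistg_le_pdist u g v h i : sqdist (g i) (h i) <= pdist u g v h.
Proof.
rewrite /pdist (bigD1 i)//= addrCA lerDl addr_ge0 ?sqdist_ge0//.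
by rewrite sumr_ge0// => j _; exact: sqdist_ge0.
Qed.

(** The closure, in the product $L^2$ distance, of the graph of the gradient on test functions.
    Keeping [g] as an argument avoids the choice hidden in [wgrad]; [H10_W0] translates to and from
    [H10]. *)
Definition W0 u g := sqint_pair u g /\
  forall e, 0 < e -> exists f k, tfun Omega f k /\ pdist f k u g <= e.

Lemma tfun_sqint_pair f k : tfun Omega f k -> sqint_pair f k.
Proof.
by move=> tf; split => [|i]; [exact: tfun_sqint tf|exact: tfun_sqintg tf].
Qed.

Lemma W0_closed (u_ : nat -> rV -> R) (g_ : nat -> 'I_d -> rV -> R) u g : (forall n, W0 (u_ n) (g_ n)) ->
  sqint_pair u g -> (fun n => pdist (u_ n) (g_ n) u g) @ \oo --> (0 : R) -> W0 u g.
Proof.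
move=> H Hs c; split => // e e0; have e4 : 0 < e / 4 by rewrite divr_gt0.
have [N HN] := cvg0_le c e4; have /= hN := HN N (leqnn N).
have [sN /(_ _ e4)[f [k [tf hf]]]] := H N.
exists f, k; split => //.
by have := pdist_tri (tfun_sqint_pair tf) sN Hs; lra.
Qed.

Lemma tfun_W0 f k : tfun Omega f k -> W0 f k.
Proof.
move=> tf; split => [|e e0]; first exact: tfun_sqint_pair.
exists f, k; split => //; rewrite /pdist.
have Z w : sqdist w w = 0.
  rewrite /sqdist /ip; under eq_Rintegral do rewrite subrr mul0r.
  by rewrite /Rintegral integral0.
by rewrite Z big1 ?addr0 ?ltW.
Qed.

Lemma W0_seq u g : W0 u g -> exists f_ k_, (forall n, tfun Omega (f_ n) (k_ n)) /\
  (fun n => pdist (f_ n) (k_ n) u g) @ \oo --> (0 : R).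
Proof.
move=> [Hs H].
have /choice[F HF] n : exists fk, tfun Omega fk.1 fk.2 /\
    pdist fk.1 fk.2 u g <= n.+1%:R^-1.
  have n0 : 0 < n.+1%:R^-1 :> R by rewrite invr_gt0.
  by have [f [k hfk]] := H _ n0; exists (f, k).
exists (fun n => (F n).1), (fun n => (F n).2); split => [n|]; first by case: (HF n).
apply: (@squeeze_cvgr _ _ _ _ (fun=> 0) (fun n => n.+1%:R^-1)).
- by apply: nearW => n; rewrite pdist_ge0/=; case: (HF n).
- exact: cvg_cst.
- exact: cvg_harmonic.
Qed.

Lemma sqint_pairP (r : R) u g v h : sqint_pair u g -> sqint_pair v h ->
  sqint_pair (fun x => r * u x + v x) (fun i x => r * g i x + h i x).
Proof.
by move=> [su sg] [sv sh]; split => [|i]; apply: sqintD => //; exact: sqintZ.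
Qed.

Lemma sqdist_lin (r : R) u v u' v' : sqint u -> sqint v -> sqint u' -> sqint v' ->
  sqdist (fun x => r * u x + v x) (fun x => r * u' x + v' x) <=
  2 * r ^+ 2 * sqdist u u' + 2 * sqdist v v'.
Proof.
move=> su sv su' sv'.
have s1 := sqintB mO su su'; have s2 := sqintB mO sv sv'.
have := ip_sqrD_le mO (sqintZ mO r s1) s2.
rewrite ipZl// ?ipZr//; last exact: sqintZ.
rewrite /sqdist expr2 -!mulrA; congr (_ <= _).
by apply: eq_Rintegral => x _; ring.
Qed.

Lemma tfunP (r : R) f k f' k' : tfun Omega f k -> tfun Omega f' k' ->
  tfun Omega (fun x => r * f x + f' x) (fun i x => r * k i x + k' i x).
Proof.
move=> tf tf'.
have C1 x : C1at (fun x => r * f x + f' x)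
    (fun i x => (r * k i x + 0 * f x) + k' i x) x.
  apply: C1atD; last exact: tfun_C1at tf'.
  by apply: C1atM; [exact: C1at_cst|exact: tfun_C1at tf].
split; last by move=> i x; rewrite (C1at_pderiv i (C1 x)) mul0r addr0.
have cU : compact (tsupp f `|` tsupp f').
  by apply: compactU; [exact: tfun_compact tf|exact: tfun_compact tf'].
have sU : tsupp f `|` tsupp f' `<=` Omega.
  by move=> x [/(tfun_sub tf)|/(tfun_sub tf')].
have := tfun_intro oO (fun x _ => C1 x) cU sU _.
case=> [x /not_orP[h1 h2]|h [[]] //].
by rewrite (tfun_out tf h1) (tfun_out tf' h2) mulr0 addr0.
Qed.

Lemma W0P (r : R) u g v h : W0 u g -> W0 v h ->
  W0 (fun x => r * u x + v x) (fun i x => r * g i x + h i x).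
Proof.
move=> [s1 H1] [s2 H2]; split; first exact: sqint_pairP.
move=> e e0.
have r0 : 0 < 4 * (r ^+ 2 + 1) by rewrite mulr_gt0// ltr_wpDl// sqr_ge0.
have [f1 [k1 [t1 h1]]] := H1 _ (divr_gt0 e0 r0).
have [f2 [k2 [t2 h2]]] := H2 _ (divr_gt0 e0 (@ltr0n R 4)).
exists (fun x => r * f1 x + f2 x), (fun i x => r * k1 i x + k2 i x).
split; first exact: tfunP.
have [sf1 sk1] := tfun_sqint_pair t1; have [sf2 sk2] := tfun_sqint_pair t2.
have [su sg] := s1; have [sv sh] := s2.
apply: (@le_trans _ _ (2 * r ^+ 2 * pdist f1 k1 u g + 2 * pdist f2 k2 v h)).
  rewrite /pdist !mulrDr addrACA; apply: lerD; first exact: sqdist_lin.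
  by rewrite !mulr_sumr -big_split/=; apply: ler_sum => i _; exact: sqdist_lin.
have h3 : 2 * r ^+ 2 * pdist f1 k1 u g <= e / 2.
  apply: (@le_trans _ _ (2 * (r ^+ 2 + 1) * (e / (4 * (r ^+ 2 + 1))))).
    apply: ler_pM => //; first by rewrite mulr_ge0// sqr_ge0.
      exact: pdist_ge0.
    by rewrite ler_wpM2l// lerDl.
  have -> : 2 * (r ^+ 2 + 1) * (e / (4 * (r ^+ 2 + 1))) = e / 2.
    by field; rewrite lt0r_neq0// ltr_wpDl// sqr_ge0.
  exact: lexx.
lra.
Qed.

Lemma W0_0 : W0 (fun=> 0) (fun _ _ => 0).
Proof.
apply: tfun_W0.
have C1 (x : rV) : Omega x -> C1at (fun=> 0 : R) (fun _ _ => 0) x.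
  by move=> _; exact: C1at_cst.
have [|//|//|h [th hE]] := @tfun_intro R d Omega oO _ _ set0 C1.
  exact: compact0.
have [t1 t2] := th; split => // i x; rewrite (C1at_pderiv i (C1at_cst 0 x))//.
Qed.

Lemma W0_ae u g v h : W0 u g -> sqint_pair v h -> ae_in (fun x => u x = v x) ->
  (forall i, ae_in (fun x => g i x = h i x)) -> W0 v h.
Proof.
move=> [[su sg] H] [sv sh] uv gh; split => // e /H[f [k [tf hf]]].
exists f, k; split => //; apply: le_trans hf; rewrite le_eqVlt; apply/orP; left.
have [sf sk] := tfun_sqint_pair tf.
apply/eqP; congr (_ + _).
  apply: (ip_ae mO); try exact: (sqintB mO);
    by apply: (ae_in_imply _ uv) => x _ ->.
apply: eq_bigr => i _; apply: (ip_ae mO); try exact: (sqintB mO);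
  by apply: (ae_in_imply _ (gh i)) => x _ ->.
Qed.

Definition gsq g := \sum_i ip (g i) (g i).

Lemma gsq_ge0 g : 0 <= gsq g.
Proof. by rewrite sumr_ge0// => i _; exact: ip_ge0. Qed.

Lemma sqdist0 u : sqdist u (fun=> 0) = ip u u.
Proof. by apply: eq_Rintegral => x _; rewrite subr0. Qed.

Lemma sqdist0l u : sqdist (fun=> 0) u = ip u u.
Proof. by rewrite sqdistC sqdist0. Qed.

(** Passage to the limit from test functions. The squared triangle inequality is used once for the
    function and once for its derivative, each time with a factor 2, hence the constant [4 * C], and
    an error $\varepsilon$ in the approximation costs at most $(2 + 4C)\varepsilon$. *)
Lemma poincare (i : 'I_d) : exists C, 0 < C /\ forall u g, W0 u g ->
  ip u u <= C * gsq g.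
Proof.
have [C [C0 HC]] := poincare_tfun oO bO i.
exists (4 * C); split; first by rewrite mulr_gt0.
move=> u g [[su sg] H]; apply/ler_addgt0Pr => e e0.
have c0 : 0 < 2 + 4 * C by rewrite addr_gt0// mulr_gt0.
have [f [k [tf hf]]] := H _ (divr_gt0 e0 c0).
have [sf sk] := tfun_sqint_pair tf.
have h1 : sqdist f u <= e / (2 + 4 * C) by exact: le_trans (sqdist_le_pdist _ _ _ _) hf.
have h2 : sqdist (k i) (g i) <= e / (2 + 4 * C).
  exact: le_trans (sqdistg_le_pdist _ _ _ _ i) hf.
have s0 := sqint0 mu Omega.
have h3 := sqdist_tri mO s0 su sf; rewrite !sqdist0l in h3.
have h4 := sqdist_tri mO s0 (sk i) (sg i); rewrite !sqdist0l sqdistC in h4.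
have h5 := HC f k tf.
have h6 : ip (g i) (g i) <= gsq g.
  by rewrite /gsq (bigD1 i)//= lerDl sumr_ge0// => j _; exact: ip_ge0.
have h7 : C * ip (k i) (k i) <= C * (2 * gsq g + 2 * (e / (2 + 4 * C))).
  by rewrite ler_wpM2l ?(ltW C0)//; lra.
have h8 : e / (2 + 4 * C) * (2 + 4 * C) = e by field; exact: lt0r_neq0.
lra.
Qed.

Lemma is_wgrad_tfun u g f k i : is_wgrad u g -> tfun Omega f k ->
  ip u (k i) = - ip (g i) f.
Proof.
move=> /(_ i)[_ H] [tf kE]; rewrite -(H _ tf).
by apply: eq_Rintegral => x _; rewrite kE.
Qed.

Lemma is_wgrad_intro u g : (forall i, sqint (g i)) ->
  (forall f k i, tfun Omega f k -> ip u (k i) = - ip (g i) f) -> is_wgrad u g.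
Proof.
move=> sg H i; split; first exact: sg.
by move=> f tf; exact: (H _ _ i (test_fun_tfun tf)).
Qed.

Lemma C1_is_wgrad z gz : (forall x, Omega x -> C1at z gz x) ->
  sqint z -> (forall i, sqint (gz i)) -> is_wgrad z gz.
Proof.
by move=> C1z sz sgz; apply: is_wgrad_intro => // f k i tf; exact: by_parts.
Qed.

Lemma sqdist_cvg (u_ : nat -> rV -> R) (g_ : nat -> 'I_d -> rV -> R) u g :
  (fun n => pdist (u_ n) (g_ n) u g) @ \oo --> (0 : R) ->
  (fun n => sqdist (u_ n) u) @ \oo --> (0 : R).
Proof.
apply: (cvg0_bound (C := 1)) => n.
by rewrite sqdist_ge0/= mul1r sqdist_le_pdist.
Qed.

Lemma sqdistg_cvg (u_ : nat -> rV -> R) (g_ : nat -> 'I_d -> rV -> R) u g i :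
  (fun n => pdist (u_ n) (g_ n) u g) @ \oo --> (0 : R) ->
  (fun n => sqdist (g_ n i) (g i)) @ \oo --> (0 : R).
Proof.
apply: (cvg0_bound (C := 1)) => n.
by rewrite sqdist_ge0/= mul1r sqdistg_le_pdist.
Qed.

Lemma W0_is_wgrad u g : W0 u g -> is_wgrad u g.
Proof.
move=> Hu; have [[su sg] _] := Hu; apply: is_wgrad_intro => // f k i tf.
have [f_ [k_ [tf_ c]]] := W0_seq Hu.
have [sf sk] := tfun_sqint_pair tf.
have sf_ n := (tfun_sqint_pair (tf_ n)).1.
have sk_ n := (tfun_sqint_pair (tf_ n)).2 i.
have c1 := ip_cvg mO sf_ su (sk i) (sqdist_cvg c).
have c2 := ip_cvg mO sk_ (sg i) sf (sqdistg_cvg i c).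
have E n : ip (f_ n) (k i) = - ip (k_ n i) f.
  apply: (by_parts oO bO _ _ _ tf) => // x _; exact: tfun_C1at.
have c3 : (fun n => ip (f_ n) (k i)) @ \oo --> - ip (g i) f.
  by under eq_fun do rewrite E; exact: cvgN.
exact: (@cvg_unique _ (@Rhausdorff R) _ _ _ _ c1 c3).
Qed.

Lemma is_wgrad_sqint u g i : is_wgrad u g -> sqint (g i).
Proof. by case/(_ i). Qed.

Lemma is_wgrad_unique u v g h i : is_wgrad u g -> is_wgrad v h -> sqint u ->
  sqint v -> ae_in (fun x => u x = v x) -> ae_in (fun x => g i x = h i x).
Proof.
move=> Hg Hh su sv uv.
have sg := is_wgrad_sqint i Hg; have sh := is_wgrad_sqint i Hh.
have : ae_in (fun x => g i x - h i x = 0).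
  apply: (fundamental_lemma oO) => [|f tf].
    by apply: (sqint_integ mO); [exact: finite_Omega|exact: sqintB].
  have tf' := test_fun_tfun tf; have [sf sk] := tfun_sqint_pair tf'.
  rewrite -/(ip (fun x => g i x - h i x) f) ipBl//.
  have := is_wgrad_tfun i Hg tf'; have := is_wgrad_tfun i Hh tf'.
  rewrite (ip_ae mO sv su (sk i) (sk i)) => [->|//|]; first by lra.
    by apply: (ae_in_imply _ uv) => x _ ->.
  exact: ae_in_all.
by apply: ae_in_imply => x _ /eqP; rewrite subr_eq0 => /eqP.
Qed.

Lemma H1_sqint u : H1 Omega u -> sqint u. Proof. by case. Qed.

Lemma H1_wgrad u : H1 Omega u -> is_wgrad u (wgrad Omega u).
Proof. by move=> [_ [g Hg]]; apply: (@getPex _ (is_wgrad u)); exists g. Qed.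

Lemma is_wgrad_H1 u g : sqint u -> is_wgrad u g -> H1 Omega u.
Proof. by move=> su Hg; split => //; exists g. Qed.

Lemma wgrad_ae u g i : sqint u -> is_wgrad u g ->
  ae_in (fun x => wgrad Omega u i x = g i x).
Proof.
move=> su Hg; apply: (@is_wgrad_unique u u) => //; last exact: ae_in_all.
exact: H1_wgrad (is_wgrad_H1 su Hg).
Qed.

Lemma is_wgradP (r : R) u g v h : sqint u -> sqint v -> is_wgrad u g -> is_wgrad v h ->
  is_wgrad (fun x => r * u x + v x) (fun i x => r * g i x + h i x).
Proof.
move=> su sv Hg Hh.
have sg i := is_wgrad_sqint i Hg; have sh i := is_wgrad_sqint i Hh.
apply: is_wgrad_intro => [i|f k i tf]; first by apply: sqintD => //; exact: sqintZ.
have [sf sk] := tfun_sqint_pair tf.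
have sru := sqintZ mO r su; have srg := sqintZ mO r (sg i).
rewrite !ipDl// !ipZl// (is_wgrad_tfun i Hg tf) (is_wgrad_tfun i Hh tf); ring.
Qed.

Lemma is_wgradB u g v h : sqint u -> sqint v -> is_wgrad u g -> is_wgrad v h ->
  is_wgrad (fun x => u x - v x) (fun i x => g i x - h i x).
Proof.
move=> su sv Hg Hh; have := is_wgradP (-1) sv su Hh Hg.
congr is_wgrad; [apply/funext => x|apply/funext => i; apply/funext => x];
  by rewrite mulN1r addrC.
Qed.

Lemma W0B u g v h : W0 u g -> W0 v h ->
  W0 (fun x => u x - v x) (fun i x => g i x - h i x).
Proof.
move=> Hg Hh; have := W0P (-1) Hh Hg.
congr W0; [apply/funext => x|apply/funext => i; apply/funext => x];
  by rewrite mulN1r addrC.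
Qed.

Lemma H1norm_eq u g : sqint u -> is_wgrad u g ->
  H1norm Omega u = Num.sqrt (ip u u + gsq g).
Proof.
move=> su Hg; rewrite /H1norm; congr (Num.sqrt (_ + _)).
apply: eq_bigr => i _.
have sw := is_wgrad_sqint i (H1_wgrad (is_wgrad_H1 su Hg)).
have sg := is_wgrad_sqint i Hg.
apply: (ip_ae mO sw sg sw sg); exact: wgrad_ae.
Qed.

Lemma H1_cvgP (u_ : nat -> rV -> R) (g_ : nat -> 'I_d -> rV -> R) u g :
  (forall n, sqint (u_ n)) -> sqint u -> (forall n, is_wgrad (u_ n) (g_ n)) ->
  is_wgrad u g ->
  H1_cvg Omega u_ u <-> (fun n => pdist (u_ n) (g_ n) u g) @ \oo --> (0 : R).
Proof.
move=> su_ su Hg_ Hg.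
have E n : H1norm Omega (fun x => u_ n x - u x) = Num.sqrt (pdist (u_ n) (g_ n) u g).
  by rewrite (H1norm_eq _ (is_wgradB (su_ n) su (Hg_ n) Hg))//; exact: sqintB.
rewrite /H1_cvg; under eq_fun do rewrite E; split => c.
  rewrite (_ : (fun n => _) = (fun n => Num.sqrt (pdist (u_ n) (g_ n) u g) *
      Num.sqrt (pdist (u_ n) (g_ n) u g))).
    by rewrite -[X in _ --> X](mulr0 0); exact: cvgM.
  by apply/funext => n; rewrite -expr2 sqr_sqrtr// pdist_ge0.
rewrite -[X in _ --> X](@sqrtr0 R).
by apply: (continuous_cvg _ _ c); exact: sqrt_continuous.
Qed.

Lemma H10_W0 u : H10 Omega u <-> exists g, W0 u g.
Proof.
split=> [[Hu [f_ [tf_ c]]]|[g Hg]].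
  exists (wgrad Omega u); have Hg := H1_wgrad Hu; have su := H1_sqint Hu.
  have tf n := test_fun_tfun (tf_ n).
  apply: (W0_closed (fun n => tfun_W0 (tf n))).
    by split => // i; exact: is_wgrad_sqint Hg.
  apply: (H1_cvgP (g_ := fun n i => pderiv i (f_ n)) _ su _ Hg).1 c => n.
    exact: tfun_sqint (tf n).
  by apply: W0_is_wgrad; exact: (tfun_W0 (tf n)).
have [[su sg] _] := Hg; have wg := W0_is_wgrad Hg.
split; first exact: is_wgrad_H1 wg.
have [f_ [k_ [tf_ c]]] := W0_seq Hg.
exists f_; split => [n|]; first by case: (tf_ n).
apply: (H1_cvgP _ su _ wg).2 c => n; first exact: tfun_sqint (tf_ n).
by apply: W0_is_wgrad; exact: (tfun_W0 (tf_ n)).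
Qed.

Definition aform (a : rV -> R) g h := \sum_i ip (fun x => a x * g i x) (h i).

Lemma dirichlet_formE a u g v h : bdd a -> sqint u -> sqint v ->
  is_wgrad u g -> is_wgrad v h -> dirichlet_form Omega a u v = aform a g h.
Proof.
move=> ba su sv Hg Hh.
have sg i := is_wgrad_sqint i Hg; have sh i := is_wgrad_sqint i Hh.
have Wu := H1_wgrad (is_wgrad_H1 su Hg); have Wv := H1_wgrad (is_wgrad_H1 sv Hh).
have sWu i := is_wgrad_sqint i Wu; have sWv i := is_wgrad_sqint i Wv.
transitivity (aform a (wgrad Omega u) (wgrad Omega v)).
  rewrite /dirichlet_form /aform.
  have Hsum (s : seq 'I_d) : integ mu Omega (fun x => \sum_(i <- s) a x * wgrad Omega u i x * wgrad Omega v i x) /\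
    \int[mu]_(x in Omega) (\sum_(i <- s) a x * wgrad Omega u i x * wgrad Omega v i x) =
    \sum_(i <- s) ip (fun x => a x * wgrad Omega u i x) (wgrad Omega v i).
    have ii i : integ mu Omega (fun x => a x * wgrad Omega u i x * wgrad Omega v i x).
      by apply: sqint_integM => //; exact: sqintMl.
    elim: s => [|i s [IH1 IH2]].
      split; first by under eq_fun do rewrite big_nil; exact: integ_cst (finite_Omega oO bO).
      by rewrite big_nil; under eq_Rintegral do rewrite big_nil; rewrite /Rintegral integral0.
    split; first by under eq_fun do rewrite big_cons; exact: integD.
    rewrite big_cons -IH2 -RintegralD//; last exact: ii.
    by apply: eq_Rintegral => x _; rewrite big_cons.
  rewrite -(Hsum _).2; apply: eq_Rintegral => x _.
  by rewrite mulr_sumr; apply: eq_bigr => i _; rewrite mulrA.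
apply: eq_bigr => i _; apply: (ip_ae mO) => //; try exact: sqintMl.
  by apply: (ae_in_imply _ (wgrad_ae i su Hg)) => x _ ->.
exact: wgrad_ae.
Qed.

Lemma pdist_cvg_split (u_ : nat -> rV -> R) (g_ : nat -> 'I_d -> rV -> R) u g :
  (fun n => sqdist (u_ n) u) @ \oo --> (0 : R) ->
  (forall i, (fun n => sqdist (g_ n i) (g i)) @ \oo --> (0 : R)) ->
  (fun n => pdist (u_ n) (g_ n) u g) @ \oo --> (0 : R).
Proof.
move=> c1 c2; rewrite -[X in _ --> X]addr0; apply: cvgD => //.
have := @cvg_bigsum R _ (index_enum 'I_d) (fun i n => sqdist (g_ n i) (g i))
  (fun=> 0) c2.
by rewrite big1.
Qed.

Lemma measurable_comp_cont (F : R -> R) u : continuous F ->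
  measurable_fun Omega u -> measurable_fun Omega (fun x => F (u x)).
Proof.
by move=> cF mu_; apply: (measurableT_comp _ mu_); exact: continuous_measurable_fun.
Qed.

Lemma bdd_dN w : measurable_fun Omega w -> bdd (fun x => dN (w x)).
Proof.
move=> mw; split; first by apply: measurable_comp_cont => //; exact: continuous_dN.
by exists 1; apply: ae_in_all => x _; exact: norm_dN.
Qed.

Lemma sqint_nN w : measurable_fun Omega w -> sqint (fun x => nN (w x)).
Proof.
move=> mw; apply: (@sqint_bounded _ _ _ oO bO _ 1).
  by apply: measurable_comp_cont => //; exact: continuous_nN.
by move=> x _; rewrite ger0_norm ?nN_ge0// nN_le1.
Qed.

(* As [w0] is a limit of test functions and [nN] vanishes on [t >= 0], the
   truncation [nN (w0 + z)] is a limit of nonnegative test functions. *)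
Lemma chain_nN w0 g0 z gz : W0 w0 g0 -> (forall x, Omega x -> C1at z gz x) ->
  (forall x, Omega x -> 0 <= z x) -> sqint z -> (forall i, sqint (gz i)) ->
  let w x := w0 x + z x in let g i x := g0 i x + gz i x in
  exists psi_ H_, [/\ forall n, tfun Omega (psi_ n) (H_ n),
    forall n x, 0 <= psi_ n x &
    (fun n => pdist (psi_ n) (H_ n) (fun x => nN (w x))
       (fun i x => dN (w x) * g i x)) @ \oo --> (0 : R)].
Proof.
move=> Hw C1z z0 sz sgz w g.
have [[sw0 sg0] _] := Hw.
have [f_ [k_ [tf_ c_]]] := W0_seq Hw.
have sf_ n := (tfun_sqint_pair (tf_ n)).1.
(* Almost everywhere convergence is needed for the dominated convergence of the factor [dN]; the
   $L^2$ convergence survives the extraction because [k <= s k]. *)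
have [s [ks aes]] := ae_subsequence mO sf_ sw0 (sqdist_cvg c_).
pose f n := f_ (s n); pose k n := k_ (s n).
have tf n : tfun Omega (f n) (k n) by exact: tf_.
have c : (fun n => pdist (f n) (k n) w0 g0) @ \oo --> (0 : R).
  apply: cvg0_ge0 => [n|e e0]; first exact: pdist_ge0.
  have [N HN] := cvg0_le c_ e0; exists N => n Nn; apply: HN.
  exact: leq_trans Nn (ks n).
have [sf sk] : (forall n, sqint (f n)) /\ (forall n i, sqint (k n i)).
  by split => n; have [] := tfun_sqint_pair (tf n).
pose psi n x := if `[< Omega x >] then nN (f n x + z x) else 0.
have psiO n x : Omega x -> psi n x = nN (f n x + z x).
  by rewrite /psi => Ox; case: asboolP.
have C1psi n x : Omega x ->
    C1at (psi n) (fun i y => dN (f n y + z y) * (k n i y + gz i y)) x.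
  move=> Ox; have C1 : C1at (fun y => f n y + z y) (fun i y => k n i y + gz i y) x.
    by apply: C1atD; [exact: tfun_C1at (tf n)|exact: C1z].
  apply: C1at_near (C1at_comp C1 (is_derive_nN _) _ _).
  - near=> y; rewrite psiO//; near: y; exact: open_nbhs_nbhs.
  - by move=> i; near=> y.
  - exact: continuous_nN.
  - exact: continuous_dN.
have psi_out n x : ~ tsupp (f n) x -> psi n x = 0.
  move=> hx; rewrite /psi; case: asboolP => // Ox.
  by rewrite (tfun_out (tf n) hx) add0r; apply/eqP; rewrite nN_eq0 z0.
have /choice[H HH] n := tfun_intro oO (C1psi n) (tfun_compact (tf n))
  (tfun_sub (tf n)) (psi_out n).
have sw : sqint w by exact: sqintD.
have sg i : sqint (g i) by exact: sqintD.
have mw : measurable_fun Omega w by exact: sqint_measurable sw.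
have sfz n : sqint (fun x => f n x + z x) by exact: sqintD.
have mfz n : measurable_fun Omega (fun x => f n x + z x) by exact: sqint_measurable (sfz n).
have tpsi n : tfun Omega (psi n) (H n) by case: (HH n).
have HE n i x : Omega x -> H n i x = dN (f n x + z x) * (k n i x + gz i x).
  by case: (HH n) => _ h Ox; rewrite h.
exists psi, H; split => //.
  by move=> n x; rewrite /psi; case: asboolP => // _; exact: nN_ge0.
apply: pdist_cvg_split.
  apply: (cvg0_bound (C := 1)) (sqdist_cvg c) => n.
  rewrite sqdist_ge0/= mul1r; apply: (ip_le mO).
  - by apply: sqintB => //; [exact: tfun_sqint (tpsi n)|exact: sqint_nN].
  - by apply: sqintB => //; [exact: tfun_sqint (tpsi n)|exact: sqint_nN].
  - exact: sqintB.
  - exact: sqintB.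
  apply: ae_in_all => x Ox; rewrite psiO//.
  rewrite -!expr2 -(real_normK (num_real (nN _ - _))) -(real_normK (num_real (f n x - _))).
  rewrite lerXn2r ?nnegrE//; apply: le_trans (nN_lip _ _) _.
  by rewrite /w opprD addrACA subrr addr0.
move=> i.
(* The intermediate function has the new argument in [dN] but the limit gradient. Its distance to
   [H n i] is controlled by $|dN| \le 1$, and its distance to the limit tends to 0 by dominated
   convergence, since [dN] is continuous. *)
pose m n x := dN (f n x + z x) * g i x.
have sm n : sqint (m n) by apply: sqintMl => //; exact: bdd_dN.
have sl : sqint (fun x => dN (w x) * g i x) by apply: sqintMl => //; exact: bdd_dN.
have sH n : sqint (H n i) by exact: tfun_sqintg (tpsi n).
have c1 : (fun n => sqdist (H n i) (m n)) @ \oo --> (0 : R).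
  apply: (cvg0_bound (C := 1)) (sqdistg_cvg i c) => n.
  rewrite sqdist_ge0/= mul1r; apply: (ip_le mO); try exact: sqintB.
  apply: ae_in_all => x Ox; rewrite HE// /m -mulrBr.
  rewrite -!expr2 exprMn /g opprD addrACA subrr addr0 ler_piMl ?sqr_ge0//.
  by rewrite -(real_normK (num_real _)) exprn_ile1// norm_dN.
have c2 : (fun n => sqdist (m n) (fun x => dN (w x) * g i x)) @ \oo --> (0 : R).
  have -> : (0 : R) = \int[mu]_(x in Omega) 0 by rewrite /Rintegral integral0.
  apply: (@Rintegral_dominated_cvg _ _ _ _ _ mO _ _ (fun x => 4 * (g i x * g i x))).
  - move=> n; have mB := sqint_measurable (sqintB mO (sm n) sl).
    exact: measurable_funM.
  - exact: measurable_cst.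
  - apply: (ae_in_imply _ aes) => x Ox h.
    have h1 : (fun n => m n x - dN (w x) * g i x) @ \oo --> (0 : R).
      apply/subr_cvg0; apply: cvgMl; apply: (continuous_cvg _ (@continuous_dN R _)).
      by apply: cvgD; [exact: h|exact: cvg_cst].
    by rewrite -[X in _ --> X](mulr0 0); exact: cvgM.
  - by apply: integZ => //; exact: sqint_integM.
  - move=> n x Ox; rewrite -expr2 ger0_norm ?sqr_ge0// /m -mulrBl exprMn -expr2.
    rewrite ler_wpM2r ?sqr_ge0//.
    have := dN_le0 (f n x + z x); have := dN_geN1 (f n x + z x).
    have := dN_le0 (w x); have := dN_geN1 (w x).
    set p := dN _; set q := dN _ => *; nra.
apply: (@squeeze_cvgr _ _ _ _ (fun=> 0) (fun n => 2 * sqdist (H n i) (m n) +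
    2 * sqdist (m n) (fun x => dN (w x) * g i x))).
- by apply: nearW => n; rewrite sqdist_ge0/= sqdist_tri.
- exact: cvg_cst.
- have c3 : (fun n => 2 * sqdist (H n i) (m n)) @ \oo --> (2 * 0 : R) by exact: cvgMr.
  have c4 : (fun n => 2 * sqdist (m n) (fun x => dN (w x) * g i x)) @ \oo --> (2 * 0 : R).
    exact: cvgMr.
  by have := cvgD c3 c4; rewrite mulr0 addr0; apply.
Unshelve. all: by end_near. Qed.

Lemma aform_cvg a (g : 'I_d -> rV -> R) (h_ : nat -> 'I_d -> rV -> R) h :
  bdd a -> (forall i, sqint (g i)) -> (forall n i, sqint (h_ n i)) ->
  (forall i, sqint (h i)) ->
  (forall i, (fun n => sqdist (h_ n i) (h i)) @ \oo --> (0 : R)) ->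
  (fun n => aform a g (h_ n)) @ \oo --> aform a g h.
Proof.
move=> ba sg sh_ sh c; apply: cvg_bigsum => i.
by apply: (ip_cvgr mO) => //; exact: sqintMl.
Qed.

(** * Maximum principle, existence and comparison for linear problems *)

Section elliptic.
Variables (K0 : R) (a : rV -> R).
Hypothesis K00 : 0 < K0.
Hypothesis ba : bdd a.
Hypothesis aK : ae_in (fun x => K0 <= a x).
Variable (i0 : 'I_d).

(** Testing with the approximations of $N(w)$, where $w = w_0 + z$ and $N$ is [nN], gives a
    nonnegative sum of two terms. Both are at most 0, because [dN <= 0] and $w N(w) \le 0$. Hence
    the gradient of $N(w)$ vanishes, and Poincare's inequality gives $N(w) = 0$. The summand [z]
    carries nonnegative boundary values: it is 0 for comparison and the datum minus the barrier for
    the lower bound. *)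
Lemma max_principle w0 g0 z gz q :
  W0 w0 g0 -> (forall x, Omega x -> C1at z gz x) ->
  (forall x, Omega x -> 0 <= z x) -> sqint z -> (forall i, sqint (gz i)) ->
  bdd q -> ae_in (fun x => 0 <= q x) ->
  (forall psi H, tfun Omega psi H -> (forall x, 0 <= psi x) ->
    0 <= aform a (fun i x => g0 i x + gz i x) H +
         ip (fun x => q x * (w0 x + z x)) psi) ->
  ae_in (fun x => 0 <= w0 x + z x).
Proof.
move=> Hw C1z z0 sz sgz bq q0 Hpos.
have [[sw0 sg0] _] := Hw.
have [psi [H [tpsi psi0 c]]] := chain_nN Hw C1z z0 sz sgz.
set w := (fun x => w0 x + z x) in c *.
set g := (fun i x => g0 i x + gz i x) in c.
have sw : sqint w by exact: sqintD.
have sg i : sqint (g i) by exact: sqintD.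
have mw : measurable_fun Omega w by exact: sqint_measurable sw.
have sn : sqint (fun x => nN (w x)) by exact: sqint_nN.
have sd i : sqint (fun x => dN (w x) * g i x) by apply: sqintMl => //; exact: bdd_dN.
have [spsi sH] : (forall n, sqint (psi n)) /\ (forall n i, sqint (H n i)).
  by split => n; have [] := tfun_sqint_pair (tpsi n).
have sqw : sqint (fun x => q x * w x) by exact: sqintMl.
have c1 := aform_cvg ba sg sH sd (fun i => sqdistg_cvg i c).
have c2 := ip_cvgr mO spsi sn sqw (sqdist_cvg c).
have h1 : 0 <= aform a g (fun i x => dN (w x) * g i x) +
    ip (fun x => q x * w x) (fun x => nN (w x)).
  by apply: (cvg_seq_ge0 (cvgD c1 c2)) => n; exact: Hpos.
have h2 : ip (fun x => q x * w x) (fun x => nN (w x)) <= 0.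
  apply: (ip_le0_ae mO) => //.
  apply: (ae_in_imply _ q0) => x _ qx; rewrite -mulrA.
  by rewrite mulr_ge0_le0// mul_nN_le0.
have h3 : K0 * gsq (fun i x => dN (w x) * g i x) <=
    - aform a g (fun i x => dN (w x) * g i x).
  rewrite /gsq /aform mulr_sumr -sumrN; apply: ler_sum => i _.
  have sK : sqint (fun x => K0 * (dN (w x) * g i x)) by exact: sqintZ.
  have sa : sqint (fun x => a x * g i x) by exact: sqintMl.
  rewrite -ipZl// -ipNl//; apply: (ip_le mO) => //; first exact: sqintN.
  apply: (ae_in_imply _ aK) => x _ ax.
  have -> : K0 * (dN (w x) * g i x) * (dN (w x) * g i x) =
    K0 * (dN (w x) ^+ 2) * (g i x ^+ 2) by ring.
  have -> : - (a x * g i x) * (dN (w x) * g i x) = a x * (- dN (w x)) * (g i x ^+ 2) by ring.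
  rewrite ler_wpM2r ?sqr_ge0// ler_pM ?sqr_ge0 ?(ltW K00)//.
  exact: dN_sqr.
have WnN : W0 (fun x => nN (w x)) (fun i x => dN (w x) * g i x).
  by apply: (W0_closed (fun n => tfun_W0 (tpsi n))).
have [C [C0 HC]] := poincare i0.
have h4 := HC _ _ WnN.
have h5 : gsq (fun i x => dN (w x) * g i x) <= 0.
  rewrite -(pmulr_rle0 _ K00); apply: le_trans h3 _; rewrite oppr_le0.
  by apply: le_trans h1 _; rewrite gerDl.
have h6 : ip (fun x => nN (w x)) (fun x => nN (w x)) <= 0.
  by apply: le_trans h4 _; rewrite pmulr_rle0.
apply: (ae_in_imply _ (ip_eq0 mO sn h6)) => x _ /eqP.
by rewrite nN_eq0.
Qed.

Implicit Types (w z f q : rV -> R).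

Lemma aformP (r : R) g h k : (forall i, sqint (g i)) -> (forall i, sqint (h i)) ->
  (forall i, sqint (k i)) ->
  aform a (fun i x => r * g i x + h i x) k = r * aform a g k + aform a h k.
Proof.
move=> sg sh sk; rewrite /aform mulr_sumr -big_split/=; apply: eq_bigr => i _.
have sag := sqintMl mO ba (sg i); have sah := sqintMl mO ba (sh i).
rewrite -ipZl// -ipDl//; last exact: sqintZ.
by apply: eq_Rintegral => x _; ring.
Qed.

Lemma aformC g h : aform a g h = aform a h g.
Proof. by apply: eq_bigr => i _; rewrite ip_MlC ipC. Qed.

Lemma aformB g h k : (forall i, sqint (g i)) -> (forall i, sqint (h i)) ->
  (forall i, sqint (k i)) ->
  aform a (fun i x => g i x - h i x) k = aform a g k - aform a h k.
Proof.
move=> sg sh sk; have := aformP (-1) sh sg sk; rewrite mulN1r addrC => <-.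
by congr aform; apply/funext => i; apply/funext => x; rewrite mulN1r addrC.
Qed.

Lemma aform_ge g : (forall i, sqint (g i)) -> K0 * gsq g <= aform a g g.
Proof.
move=> sg; rewrite /gsq /aform mulr_sumr; apply: ler_sum => i _.
rewrite -ipZl//; apply: (ip_le mO) => //; [exact: sqintZ|exact: sqintMl|].
apply: (ae_in_imply _ aK) => x _ ax.
by rewrite -!mulrA -expr2 ler_wpM2r// sqr_ge0.
Qed.

Lemma ipM_ge0 q u : bdd q -> ae_in (fun x => 0 <= q x) -> sqint u ->
  0 <= ip (fun x => q x * u x) u.
Proof.
move=> bq q0 su; apply: (ip_ge0_ae mO) => //; first exact: sqintMl.
by apply: (ae_in_imply _ q0) => x _ qx; rewrite -mulrA mulr_ge0// -expr2 sqr_ge0.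
Qed.

Definition lin_sol q f u g := forall v h, W0 v h ->
  aform a g h + ip (fun x => q x * u x) v = ip f v.

Lemma bdd_ub q : bdd q -> exists M, 0 <= M /\ ae_in (fun x => `|q x| <= M).
Proof.
move=> [_ [M qM]]; exists `|M|; split => //.
by apply: (ae_in_imply _ qM) => x _ h; rewrite (le_trans h) ?ler_norm.
Qed.

Lemma ipM_le q M u : bdd q -> ae_in (fun x => `|q x| <= M) -> sqint u ->
  ip (fun x => q x * u x) u <= M * ip u u.
Proof.
move=> bq qM su; rewrite -ipZl//; apply: (ip_le mO) => //; [exact: sqintMl|exact: sqintZ|].
apply: (ae_in_imply _ qM) => x _ h; rewrite -!mulrA -expr2 ler_wpM2r ?sqr_ge0//.
exact: le_trans (ler_norm _) h.
Qed.

Section existence.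
Variables (q f : rV -> R) (G : rV -> R) (gG : 'I_d -> rV -> R).
Hypothesis bq : bdd q.
Hypothesis q0 : ae_in (fun x => 0 <= q x).
Hypothesis sf : sqint f.
Hypothesis sG : sqint G.
Hypothesis wG : is_wgrad G gG.

Local Notation V := ((rV -> R) * ('I_d -> rV -> R))%type.

Definition energy (p p' : V) := aform a p.2 p'.2 + ip (fun x => q x * p.1 x) p'.1.

Let E (p : V) := W0 p.1 p.2.
Let S (p : V) := sqint_pair p.1 p.2.

Let SP (k : R) (p p' : V) : S p -> S p' -> S (k *: p + p').
Proof. exact: (@sqint_pairP k p.1 p.2 p'.1 p'.2). Qed.

Let EP (k : R) (p p' : V) : E p -> E p' -> E (k *: p + p').
Proof. exact: (@W0P k p.1 p.2 p'.1 p'.2). Qed.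

Let ES p : E p -> S p. Proof. by case. Qed.

Let energyC p p' : energy p p' = energy p' p.
Proof. by rewrite /energy aformC ip_MlC ipC. Qed.

Let energyP (k : R) (p p' r : V) : S p -> S p' -> S r ->
  energy (k *: p + p') r = k * energy p r + energy p' r.
Proof.
move=> [s1 g1] [s2 g2] [s3 g3]; rewrite /energy.
have -> : aform a (k *: p + p').2 r.2 = k * aform a p.2 r.2 + aform a p'.2 r.2.
  exact: (aformP k g1 g2 g3).
have sq1 := sqintMl mO bq s1; have sq2 := sqintMl mO bq s2.
have -> : ip (fun x => q x * (k *: p + p').1 x) r.1 =
    k * ip (fun x => q x * p.1 x) r.1 + ip (fun x => q x * p'.1 x) r.1.
  rewrite -ipZl// -ipDl//; last exact: sqintZ.
  by apply: eq_Rintegral => x _; rewrite /= mulrDr mulrCA.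
by rewrite mulrDr addrACA.
Qed.

Let energy_ge p : S p -> K0 * gsq p.2 <= energy p p.
Proof.
move=> [s g]; rewrite /energy (le_trans (aform_ge g))// lerDl.
exact: ipM_ge0.
Qed.

Let energy_ge0 p : S p -> 0 <= energy p p.
Proof.
by move=> h; apply: le_trans (energy_ge h); rewrite mulr_ge0 ?gsq_ge0// ltW.
Qed.

Let l (p : V) := ip f p.1 - energy (G, gG) p.

Let SG : S (G, gG).
Proof. by split => //= i; exact: is_wgrad_sqint wG. Qed.

Let energyPr (k : R) (p p' r : V) : S p -> S p' -> S r ->
  energy r (k *: p + p') = k * energy r p + energy r p'.
Proof. by move=> *; rewrite !(energyC r) energyP. Qed.

Let lP (k : R) (p p' : V) : E p -> E p' -> l (k *: p + p') = k * l p + l p'.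
Proof.
move=> /ES s1 /ES s2; rewrite /l energyPr//.
have [[u1 _] [u2 _]] := (s1, s2).
have -> : ip f (k *: p + p').1 = k * ip f p.1 + ip f p'.1.
  by rewrite -ipZr// -ipDr//; exact: sqintZ.
ring.
Qed.

Let E0 : E 0.
Proof. exact: W0_0. Qed.

(** Riesz representation for the energy on [W0], the datum [G] being moved into the functional [l].
    Ellipticity controls the gradient by the energy, and Poincare's inequality controls the
    function. An energy-Cauchy sequence thus converges in $L^2$ together with its gradient, and the
    limit stays in [W0]. *)
Lemma lin_exists : exists u g, [/\ sqint u, is_wgrad u g,
  W0 (fun x => u x - G x) (fun i x => g i x - gG i x) & lin_sol q f u g].
Proof.
have [C [C0 HC]] := poincare i0.
have CS p p' : S p -> S p' -> energy p p' ^+ 2 <= energy p p * energy p' p'.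
  apply: (@form_CS R V S energy) => //.
(* The two terms of [l] are bounded separately through $(x - y)^2 \le 2x^2 + 2y^2$: the first by
   Cauchy-Schwarz, Poincare and ellipticity, the second by Cauchy-Schwarz for the energy. *)
pose Cl := 2 * (ip f f * (C / K0)) + 2 * energy (G, gG) (G, gG).
have Cl0 : 0 <= Cl.
  rewrite addr_ge0// mulr_ge0//; last exact: energy_ge0.
  by rewrite mulr_ge0 ?ip_ge0// divr_ge0 ?ltW.
have ipE p : E p -> ip p.1 p.1 <= C / K0 * energy p p.
  move=> Ep; apply: le_trans (HC _ _ Ep) _.
  rewrite -mulrA ler_wpM2l ?(ltW C0)// ler_pdivlMl//.
  exact: energy_ge (ES Ep).
have lB p : E p -> l p ^+ 2 <= Cl * energy p p.
  move=> Ep; have Sp := ES Ep; have [sp _] := Sp.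
  apply: (@le_trans _ _ (2 * ip f p.1 ^+ 2 + 2 * energy (G, gG) p ^+ 2)).
    by have := sqr_ge0 (ip f p.1 + energy (G, gG) p); rewrite /l; lra.
  rewrite /Cl [leRHS]mulrDl -[X in _ <= X + _]mulrA -[X in _ <= _ + X]mulrA; apply: lerD; rewrite ler_pM2l//; last exact: CS.
  apply: le_trans (ip_CS mO sf sp) _.
  by rewrite -mulrA ler_wpM2l ?ip_ge0//; exact: ipE.
have [B [B0 aB]] := bdd_ub ba; have [Q [Q0 qQ]] := bdd_ub bq.
have complete (p : nat -> V) : (forall n, E (p n)) ->
    (forall e, 0 < e -> exists N, forall m n, (N <= m)%N -> (N <= n)%N ->
      energy (p m - p n) (p m - p n) <= e) ->
    exists2 w, E w & (fun n => energy (p n - w) (p n - w)) @ \oo --> (0 : R).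
  move=> Ep cp.
  have EB m n : E (p m - p n) by rewrite addrC -scaleN1r; exact: EP.
  have /cid2[u su cu] : exists2 u, sqint u & (fun n => sqdist (p n).1 u) @ \oo --> (0 : R).
    have [||u [su cu]] := @sqint_complete _ _ _ mu _ mO (fun n => (p n).1).
    - by move=> n; have [[]] := Ep n.
    - move=> e e0; have e1 : 0 < e / (C / K0) by rewrite divr_gt0// divr_gt0.
      have [N HN] := cp _ e1; exists N => m n Nm Nn.
      apply: le_trans (ipE _ (EB m n)) _.
      by rewrite mulrC -ler_pdivlMr ?divr_gt0//; exact: HN.
    by exists u.
  have /choice[g Hg] i : exists gi : rV -> R, sqint gi /\ (fun n => sqdist ((p n).2 i) gi) @ \oo --> (0 : R).
    apply: (@sqint_complete _ _ _ mu _ mO (fun n => (p n).2 i)).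
      by move=> n; have [[]] := Ep n.
    move=> e e0; have e1 : 0 < K0 * e by rewrite mulr_gt0.
    have [N HN] := cp _ e1; exists N => m n Nm Nn.
    rewrite -(ler_pM2l K00); apply: le_trans (HN m n Nm Nn).
    apply: le_trans (energy_ge (ES (EB m n))); rewrite ler_pM2l//.
    rewrite /gsq (bigD1 i)//= lerDl sumr_ge0// => j _; exact: ip_ge0.
  have cp' : (fun n => pdist (p n).1 (p n).2 u g) @ \oo --> (0 : R).
    by apply: pdist_cvg_split => // i; case: (Hg i).
  have Ew : E (u, g).
    apply: (W0_closed Ep) cp'; split => // i; by case: (Hg i).
  exists (u, g) => //; apply: (cvg0_bound (C := B + Q)) cp' => n.
  have EBn : E (p n - (u, g)) by rewrite addrC -scaleN1r; exact: EP.
  have [sn gn] := ES EBn.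
  apply/andP; split; first exact: energy_ge0 (ES EBn).
  rewrite /energy [leRHS]mulrDl.
  apply: (@le_trans _ _ (B * gsq (p n - (u, g)).2 + Q * ip (p n - (u, g)).1 (p n - (u, g)).1)).
    apply: lerD; last exact: ipM_le.
    by rewrite /aform /gsq mulr_sumr; apply: ler_sum => i _; exact: ipM_le.
  apply: lerD; apply: ler_wpM2l => //; rewrite /pdist ?lerDr ?lerDl ?sqdist_ge0//.
  by rewrite sumr_ge0// => i _; exact: sqdist_ge0.
have [|||||||p Ep Hp] := @riesz_representation R V E energy l Cl E0 EP.
- by move=> *; exact: energyC.
- by move=> k p p' r /ES s1 /ES s2 /ES s3; exact: energyP.
- by move=> p /ES; exact: energy_ge0.
- exact: lP.
- exact: Cl0.
- exact: lB.
- exact: complete.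
have [sp gp] := ES Ep.
exists (fun x => p.1 x + G x), (fun i x => p.2 i x + gG i x).
have sgG i := is_wgrad_sqint i wG.
split.
- exact: sqintD.
- have := is_wgradP 1 sp sG (W0_is_wgrad Ep) wG.
  by congr is_wgrad; [apply/funext => x|apply/funext => i; apply/funext => x]; rewrite mul1r.
- move: Ep; rewrite /E; congr W0; [apply/funext => x|apply/funext => i; apply/funext => x];
    by rewrite addrK.
- move=> v h Wv; have Sv := ES (Wv : E (v, h)).
  have := Hp (v, h) Wv; rewrite /l => /eqP; rewrite eq_sym subr_eq => /eqP ->.
  have := energyP 1 (ES Ep) SG Sv; rewrite mul1r => <-.
  rewrite /energy; congr (aform _ _ _ + ip _ _).
    by apply/funext => i; apply/funext => x /=; rewrite scale1r.
  by apply/funext => x /=; rewrite scale1r.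
Qed.

End existence.

Lemma lin_sol_energy q f w g : W0 w g -> bdd q -> ae_in (fun x => 0 <= q x) ->
  lin_sol q f w g -> K0 * gsq g + ip (fun x => q x * w x) w <= ip f w.
Proof.
move=> Ww bq q0 H; have [[sw sg] _] := Ww.
rewrite -(H _ _ Ww) lerD2r; exact: aform_ge.
Qed.

(** The constant is uniform in the nonnegative potential, whose energy is dropped: $K_0 \|\nabla
    w\|^2 \le \int fw \le \|f\| \sqrt{C} \|\nabla w\|$. *)
Lemma lin_sol_bound : exists C, 0 < C /\ forall q f w g, W0 w g -> bdd q ->
  ae_in (fun x => 0 <= q x) -> sqint f -> lin_sol q f w g ->
  ip w w + gsq g <= C * ip f f.
Proof.
have [C [C0 HC]] := poincare i0.
exists ((C + 1) * (C / K0 ^+ 2)); split.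
  by rewrite mulr_gt0 ?addr_gt0// divr_gt0// exprn_gt0.
move=> q f w g Ww bq q0 sf H; have [[sw sg] _] := Ww.
have h1 := lin_sol_energy Ww bq q0 H.
have h2 := ipM_ge0 bq q0 sw.
have h3 := ip_CS mO sf sw; have h4 := HC _ _ Ww.
have g0 := gsq_ge0 g; have f0 := ip_ge0 mu Omega f.
have h5 : gsq g <= C / K0 ^+ 2 * ip f f.
  have [->|gn] := eqVneq (gsq g) 0.
    by rewrite mulr_ge0// divr_ge0 ?(ltW C0)// exprn_ge0// ltW.
  have gp : 0 < gsq g by rewrite lt0r gn.
  have h6 : (K0 * gsq g) ^+ 2 <= ip f f * (C * gsq g).
    apply: (@le_trans _ _ (ip f w ^+ 2)).
      rewrite lerXn2r ?nnegrE//; first by rewrite mulr_ge0// ltW.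
        by apply: le_trans h1; rewrite addr_ge0// mulr_ge0// ltW.
      by apply: le_trans h1; rewrite lerDl.
    by apply: le_trans h3 _; rewrite ler_wpM2l.
  rewrite mulrAC ler_pdivlMr ?exprn_gt0// -(ler_pM2r gp).
  by move: h6; rewrite exprMn; lra.
apply: (@le_trans _ _ ((C + 1) * gsq g)); first by rewrite mulrDl mul1r lerD2r.
by rewrite -mulrA ler_wpM2l// addr_ge0// ltW.
Qed.

Lemma lin_sol_ext q f f' u g : sqint f -> sqint f' ->
  ae_in (fun x => f x = f' x) -> lin_sol q f u g -> lin_sol q f' u g.
Proof.
move=> sf sf' ff' H v h Wv; rewrite (H v h Wv).
by have [[sv _] _] := Wv; apply: (ip_ae mO) => //; exact: ae_in_all.
Qed.

(** Adding a multiple of the solution to both sides changes the potential. Solutions belonging to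
    different [k] become comparable in this way. *)
Lemma lin_sol_shift q p f u g : bdd q -> bdd p -> sqint f -> sqint u ->
  lin_sol q f u g -> lin_sol (fun x => q x + p x) (fun x => f x + p x * u x) u g.
Proof.
move=> bq bp sf su H v h Wv; have [[sv _] _] := Wv.
have sq1 := sqintMl mO bq su; have sp := sqintMl mO bp su.
rewrite ipDl// -(H v h Wv) -addrA -ipDl//; congr (_ + _).
by apply: eq_Rintegral => x _; rewrite mulrDl.
Qed.

Lemma lin_solB q f1 f2 u1 g1 u2 g2 : bdd q -> sqint f1 -> sqint f2 ->
  sqint_pair u1 g1 -> sqint_pair u2 g2 -> lin_sol q f1 u1 g1 -> lin_sol q f2 u2 g2 ->
  lin_sol q (fun x => f1 x - f2 x) (fun x => u1 x - u2 x) (fun i x => g1 i x - g2 i x).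
Proof.
move=> bq sf1 sf2 [su1 sg1] [su2 sg2] H1 H2 v h Wv; have [[sv sh] _] := Wv.
have s1 := sqintMl mO bq su1; have s2 := sqintMl mO bq su2.
rewrite aformB// ipBl// -(H1 v h Wv) -(H2 v h Wv).
have -> : ip (fun x => q x * (u1 x - u2 x)) v =
    ip (fun x => q x * u1 x) v - ip (fun x => q x * u2 x) v.
  by rewrite -ipBl//; apply: eq_Rintegral => x _; rewrite mulrBr.
ring.
Qed.

Lemma lin_sol_ge0 q f w g : W0 w g -> bdd q -> ae_in (fun x => 0 <= q x) ->
  sqint f -> lin_sol q f w g -> ae_in (fun x => 0 <= f x) -> ae_in (fun x => 0 <= w x).
Proof.
move=> Ww bq q0 sf H f0.
have C10 x : Omega x -> C1at (fun=> 0 : R) (fun _ _ => 0) x by move=> _; exact: C1at_cst.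
have s0 := sqint0 mu Omega.
have h := max_principle Ww C10 (fun _ _ => lexx 0) s0 (fun=> s0) bq q0.
have {h} : ae_in (fun x => 0 <= w x + 0).
  apply: h => psi K tpsi psi0.
  have -> : (fun i x => g i x + 0) = g.
    by apply/funext => i; apply/funext => x; rewrite addr0.
  have -> : (fun x => q x * (w x + 0)) = (fun x => q x * w x).
    by apply/funext => x; rewrite addr0.
  rewrite H; last exact: tfun_W0.
  apply: (ip_ge0_ae mO) => //; first exact: tfun_sqint tpsi.
  by apply: (ae_in_imply _ f0) => x _ fx; rewrite mulr_ge0.
by apply: ae_in_imply => x _; rewrite addr0.
Qed.

Definition sol q f G gG u g := [/\ sqint u, is_wgrad u g,
  W0 (fun x => u x - G x) (fun i x => g i x - gG i x) & lin_sol q f u g].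

Lemma sol_sqint_pair q f G gG u g : sol q f G gG u g -> sqint_pair u g.
Proof. by move=> [su wg _ _]; split => // i; exact: is_wgrad_sqint wg. Qed.

Lemma W0_trace_diff G gG u1 g1 u2 g2 :
  W0 (fun x => u1 x - G x) (fun i x => g1 i x - gG i x) ->
  W0 (fun x => u2 x - G x) (fun i x => g2 i x - gG i x) ->
  W0 (fun x => u1 x - u2 x) (fun i x => g1 i x - g2 i x).
Proof.
move=> H1 H2; have := W0B H1 H2.
by congr W0; [apply/funext => x|apply/funext => i; apply/funext => x];
  rewrite opprB addrA subrK.
Qed.

Lemma comparison q f1 f2 G gG u1 g1 u2 g2 : bdd q -> ae_in (fun x => 0 <= q x) ->
  sqint f1 -> sqint f2 -> sol q f1 G gG u1 g1 -> sol q f2 G gG u2 g2 ->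
  ae_in (fun x => f2 x <= f1 x) -> ae_in (fun x => u2 x <= u1 x).
Proof.
move=> bq q0 sf1 sf2 S1 S2 f12.
have Hd := lin_solB bq sf1 sf2 (sol_sqint_pair S1) (sol_sqint_pair S2).
have [su1 _ W1 L1] := S1; have [su2 _ W2 L2] := S2.
have : ae_in (fun x => 0 <= u1 x - u2 x).
  apply: (lin_sol_ge0 (W0_trace_diff W1 W2) bq q0 _ (Hd L1 L2)).
    exact: sqintB.
  by apply: (ae_in_imply _ f12) => x _; rewrite subr_ge0.
by apply: ae_in_imply => x _; rewrite subr_ge0.
Qed.

Lemma weak_sol_sol q f G gG u : sqint G -> is_wgrad G gG ->
  weak_sol_linear Omega a q f G u -> sol q f G gG u (wgrad Omega u).
Proof.
move=> sG wG [Hu tr H]; have wu := H1_wgrad Hu; have su := H1_sqint Hu.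
split => //.
  have [k Wk] := (H10_W0 _).1 tr; have [[sk1 sk2] _] := Wk.
  apply: (W0_ae Wk); last 2 first.
  - exact: ae_in_all.
  - move=> i; apply: (is_wgrad_unique i (W0_is_wgrad Wk)
      (is_wgradB su sG wu wG)) => //; exact: ae_in_all.
  split => // i; apply: sqintB => //; [exact: is_wgrad_sqint wu|exact: is_wgrad_sqint wG].
move=> v h Wv; have Hv : H10 Omega v by apply/(H10_W0); exists h.
have [_ _] := H v Hv.
have [[sv _] _] := Wv.
by rewrite (dirichlet_formE ba su sv wu (W0_is_wgrad Wv)).
Qed.

Lemma sol_weak_sol q f G gG u g : sqint G -> is_wgrad G gG -> bdd q -> sqint f ->
  sol q f G gG u g -> weak_sol_linear Omega a q f G u.
Proof.
move=> sG wG bq sf [su wg W H]; split.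
- exact: is_wgrad_H1 wg.
- by apply/(H10_W0); eexists; exact: W.
move=> v /(H10_W0)[h Wv]; have [[sv _] _] := Wv; split.
- by apply: sqint_integM => //; exact: sqintMl.
- exact: sqint_integM.
- by rewrite (dirichlet_formE ba su sv wg (W0_is_wgrad Wv)); exact: H.
Qed.

(** * Convergence of the iteration *)

Section newton_iteration.

Variables (b gamma : rV -> R) (theta : R).
Hypothesis bb : bdd b.
Hypothesis b0 : ae_in (fun x => 0 <= b x).
Hypothesis bgamma : bdd gamma.
Hypothesis gamma0 : ae_in (fun x => 0 <= gamma x).
Hypothesis theta0 : 0 <= theta.

Variables (G : rV -> R) (gG : 'I_d -> rV -> R).
Hypothesis sG : sqint G.
Hypothesis wG : is_wgrad G gG.

Lemma sqint_cst (k : R) : sqint (fun=> k).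
Proof.
by apply: (@sqint_bounded _ _ _ oO bO _ `|k|) => //; exact: measurable_cst.
Qed.

Lemma sqint_powRN u kap : 0 < kap -> sqint u -> ae_in (fun x => kap <= u x) ->
  sqint (fun x => u x `^ (- theta)).
Proof.
move=> kap0 su ku; apply: (sqint_le mO _ _ (sqint_cst (kap `^ (- theta)))).
  by apply: (measurableT_comp (measurable_powR (- theta)) (sqint_measurable su)).
apply: (ae_in_imply _ ku) => x _ h.
by rewrite ger0_norm ?powR_ge0// powRN_le.
Qed.

Lemma bdd_potential k : bdd (fun x => b x + gamma x * k).
Proof. by apply: bddD => //; exact: bddZ. Qed.

Lemma potential_ge0 k : 0 <= k -> ae_in (fun x => 0 <= b x + gamma x * k).
Proof.
by move=> k0; apply: (ae_in_imply2 _ b0 gamma0) => x _ h1 h2; rewrite addr_ge0// mulr_ge0.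
Qed.

Definition source k u (x : rV) := gamma x * (u x `^ (- theta) + k * u x).

Lemma sqint_source k u kap : 0 < kap -> sqint u -> ae_in (fun x => kap <= u x) ->
  sqint (source k u).
Proof.
move=> kap0 su ku; apply: sqintMl => //; apply: sqintD => //.
  exact: sqint_powRN ku.
exact: sqintZ.
Qed.

Section step.
Variables (k kap : R) (u v : rV -> R) (gu gv : 'I_d -> rV -> R).
Hypothesis kap0 : 0 < kap.
Hypothesis k0 : 0 <= k.
Hypothesis su : sqint u.
Hypothesis uK : ae_in (fun x => kap <= u x).
Hypothesis Sv : sol (fun x => b x + gamma x * k) (source k u) G gG v gv.

(** After a shift to the potential of [v], the source of [w] is [gamma * k * w], which [w <= u]
    places below [source k u]. *)
Lemma step_ge w gw : sol b (fun=> 0) G gG w gw -> ae_in (fun x => w x <= u x) ->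
  ae_in (fun x => w x <= v x).
Proof.
move=> [sw ww Ww Lw] wu.
have bgk := bddZ k bgamma.
have Sw : sol (fun x => b x + gamma x * k) (fun x => 0 + gamma x * k * w x) G gG w gw.
  split => //; apply: (lin_sol_shift _ _ _ _ Lw) => //; exact: sqint0.
apply: (comparison (bdd_potential k) (potential_ge0 k0) _ _ Sv Sw).
- exact: sqint_source uK.
- by apply: sqintD => //; [exact: sqint0|exact: sqintMl].
apply: (ae_in_imply2 _ wu gamma0) => x _ h g0.
rewrite add0r /source -mulrA ler_wpM2l//.
have := powR_ge0 (u x) (- theta); have := ler_wpM2l k0 h; lra.
Qed.

(** The same shift applied to a supersolution: [M] dominates $u^{-\theta}$ on [kap <= u]. Since [V]
    is independent of [k], one [V] bounds all iterates. *)
Lemma step_le V gV M : sol b (fun x => gamma x * M) G gG V gV ->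
  kap `^ (- theta) <= M -> ae_in (fun x => u x <= V x) ->
  ae_in (fun x => v x <= V x).
Proof.
move=> [sV wV WV LV] kM uV.
have sgM : sqint (fun x => gamma x * M) by apply: sqintMl => //; exact: sqint_cst.
have bgk := bddZ k bgamma.
have SV : sol (fun x => b x + gamma x * k)
    (fun x => gamma x * M + gamma x * k * V x) G gG V gV.
  by split => //; apply: (lin_sol_shift _ _ _ _ LV).
apply: (comparison (bdd_potential k) (potential_ge0 k0) _ _ SV Sv).
- by apply: sqintD => //; exact: sqintMl.
- exact: sqint_source uK.
apply: (ae_in_imply2 _ (ae_in_and uV gamma0) uK) => x _ [h g0] h2.
rewrite /source -mulrA -mulrDr ler_wpM2l//.
by have := powRN_le theta0 kap0 h2; have := ler_wpM2l k0 h; lra.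
Qed.

(** Rewriting the equation of [v] with the potential of [w] makes [k'] cancel from the source. Only
    the old [k] remains in [r], so its sign is decided by comparing [k] with the slope of
    $t^{-\theta}$ at [u]. *)
Lemma step_increment k' w gw : 0 < kap -> ae_in (fun x => kap <= v x) ->
  sol (fun x => b x + gamma x * k') (source k' v) G gG w gw ->
  let r x := gamma x * (v x `^ (- theta) - u x `^ (- theta) + k * (v x - u x)) in
  [/\ sqint r, W0 (fun x => w x - v x) (fun i x => gw i x - gv i x) &
  lin_sol (fun x => b x + gamma x * k') r
    (fun x => w x - v x) (fun i x => gw i x - gv i x)].
Proof.
move=> _ vK Sw r.
have [sv wv Wv Lv] := Sv; have [sw ww Ww Lw] := Sw.
have s1 := sqint_source k kap0 su uK; have s2 := sqint_source k' kap0 sv vK.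
have bgk := bddZ (k' - k) bgamma.
have Lv' := lin_sol_shift (bdd_potential k) bgk s1 sv Lv.
have E : (fun x => b x + gamma x * k + gamma x * (k' - k)) =
    (fun x => b x + gamma x * k').
  by apply/funext => x; ring.
rewrite E in Lv'.
have s3 : sqint (fun x => source k u x + gamma x * (k' - k) * v x).
  by apply: sqintD => //; exact: sqintMl.
have L := lin_solB (bdd_potential k') s2 s3 (sol_sqint_pair Sw) (sol_sqint_pair Sv) Lw Lv'.
have Er : (fun x => source k' v x - (source k u x + gamma x * (k' - k) * v x)) = r.
  by apply/funext => x; rewrite /source /r; ring.
rewrite Er in L; split => //; last exact: W0_trace_diff Ww Wv.
rewrite -Er; exact: sqintB.
Qed.

End step.

Local Notation pot k := (fun x => b x + gamma x * k).

Section linear_iteration.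
Variables (C Mg : R).
Hypothesis C0 : 0 < C.
Hypothesis HC : forall w g, W0 w g -> ip w w <= C * gsq g.
Hypothesis Mg0 : 0 < Mg.
Hypothesis gMg : ae_in (fun x => `|gamma x| <= Mg).
Let delta := K0 / (Mg * C).
Let A w := ip (fun x => gamma x * w x) w.

(* [delta] measures the share of the [gamma]-energy that Poincare's inequality
   absorbs in the gradient term, so that [k ^+ 2 * A] contracts by the factor
   [(k / (delta + k)) ^+ 2]. *)
Lemma linear_iteration_step k k' z z' g' : 0 <= k -> 0 <= k' -> sqint z -> W0 z' g' ->
  lin_sol (pot k') (fun x => gamma x * (k * z x)) z' g' ->
  (delta + k') ^+ 2 * A z' <= k ^+ 2 * A z /\
  delta * (K0 * gsq g') <= k ^+ 2 * A z.
Proof.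
move=> k0 k'0 sz Wz' L; have [[sz' sg'] _] := Wz'.
have d0 : 0 < delta by rewrite divr_gt0// mulr_gt0.
have bp : bdd (pot k') := bdd_potential k'.
have en := lin_sol_energy Wz' bp (potential_ge0 k'0) L.
have A0 w : sqint w -> 0 <= A w by exact: (ipM_ge0 bgamma gamma0).
have E0 := gsq_ge0 g'.
have h1 : ip (fun x => pot k' x * z' x) z' = ip (fun x => b x * z' x) z' + k' * A z'.
  rewrite /A -ipZl//; last exact: sqintMl.
  rewrite -ipDl//; [|exact: sqintMl|by apply: sqintZ => //; exact: sqintMl].
  by apply: eq_Rintegral => x _; ring.
have h2 := ipM_ge0 bb b0 sz'.
have h3 : ip (fun x => gamma x * (k * z x)) z' = k * ip (fun x => gamma x * z x) z'.
  rewrite -ipZl//; last exact: sqintMl.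
  by apply: eq_Rintegral => x _; ring.
have h4 := weighted_CS mO bgamma gamma0 sz sz'.
have h5 : delta * A z' <= K0 * gsq g'.
  have h : A z' <= Mg * ip z' z' by exact: ipM_le.
  rewrite /delta mulrAC ler_pdivrMr ?mulr_gt0// -mulrA ler_wpM2l ?(ltW K00)//.
  apply: le_trans h _; rewrite (mulrC (gsq _)) -mulrA ler_wpM2l ?(ltW Mg0)//.
  exact: HC.
set X := ip (fun x => gamma x * z x) z' in h3 h4.
rewrite h1 h3 in en.
have Az := A0 _ sz; have Az' := A0 _ sz'.
have h6 : K0 * gsq g' + k' * A z' <= k * X by lra.
have h7 : (delta + k') * A z' <= k * X by lra.
have kX : 0 <= k * X by apply: le_trans h7; rewrite mulr_ge0// addr_ge0// ltW.
have h8 : (k * X) ^+ 2 <= k ^+ 2 * A z * A z'.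
  by rewrite exprMn -mulrA ler_wpM2l// exprn_ge0.
have r1 : (delta + k') ^+ 2 * A z' <= k ^+ 2 * A z.
  have [->|An] := eqVneq (A z') 0; first by rewrite mulr0 mulr_ge0// exprn_ge0.
  have Ap : 0 < A z' by rewrite lt0r An.
  rewrite -(ler_pM2r Ap); apply: le_trans h8.
  rewrite -mulrA -expr2 -exprMn lerXn2r ?nnegrE//.
  by rewrite mulr_ge0// addr_ge0// ltW.
split => //.
have h9 : K0 * gsq g' <= k * X.
  by apply: le_trans h6; rewrite lerDl mulr_ge0.
have KE : 0 <= K0 * gsq g' by rewrite mulr_ge0// ltW.
(* Squared, the left side is at most $k^2 A(z) \delta^2 A(z')$, and the first conclusion bounds
   $\delta^2 A(z')$ by $k^2 A(z)$. *)
rewrite -(@ler_pXn2r _ 2)// ?nnegrE; last 2 first.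
- by rewrite mulr_ge0// ltW.
- by rewrite mulr_ge0// exprn_ge0.
rewrite exprMn; apply: (@le_trans _ _ (delta ^+ 2 * (k ^+ 2 * A z * A z'))).
  rewrite ler_wpM2l ?exprn_ge0 ?(ltW d0)//; apply: le_trans h8.
  by rewrite lerXn2r ?nnegrE.
have Y0 : 0 <= k ^+ 2 * A z by rewrite mulr_ge0// exprn_ge0.
have h10 : delta ^+ 2 * A z' <= k ^+ 2 * A z.
  apply: le_trans r1; rewrite ler_wpM2r// lerXn2r ?nnegrE ?addr_ge0 ?(ltW d0)//.
  by rewrite lerDl.
by have := ler_wpM2l Y0 h10; rewrite -expr2; lra.
Qed.
End linear_iteration.

Lemma lin_exists0 q f : bdd q -> ae_in (fun x => 0 <= q x) -> sqint f ->
  exists w g, W0 w g /\ lin_sol q f w g.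
Proof.
move=> bq q0 sf; have s0 := sqint0 mu Omega.
have w0 : is_wgrad (fun=> 0) (fun _ _ => 0) by exact: (W0_is_wgrad (W0_0)).
have [w [g [_ _ Ww Lw]]] := lin_exists bq q0 sf s0 w0.
exists w, g; split => //; move: Ww.
by congr W0; [apply/funext => x|apply/funext => i; apply/funext => x]; rewrite subr0.
Qed.

Lemma linear_iteration (k : nat -> R) K z0 : (forall n, 0 <= k n <= K) ->
  sqint z0 -> ae_in (fun x => 0 <= z0 x) ->
  exists z : nat -> rV -> R, [/\ z 0%N = z0, forall n, sqint (z n),
    forall n, ae_in (fun x => 0 <= z n x),
    forall n, exists g, W0 (z n.+1) g /\
      lin_sol (pot (k n.+1)) (fun x => gamma x * (k n * z n x)) (z n.+1) g &
    exists C rho, [/\ 0 <= C, 0 <= rho < 1 &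
      forall n, ip (z n.+1) (z n.+1) <= C * rho ^+ n]].
Proof.
move=> kK sz0 z00.
have k0 n : 0 <= k n by have /andP[] := kK n.
(* The index travels with the function because the coefficients change at each step. Square
   integrability is a premise under the existential, so that [choice] applies to all functions. *)
have ex (p : nat * (rV -> R)) : exists w, sqint p.2 -> exists g, W0 w g /\
    lin_sol (pot (k p.1.+1)) (fun x => gamma x * (k p.1 * p.2 x)) w g.
  have [sp|np] := pselect (sqint p.2); last by exists (fun=> 0).
  have [w [g H]] := lin_exists0 (bdd_potential (k p.1.+1))
    (potential_ge0 (k0 _)) (sqintMl mO bgamma (sqintZ mO (k p.1) sp)).
  by exists w => _; exists g.
have [nxt Hn] := choice ex.
pose z := fix z n := if n is m.+1 then nxt (m, z m) else z0.
have sz n : sqint (z n).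
  elim: n => [|n IH] //=; have [g [[[sw _] _] _]] := Hn (n, z n) IH; exact: sw.
have zS n : exists g, W0 (z n.+1) g /\
    lin_sol (pot (k n.+1)) (fun x => gamma x * (k n * z n x)) (z n.+1) g.
  exact: Hn (n, z n) (sz n).
have skz n : sqint (fun x => gamma x * (k n * z n x)).
  by apply: sqintMl => //; exact: sqintZ.
exists z; split => //.
  elim=> [|n IH] //; have [g [Wg Lg]] := zS n.
  apply: (lin_sol_ge0 Wg (bdd_potential (k n.+1))
    (potential_ge0 (k0 _)) (skz n) Lg).
  by apply: (ae_in_imply2 _ IH gamma0) => x _ h1 h2; rewrite !mulr_ge0.
have [C [C0 HC]] := poincare i0.
have [Mg [Mg0 gMg]] := bdd_ub bgamma.
have M10 : 0 < Mg + 1 by rewrite ltr_wpDl.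
have gMg1 : ae_in (fun x => `|gamma x| <= Mg + 1).
  by apply: (ae_in_imply _ gMg) => x _ h; rewrite (le_trans h)// lerDl.
pose delta := K0 / ((Mg + 1) * C).
have d0 : 0 < delta by rewrite divr_gt0// mulr_gt0.
pose A w := ip (fun x => gamma x * w x) w.
(* This product contracts although [k] varies: its factor [k n] stands in the source of the next
   equation, whose potential contributes [k n.+1]. *)
pose B n := k n ^+ 2 * A (z n).
have A0 w : sqint w -> 0 <= A w by exact: (ipM_ge0 bgamma gamma0).
have B0 n : 0 <= B n by rewrite mulr_ge0 ?exprn_ge0// A0.
have step n : (delta + k n.+1) ^+ 2 * A (z n.+1) <= B n /\
    exists2 g, W0 (z n.+1) g & delta * (K0 * gsq g) <= B n.
  have [g [Wg Lg]] := zS n.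
  have [h1 h2] := linear_iteration_step C0 HC M10 gMg1 (k0 n) (k0 n.+1) (sz n) Wg Lg.
  by split => //; exists g.
have K_0 : 0 <= K by have /andP[h1 h2] := kK 0%N; exact: le_trans h2.
(* As $k/(\delta + k)$ increases with $k$, its value at the common bound [K] serves for every
   step. *)
pose rho := (K / (delta + K)) ^+ 2.
have dK : 0 < delta + K by rewrite ltr_pwDl.
have r0 : 0 <= K / (delta + K) by rewrite divr_ge0// ltW.
have Bgeo n : B n <= rho ^+ n * B 0%N.
  elim: n => [|n IH]; first by rewrite expr0 mul1r.
  rewrite exprS -mulrA; apply: (@le_trans _ _ (rho * B n)); last first.
    by rewrite ler_wpM2l// /rho exprn_ge0.
  have [h1 _] := step n; have dk : 0 < delta + k n.+1 by rewrite ltr_pwDl.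
  have h2 : k n.+1 ^+ 2 <= rho * (delta + k n.+1) ^+ 2.
    rewrite /rho -exprMn lerXn2r ?nnegrE ?(mulr_ge0 r0) ?(ltW dk)//.
    rewrite mulrAC ler_pdivlMr//; have /andP[_ h] := kK n.+1.
    have := ler_wpM2l (ltW d0) h; lra.
  apply: (@le_trans _ _ (rho * (delta + k n.+1) ^+ 2 * A (z n.+1))).
    by rewrite ler_wpM2r// A0.
  by rewrite -mulrA ler_wpM2l// /rho exprn_ge0.
exists (C / (delta * K0) * B 0%N), rho; split.
- by rewrite mulr_ge0// divr_ge0 ?(ltW C0)// mulr_ge0// ltW.
- rewrite /rho exprn_ge0//= expr_lt1// ltr_pdivrMr// mul1r.
  by rewrite ltrDr.
(* The $\gamma$-energy says nothing where $\gamma$ vanishes. The $L^2$ decay comes from the gradient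
   bound in [step], through Poincare's inequality. *)
move=> n; have [_ [g Wg h]] := step n; apply: le_trans (HC _ _ Wg) _.
have -> : C / (delta * K0) * B 0%N * rho ^+ n = C * ((rho ^+ n * B 0%N) / (delta * K0)).
  by field; rewrite !lt0r_neq0.
rewrite ler_wpM2l ?(ltW C0)// ler_pdivlMr ?(mulr_gt0 d0 K00)//.
by apply: le_trans (Bgeo n); move: h; lra.
Qed.

Lemma ip_norm_le c u v : 0 <= c -> sqint u -> sqint v ->
  ae_in (fun x => `|u x| <= c * `|v x|) -> ip u u <= c ^+ 2 * ip v v.
Proof.
move=> c0 su sv uv; rewrite -ipZl//; apply: ip_le => //; first exact: sqintZ.
apply: (ae_in_imply _ uv) => x _ h.
rewrite -mulrA -!expr2 -(real_normK (num_real (u x))) -(real_normK (num_real (v x))) -exprMn.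
by rewrite lerXn2r ?nnegrE// mulr_ge0.
Qed.

Lemma sqint_norm v : sqint v -> sqint (fun x => `|v x|).
Proof.
move=> [mv iv]; split; first exact: measurableT_comp.
by under eq_fun do rewrite real_normK ?num_real//.
Qed.

Lemma W0D v h w g : W0 v h -> W0 w g ->
  W0 (fun x => v x + w x) (fun i x => h i x + g i x).
Proof.
move=> Wv Ww; have := W0P 1 Wv Ww.
by congr W0; [apply/funext => x|apply/funext => i; apply/funext => x]; rewrite mul1r.
Qed.

Lemma lin_solD q f1 f2 u1 g1 u2 g2 : bdd q -> sqint f1 -> sqint f2 ->
  W0 u1 g1 -> W0 u2 g2 -> lin_sol q f1 u1 g1 -> lin_sol q f2 u2 g2 ->
  lin_sol q (fun x => f1 x + f2 x) (fun x => u1 x + u2 x) (fun i x => g1 i x + g2 i x).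
Proof.
move=> bq sf1 sf2 [[su1 sg1] _] [[su2 sg2] _] H1 H2 v h Wv; have [[sv sh] _] := Wv.
have s1 := sqintMl mO bq su1; have s2 := sqintMl mO bq su2.
have -> : (fun i x => g1 i x + g2 i x) = (fun i x => 1 * g1 i x + g2 i x).
  by apply/funext => i; apply/funext => x; rewrite mul1r.
rewrite aformP// mul1r ipDl// -(H1 v h Wv) -(H2 v h Wv).
have -> : ip (fun x => q x * (u1 x + u2 x)) v =
    ip (fun x => q x * u1 x) v + ip (fun x => q x * u2 x) v.
  by rewrite -ipDl//; apply: eq_Rintegral => x _; rewrite mulrDr.
ring.
Qed.

Variables (u : nat -> rV -> R) (gu : nat -> 'I_d -> rV -> R) (k : nat -> R) (K kap : R).
Hypothesis kap0 : 0 < kap.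
Hypothesis kK : forall n, 0 <= k n <= K.
Hypothesis S0 : sol b (fun=> 0) G gG (u 0%N) (gu 0%N).
Hypothesis SS : forall n, sol (pot (k n)) (source (k n) (u n)) G gG (u n.+1) (gu n.+1).
Hypothesis uK : forall n, ae_in (fun x => kap <= u n x).
Hypothesis uk : forall n, ae_in (fun x => theta * u n.+1 x `^ (- (1 + theta)) <= k n.+1).

Let k0 n : 0 <= k n. Proof. by have /andP[] := kK n. Qed.

Let su n : sqint (u n).
Proof. by case: n => [|n]; [have [] := S0|have [] := SS n]. Qed.

Lemma iterates_bounded : exists V, sqint V /\ forall n, ae_in (fun x => u n x <= V x).
Proof.
pose M := kap `^ (- theta).
have sM : sqint (fun x => gamma x * M) by apply: sqintMl => //; exact: sqint_cst.
have [V [gV SV]] := lin_exists bb b0 sM sG wG.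
exists V; split; first by have [] := SV.
elim=> [|n IH].
  apply: (comparison bb b0 sM (sqint0 _ _) SV S0).
  by apply: (ae_in_imply _ gamma0) => x _ h; rewrite mulr_ge0// powR_ge0.
exact: (step_le kap0 (k0 n) (su n)
  (uK n) (SS n) SV (lexx _) IH).
Qed.

Let r n x := gamma x * (u n.+1 x `^ (- theta) - u n x `^ (- theta) +
  k n * (u n.+1 x - u n x)).

Let incr n := step_increment kap0 (su n) (uK n) (SS n)
  kap0 (uK n.+1) (SS n.+1).

(** The source [r 0] has no definite sign, so the first majorant is solved with source $|r_0|$. From
    then on the part of each source that could be negative is absorbed by the source of the next
    majorant. *)
Lemma increment_majorant : exists z : nat -> rV -> R, exists C rho,
  [/\ forall n, sqint (z n),
      forall n, ae_in (fun x => 0 <= (u n.+2 x - u n.+1 x) + z n x),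
      0 <= C, 0 <= rho < 1 & forall n, ip (z n.+1) (z n.+1) <= C * rho ^+ n].
Proof.
have [sr0 WD0 L0] := incr 0%N.
have kp n := potential_ge0 (k0 n).
have bp n := bdd_potential (k n).
have sabs : sqint (fun x => `|r 0%N x|) by exact: sqint_norm.
have [z0 [g0 [Wz0 Lz0]]] := lin_exists0 (bp 1%N) (kp 1%N) sabs.
have [[sz0 sg0] _] := Wz0.
have z00 : ae_in (fun x => 0 <= z0 x).
  by apply: (lin_sol_ge0 Wz0 (bp _) (kp _) sabs Lz0); exact: ae_in_all.
have [z [zE sz zp zS [C [rho [C0 rho1 zC]]]]] := linear_iteration (fun n => kK n.+1) sz0 z00.
exists z, C, rho; split => //.
elim=> [|n IH].
  rewrite zE; have sab := sqintD mO sr0 sabs.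
  apply: (lin_sol_ge0 (W0D WD0 Wz0) (bp 1%N) (kp 1%N) sab).
    exact: (lin_solD (bp _) sr0 sabs WD0 Wz0 L0 Lz0).
  by apply: ae_in_all => x _; rewrite -/(r 0%N x); have := ler_norm (- r 0%N x); rewrite normrN; lra.
have [sr WD L] := incr n.+1; have [g [Wg Lg]] := zS n.
have skz : sqint (fun x => gamma x * (k n.+1 * z n x)).
  by apply: sqintMl => //; exact: sqintZ.
have sab := sqintD mO sr skz.
apply: (lin_sol_ge0 (W0D WD Wg) (bp n.+2) (kp n.+2) sab).
  exact: (lin_solD (bp _) sr skz WD Wg L Lg).
have h := ae_in_and (uK n.+1) (uK n.+2).
have {}h := ae_in_and h (uk n).
have {}h := ae_in_and h gamma0.
apply: (ae_in_imply2 _ h (ae_in_and IH (zp n))).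
move=> x _ [[[h1 h2] h3] h4] [h5 h6]; rewrite /r -mulrDr mulr_ge0//.
(* Let $d$ be the increment, $z$ its majorant and $p \le k$ the tangent slope. The bracket is at
   least $(k - p)d + kz = (k - p)(d + z) + pz$, a sum of nonnegative terms. *)
have u0 := lt_le_trans kap0 h1; have := powRN_tangent theta0 u0 (lt_le_trans kap0 h2).
set p := theta * _ in h3 *; have p0 : 0 <= p by rewrite mulr_ge0// powR_ge0.
by nra.
Qed.

(* Adding the partial sums of the majorants makes the iterates nondecreasing. *)
Lemma iterates_cvg_sqdist : exists w, sqint w /\
  (fun n => sqdist (u n) w) @ \oo --> (0 : R).
Proof.
have [V [sV uV]] := iterates_bounded.
have [z [C [rho [sz zp C0 rho1 zC]]]] := increment_majorant.
have [L [L0 HL]] := geometric_partial_sums mO C0 rho1 (fun n => sz n.+1) zC.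
(* The sum starts at [z 1], where the geometric bound starts; accordingly [U n] is built on
   [u n.+2]. *)
pose S n x := \sum_(i < n) z i.+1 x.
have sS n : sqint (S n) := sqint_partial_sum mO n (fun n => sz n.+1).
pose U n x := u n.+2 x + S n x.
have sU n : sqint (U n) := sqintD mO (su n.+2) (sS n).
have U0 : ae_in (fun x => 0 <= U 0%N x).
  by apply: (ae_in_imply _ (uK 2)) => x _; rewrite /U /S big_ord0 addr0; apply/le_trans/ltW.
have US n : ae_in (fun x => U n x <= U n.+1 x).
  by apply: (ae_in_imply _ (zp n.+1)) => x _; rewrite /U /S big_ord_recr/=; lra.
have Sb n : ip (S n) (S n) <= L.
  have := HL n 0%N; rewrite expr0 mulr1; apply: le_trans; rewrite le_eqVlt.
  by apply/orP; left; apply/eqP; apply: eq_Rintegral => x _; rewrite big_ord0 subr0.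
have Ub n : ip (U n) (U n) <= 2 * ip V V + 2 * L.
  apply: le_trans (ip_sqrD_le mO (su n.+2) (sS n)) _; apply: lerD; rewrite ler_wpM2l//.
  apply: ip_le => //; apply: (ae_in_imply2 _ (uK n.+2) (uV n.+2)) => x _ h1 h2.
  by have h3 := le_trans (ltW kap0) h1; apply: ler_pM.
have cU := nondecreasing_sqint_cauchy mO sU U0 US Ub.
have cS e : 0 < e -> exists N, forall m n, (N <= m)%N -> (N <= n)%N ->
    sqdist (S m) (S n) <= e.
  move=> e0; have cr : (fun n => L * rho ^+ n) @ \oo --> (0 : R).
    have /andP[r0 r1] := rho1; rewrite -(mulr0 L); apply: cvgMr; apply: cvg_expr.
    by rewrite ger0_norm.
  have [N HN] := cvg0_le cr e0; exists N => m n; wlog nm : m n / (n <= m)%N.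
    move=> H Nm Nn; have [/H|/ltnW /H] := leqP n m; first exact.
    by rewrite sqdistC; apply.
  by move=> Nm Nn; have := HL (m - n)%N n; rewrite subnKC// => h; exact: le_trans (HN n Nn).
have cu e : 0 < e -> exists N, forall m n, (N <= m)%N -> (N <= n)%N ->
    sqdist (u m.+2) (u n.+2) <= e.
  move=> e0; have e4 : 0 < e / 4 by rewrite divr_gt0.
  have [N1 H1] := cU _ e4; have [N2 H2] := cS _ e4.
  exists (maxn N1 N2) => m n; rewrite !geq_max => /andP[m1 m2] /andP[n1 n2].
  have := H1 m n m1 n1; have := H2 m n m2 n2.
  have -> : sqdist (u m.+2) (u n.+2) = ip (fun x => (U m x - U n x) + (S n x - S m x))
      (fun x => (U m x - U n x) + (S n x - S m x)).
    by apply: eq_Rintegral => x _; rewrite /U; ring.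
  have := ip_sqrD_le mO (sqintB mO (sU m) (sU n)) (sqintB mO (sS n) (sS m)).
  by rewrite (sqdistC _ _ (S m)) /sqdist; lra.
have [w [sw cw]] := sqint_complete mO (fun n => su n.+2) cu.
exists w; split => //.
by apply: cvg_sqdist_shift; exact: (@cvg_sqdist_shift _ _ _ _ _ (fun n => u n.+1)).
Qed.

(** The source of [u n.+1] for the fixed potential [b]. The variable part [k n] of the potential is
    moved to the right, where it multiplies a difference that tends to 0. *)
Let h n x := gamma x * (u n x `^ (- theta) + k n * (u n x - u n.+1 x)).

Let sPu n : sqint (fun x => u n x `^ (- theta)).
Proof. exact: (sqint_powRN kap0 (su n) (uK n)). Qed.

Let sh n : sqint (h n).
Proof. by apply: sqintMl => //; apply: sqintD => //; apply: sqintZ => //; exact: sqintB. Qed.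

Let Sh n : sol b (h n) G gG (u n.+1) (gu n.+1).
Proof.
have [s1 w1 W1 L1] := SS n; split => //.
have bk : bdd (fun x => gamma x * (- k n)) by exact: bddZ.
have := lin_sol_shift (bdd_potential (k n)) bk
  (sqint_source (k n) kap0 (su n) (uK n)) s1 L1.
have -> : (fun x => b x + gamma x * k n + gamma x * - k n) = b.
  by apply/funext => x; ring.
by congr lin_sol; apply/funext => x; rewrite /source /h; ring.
Qed.

(** The candidate [w] solves the linear problem with the nonlinear term frozen at the $L^2$ limit
    [v]. The sources [h n] tend to this frozen source in $L^2$, because $t^{-\theta}$ is Lipschitz
    above [kap] and [k] is bounded. The energy estimate then gives convergence to [w] in $H^1$, so
    [v] and [w] agree almost everywhere and the freezing disappears. *)
Theorem iteration_converges : exists w gw,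
  [/\ sol b (fun x => gamma x * w x `^ (- theta)) G gG w gw,
  ae_in (fun x => kap <= w x) &
  (fun n => pdist (u n) (gu n) w gw) @ \oo --> (0 : R)].
Proof.
have [v [sv cv]] := iterates_cvg_sqdist.
have vK := ae_ge_limit mO su sv cv uK.
have sPv := sqint_powRN kap0 sv vK.
have sgPv := sqintMl mO bgamma sPv.
have [w [gw Sw]] := lin_exists bb b0 sgPv sG wG.
have [C [C0 HC]] := lin_sol_bound.
have [Mg [Mg0 gMg]] := bdd_ub bgamma.
have K_0 : 0 <= K by have /andP[h1 h2] := kK 0%N; exact: le_trans h2.
pose Lp := Mg * (theta * kap `^ (- (1 + theta))).
have Lp0 : 0 <= Lp by rewrite mulr_ge0// mulr_ge0// powR_ge0.
have resid n : ip (fun x => h n x - gamma x * v x `^ (- theta))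
    (fun x => h n x - gamma x * v x `^ (- theta)) <=
    2 * (Lp ^+ 2 * sqdist (u n) v) + 2 * ((Mg * K) ^+ 2 * sqdist (u n) (u n.+1)).
  pose A x := gamma x * (u n x `^ (- theta) - v x `^ (- theta)).
  pose B x := gamma x * (k n * (u n x - u n.+1 x)).
  have sA : sqint A by apply: sqintMl => //; exact: sqintB.
  have sB : sqint B by apply: sqintMl => //; apply: sqintZ => //; exact: sqintB.
  have -> : (fun x => h n x - gamma x * v x `^ (- theta)) = (fun x => A x + B x).
    by apply/funext => x; rewrite /h /A /B; ring.
  apply: le_trans (ip_sqrD_le mO sA sB) _; apply: lerD; rewrite ler_wpM2l//.
    apply: ip_norm_le => //; first exact: sqintB.
    apply: (ae_in_imply2 _ gMg (ae_in_and (uK n) vK)).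
    move=> x _ h1 [h2 h3]; rewrite /A normrM /Lp -mulrA; apply: ler_pM => //.
    exact: powRN_lip.
  apply: ip_norm_le => //; [by rewrite mulr_ge0|exact: sqintB|].
  apply: (ae_in_imply _ gMg) => x _ h1; rewrite /B !normrM -mulrA; apply: ler_pM => //.
  by rewrite ler_wpM2r// ger0_norm//; have /andP[] := kK n.
have bound n : pdist (u n.+1) (gu n.+1) w gw <=
    C * (2 * (Lp ^+ 2 * sqdist (u n) v) + 2 * ((Mg * K) ^+ 2 * sqdist (u n) (u n.+1))).
  have [_ _ W1 L1] := Sh n; have [_ _ W2 L2] := Sw.
  have L := lin_solB bb (sh n) sgPv (sol_sqint_pair (Sh n)) (sol_sqint_pair Sw) L1 L2.
  have := HC _ _ _ _ (W0_trace_diff W1 W2) bb b0 (sqintB mO (sh n) sgPv) L.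
  by move/le_trans; apply; rewrite ler_wpM2l// ltW.
have cvS : (fun n => sqdist (u n.+1) v) @ \oo --> (0 : R).
  by have := cv; rewrite -cvg_shiftS.
have cuu : (fun n => sqdist (u n) (u n.+1)) @ \oo --> (0 : R).
  have c2 : (fun n => sqdist (u n) v + sqdist (u n.+1) v) @ \oo --> (0 : R).
    by rewrite -(addr0 (0 : R)); exact: cvgD.
  apply: (cvg0_bound (C := 2) _ c2) => n; rewrite sqdist_ge0/=.
  by have := sqdist_tri mO (su n) (su n.+1) sv; rewrite (sqdistC _ _ v); lra.
have cp : (fun n => pdist (u n.+1) (gu n.+1) w gw) @ \oo --> (0 : R).
  have c3 : (fun n => 2 * (Lp ^+ 2 * sqdist (u n) v) +
      2 * ((Mg * K) ^+ 2 * sqdist (u n) (u n.+1))) @ \oo --> (0 : R).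
    rewrite -(addr0 (0 : R)); apply: cvgD.
      by rewrite -(mulr0 2); apply: cvgMr; rewrite -(mulr0 (Lp ^+ 2)); exact: cvgMr.
    by rewrite -(mulr0 2); apply: cvgMr; rewrite -(mulr0 ((Mg * K) ^+ 2)); exact: cvgMr.
  by apply: (cvg0_bound (C := C) _ c3) => n; rewrite pdist_ge0 bound.
have cpu : (fun n => pdist (u n) (gu n) w gw) @ \oo --> (0 : R).
  by rewrite -cvg_shiftS.
have [sw ww Ww Lw] := Sw.
have vw : ae_in (fun x => v x = w x).
  exact: (sqdist_unique mO su sv sw cv (sqdist_cvg cpu)).
have wK : ae_in (fun x => kap <= w x).
  by apply: (ae_in_imply2 _ vK vw) => x _ h1 <-.
exists w, gw; split; [split; [exact: sw|exact: ww|exact: Ww|]|exact: wK|exact: cpu].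
apply: (lin_sol_ext sgPv _ _ Lw).
  by apply: sqintMl => //; exact: (sqint_powRN kap0 sw wK).
by apply: (ae_in_imply _ vw) => x _ ->.
Qed.

End newton_iteration.

(** * The semilinear problem *)

Section semilinear.

Variables (b c : rV -> R) (theta : R).
Hypothesis bb : bdd b.
Hypothesis b0 : ae_in (fun x => 0 <= b x).
Hypothesis bc : bdd c.
Hypothesis c0 : ae_in (fun x => c x <= 0).
Hypothesis theta0 : 0 <= theta.
Let gamma x := - c x.

Let bgamma : bdd gamma.
Proof.
have [mc [M cM]] := bc; split; first exact: measurableT_comp.
by exists M; apply: (ae_in_imply _ cM) => x _; rewrite normrN.
Qed.

Let gamma0 : ae_in (fun x => 0 <= gamma x).
Proof. by apply: (ae_in_imply _ c0) => x _; rewrite oppr_ge0. Qed.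

Variables (G : rV -> R) (gG : 'I_d -> rV -> R).
Hypothesis sG : sqint G.
Hypothesis wG : is_wgrad G gG.

Lemma sol_pos_weak_sol w gw kap : 0 < kap -> ae_in (fun x => kap <= w x) ->
  sol b (fun x => gamma x * w x `^ (- theta)) G gG w gw ->
  pos_weak_sol Omega a b c theta G w.
Proof.
move=> kap0 kw [sw ww Ww Lw].
have sP := sqint_powRN theta0 kap0 sw kw.
split.
- exact: is_wgrad_H1 ww.
- by apply: (ae_in_imply _ kw) => x _; exact: lt_le_trans.
- by apply/(H10_W0); eexists; exact: Ww.
move=> v /(H10_W0)[h Wv]; have [[sv _] _] := Wv.
have sbw := sqintMl mO bb sw; have scP := sqintMl mO bc sP.
split; first by apply: sqint_integM => //; exact: sqintD.
rewrite (dirichlet_formE ba sw sv ww (W0_is_wgrad Wv)).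
have e : aform a gw h + ip (fun x => b x * w x) v =
    ip (fun x => gamma x * w x `^ (- theta)) v := Lw v h Wv.
rewrite -[\int[mu]_(x in Omega) _]/(ip (fun x => b x * w x + c x * w x `^ (- theta)) v).
rewrite ipDl//.
have e2 : ip (fun x => gamma x * w x `^ (- theta)) v = - ip (fun x => c x * w x `^ (- theta)) v.
  by rewrite -ipNl//; apply: eq_Rintegral => x _; rewrite /gamma mulNr.
by rewrite e2 in e; lra.
Qed.

(** An arbitrary positive solution has no known positive lower bound, so its negative power need not
    be square integrable. Only the whole integrands are known to be integrable; they are therefore
    compared directly, without splitting them into inner products. *)
Lemma pos_weak_sol_unique u w : pos_weak_sol Omega a b c theta G u ->
  pos_weak_sol Omega a b c theta G w -> ae_in (fun x => u x = w x).
Proof.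
move=> [Hu u0 tu eu] [Hw w0 tw ew].
have su := H1_sqint Hu; have sw := H1_sqint Hw.
have wu := H1_wgrad Hu; have ww := H1_wgrad Hw.
have [k Wk] := (H10_W0 _).1 tu; have [l Wl] := (H10_W0 _).1 tw.
have Wv := W0B Wk Wl.
pose v x := u x - w x; have sv0 : sqint v by exact: sqintB.
have {}Wv : W0 v (fun i x => wgrad Omega u i x - wgrad Omega w i x).
  have wv := is_wgradB su sw wu ww.
  apply: (W0_ae Wv); last 2 first.
  - by apply: ae_in_all => x _; rewrite /v; ring.
  - have E : (fun x => u x - G x - (w x - G x)) = v by apply/funext => x; rewrite /v; ring.
    move=> i; have := W0_is_wgrad Wv; rewrite E => h.
    by apply: (is_wgrad_unique (v := v) i h wv) => //; exact: ae_in_all.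
  split; first exact: sqintB.
  by move=> i; apply: sqintB => //; [exact: is_wgrad_sqint wu|exact: is_wgrad_sqint ww].
have Hv : H10 Omega v by apply/(H10_W0); eexists; exact: Wv.
have [sv sgv] := Wv.1.
have wv := W0_is_wgrad Wv.
have [iu du] := eu v Hv; have [iw dw] := ew v Hv.
move: du dw; rewrite (dirichlet_formE ba su sv wu wv) (dirichlet_formE ba sw sv ww wv).
set Fu := fun x => (b x * u x + c x * u x `^ (- theta)) * v x in iu *.
set Fw := fun x => (b x * w x + c x * w x `^ (- theta)) * v x in iw *.
move=> du dw.
have sgu i : sqint (wgrad Omega u i) by exact: is_wgrad_sqint wu.
have sgw i : sqint (wgrad Omega w i) by exact: is_wgrad_sqint ww.
have FF : \int[mu]_(x in Omega) Fw x <= \int[mu]_(x in Omega) Fu x.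
  apply: le_Rintegral_ae => //.
  apply: (ae_in_imply2 _ (ae_in_and u0 w0)
    (ae_in_and b0 c0)) => x _ [ux wx] [bx cx].
  rewrite -subr_ge0.
  have -> : Fu x - Fw x = b x * v x ^+ 2 +
      (- c x) * ((w x `^ (- theta) - u x `^ (- theta)) * (u x - w x)).
    by rewrite /Fu /Fw /v; ring.
  rewrite addr_ge0 ?(mulr_ge0 bx (sqr_ge0 _))// mulr_ge0 ?oppr_ge0//.
  have [uw|/ltW uw] := leP (u x) (w x).
    by rewrite mulr_le0 ?subr_le0// powRN_le.
  by rewrite mulr_ge0 ?subr_ge0// powRN_le.
have := aform_ge sgv; rewrite aformB// du dw => h.
have g0 : gsq (fun i x => wgrad Omega u i x - wgrad Omega w i x) <= 0.
  by rewrite -(ler_pM2l K00) mulr0; apply: le_trans h _; rewrite opprK addrC subr_le0.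
have [C [C0 HC]] := poincare i0.
have v0 : ip v v <= 0.
  by apply: le_trans (HC _ _ Wv) _; rewrite -(mulr0 C) ler_wpM2l// ltW.
by apply: (ae_in_imply _ (ip_eq0 mO sv v0)) => x _ /eqP; rewrite subr_eq0 => /eqP.
Qed.

Hypothesis O0 : Omega !=set0.
Variable K2 : R.
Hypothesis K20 : 0 < K2.
Hypothesis GK : ae_in (fun x => K2 <= G x).
Hypothesis homogeneous_lb : forall u gu, sol b (fun=> 0) G gG u gu ->
  exists kap, 0 < kap /\ ae_in (fun x => kap <= u x).
Local Notation pot k := (fun x => b x + gamma x * k).
Local Notation source := (source gamma theta).
Local Notation iteration := (iteration Omega a b c theta G).

(** [kappa] reads a whole sequence; this form reads only the current iterate, so that one step can
    be stated before the sequence is constructed. *)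
Let kap_of n u := if n is 0%N then essinf Omega G else essinf Omega u.
Let k_of n u := theta * kap_of n u `^ (- (1 + theta)).

Let kappaE Psi n : kappa Omega G Psi n = kap_of n (Psi n).
Proof. by case: n. Qed.

Let k_of_ge0 n u : 0 <= k_of n u.
Proof. by rewrite mulr_ge0// powR_ge0. Qed.

Lemma step_weak_sol n (u v : rV -> R) :
  let nu := - theta * kap_of n u `^ (- (1 + theta)) in
  weak_sol_linear Omega a (fun x => b x + c x * nu)
    (fun x => - c x * (u x `^ (- theta) - nu * u x)) G v =
  weak_sol_linear Omega a (pot (k_of n u)) (source (k_of n u) u) G v.
Proof.
move=> nu; congr weak_sol_linear; apply/funext => x.
  by rewrite /nu /gamma /k_of; ring.
by rewrite /source /nu /gamma /k_of; ring.
Qed.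

Lemma iteration_sol Psi : iteration Psi ->
  sol b (fun=> 0) G gG (Psi 0%N) (wgrad Omega (Psi 0%N)) /\
  forall n, sol (pot (k_of n (Psi n))) (source (k_of n (Psi n)) (Psi n)) G gG
    (Psi n.+1) (wgrad Omega (Psi n.+1)).
Proof.
move=> [H0 HS]; split; first exact: (weak_sol_sol sG wG H0).
by move=> n; have /= := HS n; rewrite kappaE step_weak_sol; exact: (weak_sol_sol sG wG).
Qed.

Lemma step_lower_bound n kap Psi0 gP0 u v gv : 0 < kap ->
  sol b (fun=> 0) G gG Psi0 gP0 -> ae_in (fun x => kap <= Psi0 x) ->
  sqint u -> ae_in (fun x => Psi0 x <= u x) ->
  sol (pot (k_of n u)) (source (k_of n u) u) G gG v gv -> ae_in (fun x => Psi0 x <= v x).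
Proof.
move=> kap0 S0 h0 su hu Sv.
have uK : ae_in (fun x => kap <= u x) by apply: (ae_in_imply2 _ h0 hu) => x _; exact: le_trans.
exact: (step_ge bb b0 bgamma gamma0 theta0 kap0 (k_of_ge0 n u) su uK Sv S0 hu).
Qed.

Lemma iteration_lower_bound Psi : iteration Psi ->
  exists kap, 0 < kap /\ forall n, ae_in (fun x => kap <= Psi n x).
Proof.
move=> /iteration_sol[S0 SS]; have [kap [kap0 h0]] := homogeneous_lb S0.
exists kap; split => // n.
suff h : ae_in (fun x => Psi 0%N x <= Psi n x).
  by apply: (ae_in_imply2 _ h0 h) => x _; exact: le_trans.
elim: n => [|n IH]; first exact: ae_in_all.
apply: (step_lower_bound kap0 S0 h0 _ IH (SS n)).
by case: n {IH} => [|n]; [have [] := S0|have [] := SS n].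
Qed.

Lemma kap_of_ge n kap u : 0 < kap -> ae_in (fun x => kap <= u x) ->
  Num.min K2 kap <= kap_of n u.
Proof.
move=> kap0 hu; rewrite ge_min; case: n => [|n] /=.
  by have [-> _] := essinf_ge oO O0 GK.
by have [-> _] := essinf_ge oO O0 hu; rewrite orbT.
Qed.

Lemma kappa_gt0 n kap u : 0 < kap -> ae_in (fun x => kap <= u x) -> 0 < kap_of n u.
Proof. by move=> kap0 /(kap_of_ge n kap0); apply: lt_le_trans; rewrite lt_min K20. Qed.

Lemma iteration_exists : exists Psi, iteration Psi.
Proof.
have s0 := sqint0 mu Omega.
have [Psi0 [gP0 S0]] := lin_exists bb b0 s0 sG wG.
have [kap [kap0 h0]] := homogeneous_lb S0.
(* The invariant of the recursion: with [kap <= Psi0] it keeps the negative power bounded, so that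
   the next source is square integrable. *)
pose good u := sqint u /\ ae_in (fun x => Psi0 x <= u x).
have goodK u : good u -> ae_in (fun x => kap <= u x).
  by move=> [_ hu]; apply: (ae_in_imply2 _ h0 hu) => x _; exact: le_trans.
have ex (p : nat * (rV -> R)) : exists v, good p.2 -> good v /\ exists gv,
    sol (pot (k_of p.1 p.2)) (source (k_of p.1 p.2) p.2) G gG v gv.
  have [gp|np] := pselect (good p.2); last by exists (fun=> 0).
  have sf := sqint_source bgamma theta0 (k_of p.1 p.2) kap0 gp.1 (goodK _ gp).
  have [v [gv Sv]] := lin_exists (bdd_potential bb bgamma (k_of p.1 p.2))
    (potential_ge0 b0 gamma0 (k_of_ge0 p.1 p.2)) sf sG wG.
  exists v => _; split; last by exists gv.
  split; first by have [] := Sv.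
  exact: step_lower_bound kap0 S0 h0 gp.1 gp.2 Sv.
have [nxt Hn] := choice ex.
pose Psi := fix Psi n := if n is m.+1 then nxt (m, Psi m) else Psi0.
have gP n : good (Psi n).
  elim: n => [|n IH] /=; first by split; [have [] := S0|exact: ae_in_all].
  by have [] := Hn (n, Psi n) IH.
exists Psi; split; first exact: (sol_weak_sol sG wG bb s0 S0).
move=> n /=; rewrite kappaE step_weak_sol; have [_ [gv Sv]] := Hn (n, Psi n) (gP n).
apply: (sol_weak_sol sG wG _ _ Sv); first exact: bdd_potential.
exact: (sqint_source bgamma theta0 _ kap0 (gP n).1 (goodK _ (gP n))).
Qed.

Lemma iteration_unique Psi Psi' : iteration Psi -> iteration Psi' ->
  forall n, ae_in (fun x => Psi n x = Psi' n x).
Proof.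
move=> I1 I2; have [S0 SS] := iteration_sol I1; have [S0' SS'] := iteration_sol I2.
have [kap [kap0 hk]] := iteration_lower_bound I1.
have [kap' [kap0' hk']] := iteration_lower_bound I2.
have s0 := sqint0 mu Omega.
have eq2 (u v : rV -> R) : ae_in (fun x => u x <= v x) -> ae_in (fun x => v x <= u x) ->
    ae_in (fun x => u x = v x).
  by move=> h1 h2; apply: (ae_in_imply2 _ h1 h2) => x _ h3 h4; apply: le_anti; rewrite h3 h4.
have sP n : sqint (Psi n) by case: n => [|n]; [have [] := S0|have [] := SS n].
have sP' n : sqint (Psi' n) by case: n => [|n]; [have [] := S0'|have [] := SS' n].
elim=> [|n IH].
  have le0 : ae_in (fun x : rV => (0 : R) <= 0) by exact: ae_in_all.
  by apply: eq2; [exact: (comparison bb b0 s0 s0 S0' S0 le0)|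
                  exact: (comparison bb b0 s0 s0 S0 S0' le0)].
have S1 := SS n; have S2 := SS' n.
(* Iterates equal almost everywhere have the same essential infimum, and at index 0 both constants
   come from the datum. The next iterates thus solve the same linear problem, and comparison applies
   in both directions. *)
have ek : k_of n (Psi' n) = k_of n (Psi n).
  suff e : kap_of n (Psi' n) = kap_of n (Psi n) by rewrite /k_of e.
  case: n IH {S1 S2} => [_|n IH]; first exact: erefl.
  exact/esym/essinf_ae/IH.
rewrite ek in S2; set k := k_of n (Psi n) in S1 S2.
have sf1 := sqint_source bgamma theta0 k kap0 (sP n) (hk n).
have sf2 := sqint_source bgamma theta0 k kap0' (sP' n) (hk' n).
have bp := bdd_potential bb bgamma k.
have p0 := potential_ge0 b0 gamma0 (k_of_ge0 n (Psi n)).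
apply: eq2.
  apply: (comparison bp p0 sf2 sf1 S2 S1).
  by apply: (ae_in_imply _ IH) => x _; rewrite /source => ->.
apply: (comparison bp p0 sf1 sf2 S1 S2).
by apply: (ae_in_imply _ IH) => x _; rewrite /source => ->.
Qed.

Lemma iteration_positive Psi : iteration Psi -> forall n,
  ae_in (fun x => 0 < Psi n x) /\ 0 < kappa Omega G Psi n.
Proof.
move=> I n; have [kap [kap0 hk]] := iteration_lower_bound I; split.
  by apply: (ae_in_imply _ (hk n)) => x _; exact: lt_le_trans.
by rewrite kappaE; exact: kappa_gt0 kap0 (hk n).
Qed.

Lemma iteration_cvg Psi : iteration Psi -> exists w,
  pos_weak_sol Omega a b c theta G w /\ H1_cvg Omega Psi w.
Proof.
move=> I; have [S0 SS] := iteration_sol I; have [kap [kap0 hk]] := iteration_lower_bound I.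
(* [K2] bounds [kappa] below at index 0, where it comes from the datum, and [kap] at all later
   indices. *)
pose m := Num.min K2 kap; have m0 : 0 < m by rewrite lt_min K20.
have powle t : m <= t -> theta * t `^ (- (1 + theta)) <= theta * m `^ (- (1 + theta)).
  move=> mt; rewrite ler_wpM2l//.
  by have := @powRN_le _ (1 + theta) _ m t m0 mt; apply; rewrite addr_ge0.
have kK n : 0 <= k_of n (Psi n) <= theta * m `^ (- (1 + theta)).
  by rewrite k_of_ge0/= powle// kap_of_ge.
have uk n : ae_in (fun x => theta * Psi n.+1 x `^ (- (1 + theta)) <= k_of n.+1 (Psi n.+1)).
  have [kl] := essinf_ge oO O0 (hk n.+1); apply: ae_in_imply => x _ h.
  rewrite /k_of ler_wpM2l// powRN_le//; first by rewrite addr_ge0.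
  exact: lt_le_trans kl.
have [w [gw [Sw kw cw]]] := iteration_converges (u := Psi) (gu := fun n => wgrad Omega (Psi n))
  (k := fun n => k_of n (Psi n)) bb b0 bgamma gamma0 theta0
  sG wG kap0 kK S0 SS hk uk.
exists w; split; first exact: sol_pos_weak_sol kap0 kw Sw.
have [sw ww _ _] := Sw.
apply/(H1_cvgP (g_ := fun n => wgrad Omega (Psi n)) _ sw _ ww) => //.
  by case=> [|n]; [have [] := S0|have [] := SS n].
by case=> [|n]; [have [] := S0|have [] := SS n].
Qed.

(** [H1norm] uses a chosen gradient, which may depend on the representative. A weak gradient of [u]
    is also one of [v], and [H1_cvgP] shows that the choice does not affect convergence. *)
Lemma H1_cvg_ae (u_ : nat -> rV -> R) u v : (forall n, H1 Omega (u_ n)) ->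
  H1 Omega u -> H1 Omega v -> ae_in (fun x => u x = v x) ->
  H1_cvg Omega u_ u -> H1_cvg Omega u_ v.
Proof.
move=> Hn Hu Hv uv; have sn n := H1_sqint (Hn n); have wn n := H1_wgrad (Hn n).
have su := H1_sqint Hu; have wu := H1_wgrad Hu.
have sv := H1_sqint Hv; have wv := H1_wgrad Hv.
have wvu : is_wgrad v (wgrad Omega u).
  move=> i; have [suv hu] := wu i; split => // phi /test_fun_tfun tf.
  rewrite -hu; last by case: tf.
  have sphi := tfun_sqintg oO bO i tf.
  by apply/esym; apply: (ip_ae mO su sv sphi sphi uv); exact: ae_in_all.
move=> /(H1_cvgP sn su wn wu) cv; apply/(H1_cvgP sn sv wn wvu); move: cv.
have suu n := sqintB mO (sn n) su; have svv n := sqintB mO (sn n) sv.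
rewrite (_ : (fun n => pdist _ _ v _) =
  fun n => pdist (u_ n) (wgrad Omega (u_ n)) u (wgrad Omega u))//.
apply/funext => n; congr (_ + _).
apply: (ip_ae mO (svv n) (suu n) (svv n) (suu n)); by apply: (ae_in_imply _ uv) => x _ ->.
Qed.

End semilinear.

End elliptic.

(** * The barrier *)

Section exponential_barrier.

Variables (K0 K1 L : R) (a : rV -> R).
Hypothesis K00 : 0 < K0.
Hypothesis L0 : 0 <= L.
Hypothesis ma : measurable_fun Omega a.
Hypothesis aK : forall x, Omega x -> K0 <= a x <= K1.
Variable (i0 : 'I_d).
Local Notation e_ i := (delta_mx 0 i : 'rV[R]_d).
Hypothesis aL : forall x (h : R), 0 < h -> Omega x -> Omega (x - h *: e_ i0) ->
  `|a (x - h *: e_ i0) - a x| <= L * h.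

Let ba : bdd a.
Proof.
split => //; exists K1; apply: ae_in_all => x /aK /andP[h1 h2].
by rewrite ger0_norm// (le_trans (ltW K00)).
Qed.

Let aK' : ae_in (fun x => K0 <= a x).
Proof. by apply: ae_in_all => x /aK /andP[]. Qed.

Section barrier.
Variable lam : R.
Hypothesis lam0 : 0 < lam.

Let v (x : rV) : R := expR (lam * x 0 i0).
Let gv i x : R := lam * v x * (i == i0)%:R.

Lemma C1at_barrier x : C1at v gv x.
Proof.
apply: (@C1at_comp _ _ (fun t => expR (lam * t)) (fun t => lam * expR (lam * t))
  (fun x => x 0 i0) (fun i _ => (i == i0)%:R)).
- exact: C1at_coord.
- by apply: is_derive_eq; rewrite /GRing.scale/= mulr1 mulrC.
- by apply: continuous_comp; [exact: mulrl_continuous|exact: continuous_expR].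
apply: continuousM; first exact: cst_continuous.
by apply: continuous_comp; [exact: mulrl_continuous|exact: continuous_expR].
Qed.

Lemma barrier_bounds : exists B, forall x, Omega x -> expR (- B) <= v x <= expR B.
Proof.
have [B [B0 OB]] := bounded_box bO; exists (lam * B) => x /OB /(_ i0).
rewrite mxE subr0 => /ltW; rewrite ler_norml => /andP[h1 h2].
by rewrite /v !ler_expR -mulrN !ler_pM2l// h1.
Qed.

Let mv : measurable_fun Omega v.
Proof. by apply: measurable_fun_open => // x _; have [] := C1at_barrier x. Qed.

Let sv : sqint v.
Proof.
have [B hB] := barrier_bounds; apply: (@sqint_bounded _ _ _ oO bO _ (expR B)) => //.
by move=> x /hB/andP[_]; rewrite ger0_norm ?expR_ge0.
Qed.

Let sgv i : sqint (gv i).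
Proof.
have -> : gv i = fun x => (lam * (i == i0)%:R) * v x by apply/funext => x; rewrite /gv; ring.
exact: sqintZ.
Qed.

(* The Lipschitz coefficient [a] is never differentiated: the equation is tested
   in the limit of difference quotients of [a * v']. *)
Lemma barrier_subsolution M psi H : M <= K0 * lam ^+ 2 / 2 - lam * L ->
  tfun Omega psi H -> (forall x, 0 <= psi x) ->
  aform a gv H <= - M * ip v psi.
Proof.
move=> hM tf psi0.
have [B hB] := barrier_bounds.
pose F0 (x : rV) := a x * (lam * v x).
(* The flux [a * lam * v] is cut off outside [Omega], because the difference quotient argument needs
   a bounded measurable function on the whole space. *)
pose F := F0 \_ Omega.
have FE x : Omega x -> F x = F0 x by move=> Ox; rewrite /F patchE mem_set.
have mF0 : measurable_fun Omega F0.
  by apply: measurable_funM => //; apply: measurable_funM.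
have mF : measurable_fun setT F by apply/(measurable_restrictT F0 mO).
have FB x : `|F x| <= `|K1 * (lam * expR B)|.
  have [Ox|Ox] := pselect (Omega x); last by rewrite /F patchE memNset// normr0.
  rewrite FE// /F0; have /andP[h1 h2] := hB x Ox; have /andP[h3 h4] := aK Ox.
  have a0 := le_trans (ltW K00) h3; have K10 := le_trans a0 h4.
  rewrite ger0_norm; last by rewrite !mulr_ge0 ?expR_ge0// ltW.
  rewrite ger0_norm; last by rewrite !mulr_ge0 ?expR_ge0// ltW.
  by rewrite ler_pM// ?(mulr_ge0 (ltW lam0)) ?expR_ge0// ler_pM2l.
have cv := difference_quotient_cvg bO (i := i0) tf mF FB.
have -> : aform a gv H = \int[mu]_x (F x * H i0 x).
  rewrite /aform (bigD1 i0)//= big1 => [|i ii].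
    rewrite addr0 -(Rintegral_tfun (Omega := Omega)); last first.
      by move=> x Ox; rewrite (tfungO i0 tf Ox) mulr0.
    apply: eq_Rintegral => x; rewrite inE => Ox.
    by rewrite FE// /F0 /gv eqxx mulr1.
  have -> : (fun x => a x * gv i x) = fun=> 0; last first.
    by apply: (ip0l mO); [exact: ae_in_all|exact: sqint0|exact: (tfun_sqintg oO bO i tf)].
  by apply/funext => x; rewrite /gv (negbTE ii) !mulr0.
have spsi := tfun_sqint oO bO tf.
(* The quotient of [a * lam * v] splits into a loss of at most [lam * L * v], from the variation of
   [a], and a gain of at least [K0 * lam ^+ 2 / 2 * v], from the exponential. *)
have step n x : n.+1%:R^-1 * lam <= 1 -> Omega x -> Omega (x - n.+1%:R^-1 *: e_ i0) ->
    (F (x - n.+1%:R^-1 *: e_ i0) - F x) / n.+1%:R^-1 <= - M * v x.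
  have : 0 < n.+1%:R^-1 :> R by rewrite invr_gt0.
  move: (n.+1%:R^-1) => h h0 hl Ox Oxh; rewrite !FE// ler_pdivrMr// /F0.
  have -> : v (x - h *: e_ i0) = v x * expR (- (h * lam)).
    rewrite /v -expRD; congr expR; rewrite !mxE !eqxx mulr1; ring.
  have [y yE] : exists y, h * lam = y by eexists.
  have y0 : 0 < y by rewrite -yE mulr_gt0.
  rewrite yE in hl *.
  (* From $e^{-y}(1 + y) \le 1$ and $(1 - y/2)(1 + y) \ge 1$ for $0 \le y \le 1$. This is the origin
     of the factor one half in the condition on [M]. *)
  have e1 : expR (- y) <= 1 - y / 2.
    have h1 : expR (- y) * expR y = 1 by rewrite expRN mulVf// gt_eqF// expR_gt0.
    have h2 := ler_wpM2l (expR_ge0 (- y)) (expR_ge1Dx y).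
    rewrite -(@ler_pM2r _ (1 + y)); last lra.
    by rewrite h1 in h2; apply: le_trans h2 _; nra.
  have e0 := expR_ge0 (- y).
  have := aL h0 Ox Oxh; rewrite ler_norml => /andP[_ h2].
  have /andP[h3 _] := aK Ox; have vx : 0 < v x by exact: expR_gt0.
  set a' := a _ in h2 *; set e := expR (- y) in e1 e0 *.
  have -> : a' * (lam * (v x * e)) - a x * (lam * v x) =
    (lam * v x) * ((a' - a x) * e + a x * (e - 1)) by ring.
  have h5 : (a' - a x) * e <= L * h.
    apply: (@le_trans _ _ (L * h * e)); first by rewrite ler_wpM2r.
    by rewrite ler_piMr// ?mulr_ge0 ?(ltW h0)//; lra.
  have h6 : a x * (e - 1) <= - (K0 * y / 2).
    have q1 := ler_wpM2l (le_trans (ltW K00) h3) e1.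
    by have := ler_wpM2r (ltW y0) h3; lra.
  apply: (@le_trans _ _ (lam * v x * (L * h - K0 * y / 2))).
    by rewrite ler_wpM2l ?mulr_ge0 ?(ltW lam0) ?(ltW vx)//; lra.
  have -> : lam * v x * (L * h - K0 * y / 2) =
     (lam * L - K0 * lam ^+ 2 / 2) * (v x * h) by rewrite -yE; field.
  by rewrite -[leRHS]mulrA ler_wpM2r ?mulr_ge0 ?(ltW h0) ?(ltW vx)//; lra.
(* The Lipschitz bound needs both the point and its translate in [Omega]. By compactness of the
   support this holds on all of it once the shift is small. *)
have near1 : \forall n \near \oo, forall x, tsupp psi x -> Omega (x - n.+1%:R^-1 *: e_ i0).
  have := tfun_compact tf; rewrite compact_near_coveringP.
  move=> /(_ nat \oo (fun n (x : rV) => Omega (x - n.+1%:R^-1 *: e_ i0)) _).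
  apply => x sx.
  have nx : nbhs x Omega by apply: open_nbhs_nbhs; split => //; exact: tfun_sub tf _ sx.
  have c : (fun p : rV * nat => p.1 - p.2.+1%:R^-1 *: e_ i0) @ (nbhs x, \oo) --> x.
    rewrite -[X in _ --> X]subr0; apply: cvgB; first exact: cvg_fst.
    rewrite -[X in _ --> X](scale0r (e_ i0)); apply: cvgZr_tmp.
    by apply: (cvg_comp snd (fun n => n.+1%:R^-1)); [exact: cvg_snd|exact: cvg_harmonic].
  exact: c Omega nx.
have near2 : \forall n \near \oo, n.+1%:R^-1 * lam <= 1 :> R.
  have c : (fun n => n.+1%:R^-1 * lam) @ \oo --> (0 : R).
    by rewrite -(mul0r lam); apply: cvgMl; exact: cvg_harmonic.
  by have [N HN] := cvg0_le c ltr01; exists N.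
apply: (cvgr_to_le cv); near=> n.
have n1 : n.+1%:R^-1 * lam <= 1 by near: n.
have n2 : forall x, tsupp psi x -> Omega (x - n.+1%:R^-1 *: e_ i0) by near: n.
rewrite -(Rintegral_tfun (Omega := Omega)); last first.
  by move=> x Ox; rewrite (tfunO tf Ox) mulr0.
rewrite -ipZl//.
set Q := fun x : rV => (F (x - n.+1%:R^-1 *: e_ i0) - F x) / n.+1%:R^-1.
have sQ : sqint Q.
  pose P := `|K1 * (lam * expR B)|.
  apply: (@sqint_bounded _ _ _ oO bO _ ((P + P) / n.+1%:R^-1)).
    apply: (@measurable_funS _ _ _ _ setT) => //.
    apply: measurable_funM => //; apply: measurable_funB => //.
    exact: (measurableT_comp mF (measurable_translation (- (n.+1%:R^-1 *: e_ i0)))).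
  move=> x _; rewrite /Q normrM normfV (ger0_norm (_ : 0 <= n.+1%:R^-1))//.
  by rewrite ler_wpM2r// (le_trans (ler_normB _ _))// lerD// /P FB.
apply: (ip_le mO) => //; first exact: sqintZ.
apply: ae_in_all => x Ox.
have [sx|sx] := pselect (tsupp psi x); last by rewrite (tfun_out tf sx) !mulr0.
by rewrite ler_wpM2r//; apply: step => //; exact: n2.
Unshelve. all: by end_near.
Qed.

End barrier.

(** The function $u - \delta v$ is the sum of $u - G$, in $H^1_0$, and of $z = G - \delta v$, which
    is nonnegative and $C^1$ in [Omega]; hence the maximum principle applies to it. The barrier is a
    subsolution because the zeroth-order term [b] is absorbed by the bound [M]. *)
Lemma homogeneous_lower_bound b G gG u gu K2 : bdd b -> ae_in (fun x => 0 <= b x) ->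
  0 < K2 -> (forall x, Omega x -> K2 <= G x) ->
  (forall x, Omega x -> C1at G gG x) -> sqint G -> (forall i, sqint (gG i)) ->
  sol a b (fun=> 0) G gG u gu -> exists kap, 0 < kap /\ ae_in (fun x => kap <= u x).
Proof.
move=> bb b0 K20 GK C1G sG sgG [su wu Wu Lu].
have sgu i : sqint (gu i) by exact: is_wgrad_sqint wu.
have [M [M0 bM]] := bdd_ub bb.
(* With this value $K_0\lambda^2/2 - \lambda L = \lambda(M + 1 + K_0/2)$, which is at least $M$
   because $\lambda \ge 1$. *)
pose lam := 2 * (L + M + 1) / K0 + 1.
have q0 : 0 <= 2 * (L + M + 1) / K0.
  by rewrite divr_ge0 ?(ltW K00)// mulr_ge0// !addr_ge0.
have lam0 : 0 < lam by rewrite ltr_wpDl.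
have lamM : M <= K0 * lam ^+ 2 / 2 - lam * L.
  have -> : K0 * lam ^+ 2 / 2 - lam * L = lam * (M + 1 + K0 / 2).
    by rewrite /lam; field; exact: lt0r_neq0.
  have l1 : 1 <= lam by rewrite lerDr.
  have c0 : 0 <= M + 1 + K0 / 2 by rewrite !addr_ge0// divr_ge0// ltW.
  rewrite -[leLHS]mul1r; apply: ler_pM => //.
  by rewrite -addrA lerDl addr_ge0// divr_ge0// ltW.
have [B hB] := barrier_bounds lam0.
pose v (x : rV) := expR (lam * x 0 i0).
pose gv i (x : rV) := lam * v x * (i == i0)%:R.
have C1v x : C1at v gv x by exact: C1at_barrier.
have mv : measurable_fun Omega v by apply: measurable_fun_open => // x _; have [] := C1v x.
have sv : sqint v.
  apply: (@sqint_bounded _ _ _ oO bO _ (expR B)) => //.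
  by move=> x /hB/andP[_]; rewrite ger0_norm ?expR_ge0.
have sgv i : sqint (gv i).
  have -> : gv i = fun x => (lam * (i == i0)%:R) * v x by apply/funext => x; rewrite /gv; ring.
  exact: sqintZ.
(* As [v] is at most [expR B] on [Omega], this factor keeps [del * v] below [K2], hence below the
   datum. *)
pose del := K2 * expR (- B); have del0 : 0 < del by rewrite mulr_gt0// expR_gt0.
pose z x := G x + (- del) * v x.
pose gz i x := gG i x + (- del) * gv i x.
have C1z x : Omega x -> C1at z gz x.
  move=> Ox; have := C1atD (C1G x Ox) (C1atM (C1at_cst (- del) x) (C1v x)).
  apply: C1at_near; first by near=> y.
  by move=> i; near=> y; rewrite /gz mul0r addr0.
have z0 x : Omega x -> 0 <= z x.
  move=> Ox; have /andP[_ h] := hB x Ox; have := GK x Ox.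
  have h2 : del * v x <= K2.
    rewrite /del -mulrA -[leRHS]mulr1 ler_wpM2l ?(ltW K20)// expRN mulrC.
    by rewrite ler_pdivrMr ?expR_gt0// mul1r.
  by rewrite /z; lra.
have sz : sqint z by apply: sqintD => //; exact: sqintZ.
have sgz i : sqint (gz i) by apply: sqintD => //; exact: sqintZ.
exists (del * expR (- B)); split; first by rewrite mulr_gt0// expR_gt0.
have h := max_principle K00 ba aK' i0 Wu C1z z0 sz sgz bb b0.
have {}h : ae_in (fun x => 0 <= u x - G x + z x).
  apply: h => psi H tf psi0.
  have Wpsi := tfun_W0 tf; have [[spsi sH] _] := Wpsi.
  have -> : (fun i x => gu i x - gG i x + gz i x) = (fun i x => (- del) * gv i x + gu i x).
    by apply/funext => i; apply/funext => x; rewrite /gz; ring.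
  have -> : (fun x => b x * (u x - G x + z x)) = (fun x => (- del) * (b x * v x) + b x * u x).
    by apply/funext => x; rewrite /z; ring.
  have sbv := sqintMl mO bb sv; have sbu := sqintMl mO bb su.
  have e1 := aformP ba (- del) sgv sgu sH.
  rewrite e1 ipDl//; last exact: sqintZ.
  rewrite ipZl//; have := Lu _ _ Wpsi; rewrite (ip0l mO (ae_in_all _ (fun _ _ => erefl)) (sqint0 _ _) spsi).
  have := barrier_subsolution lam0 lamM tf psi0.
  have : ip (fun x => b x * v x) psi <= M * ip v psi.
    rewrite -ipZl//; apply: ip_le => //; first exact: sqintZ.
    apply: (ae_in_imply _ bM) => x _ hb; rewrite ler_wpM2r// ler_wpM2r ?expR_ge0//.
    exact: le_trans (ler_norm _) hb.
  rewrite -/v -/gv => h1 h2 h3.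
  have := ler_wpM2l (ltW del0) h1; have := ler_wpM2l (ltW del0) h2; lra.
apply: (ae_in_imply _ h) => x Ox; have /andP[h1 _] := hB x Ox.
by have := ler_wpM2l (ltW del0) h1; rewrite /z /v; lra.
Unshelve. all: by end_near.
Qed.

End exponential_barrier.

(** * Regularity of the coefficients and of the boundary datum *)

Lemma compact_closure : compact (closure Omega).
Proof.
apply: bounded_closed_compact; last exact: closed_closure.
have [M [_ hM]] := bO; exists (`|M| + 1); split; first exact: num_real.
move=> r rM x clx; apply: (le_trans _ (ltW rM)).
have cl : closed [set y : rV | `|y| <= `|M| + 1].
  apply: (@closed_comp _ _ (fun y : rV => `|y|) [set t | t <= `|M| + 1]).
    by move=> y _; exact: norm_continuous.
  exact: closed_le.
have h : Omega `<=` [set y : rV | `|y| <= `|M| + 1].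
  by move=> y Oy; apply: (hM (`|M| + 1)) => //; rewrite (le_lt_trans (ler_norm M))// ltrDl.
by have := closure_subset h clx; rewrite -((closure_id _).1 cl).
Qed.

Lemma closure_continuous_bounded (h : rV -> R) : {within closure Omega, continuous h} ->
  exists M, forall x, Omega x -> `|h x| <= M.
Proof.
move=> ch; have : compact (h @` closure Omega).
  by apply: continuous_compact => //; exact: compact_closure.
move=> /compact_bounded[M [_ hM]]; exists (`|M| + 1) => x Ox.
apply: (hM (`|M| + 1)); first by rewrite (le_lt_trans (ler_norm M))// ltrDl.
by exists x => //; exact: subset_closure.
Qed.

Lemma closure_continuous_at (h : rV -> R) x : {within closure Omega, continuous h} ->
  Omega x -> {for x, continuous h}.
Proof.
move=> /(continuous_subspaceW (@subset_closure _ Omega)).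
by rewrite continuous_open_subspace// => c Ox; apply: c; rewrite inE.
Qed.

Lemma powR_datum (K0 K1 p : R) (g : rV -> R) : 0 < K0 -> C1_closure Omega g ->
  (forall x, Omega x -> K0 < g x < K1) ->
  exists gG, [/\ forall x, Omega x -> C1at (fun x => g x `^ p) gG x,
    sqint (fun x => g x `^ p) & forall i, sqint (gG i)].
Proof.
move=> K00 [cg /choice[h hh]] gK.
(* The power increases or decreases with its base according to the sign of [q]; the sum of the two
   end values is a bound in both cases. *)
have powB (q : R) x : Omega x -> `|g x `^ q| <= K0 `^ q + K1 `^ q.
  move=> /gK/andP[h1 h2]; have g0 := lt_trans K00 h1.
  rewrite ger0_norm ?powR_ge0//; have [q0|q0] := leP 0 q.
    rewrite (@le_trans _ _ (K1 `^ q))// ?lerDr ?powR_ge0//.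
    by apply: ge0_ler_powR => //; rewrite ?nnegrE ltW// (lt_trans g0).
  rewrite (@le_trans _ _ (K0 `^ q))// ?lerDl ?powR_ge0//.
  by have := @powRN_le _ (- q) _ K0 (g x) K00 (ltW h1); rewrite opprK; apply; rewrite oppr_ge0 ltW.
have cpow (q t : R) : 0 < t -> {for t, continuous (fun s : R => s `^ q)}.
  move=> t0; apply: differentiable_continuous; apply/derivable1_diffP.
  by have [] := is_derive1_powR q t0.
pose gG i x := (p * g x `^ (p - 1)) * h i x.
have C1 x : Omega x -> C1at (fun x => g x `^ p) gG x.
  move=> Ox; have /andP[h1 _] := gK x Ox; have g0 := lt_trans K00 h1.
  apply: (@C1at_comp _ _ (fun t : R => t `^ p) (fun t => p * t `^ (p - 1)) g h x) => //.
  - split; first exact: closure_continuous_at cg Ox.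
    by move=> i; have [ch dh] := hh i; split; [exact: dh|exact: closure_continuous_at ch Ox].
  - exact: is_derive1_powR.
  - exact: cpow.
  - by apply: continuousM; [exact: cst_continuous|exact: cpow].
exists gG; split => // [|i].
  apply: (@sqint_bounded _ _ _ oO bO _ (K0 `^ p + K1 `^ p)) => //; last exact: powB.
  by apply: measurable_fun_open => // x /C1[].
have [M hM] := closure_continuous_bounded (hh i).1.
apply: (@sqint_bounded _ _ _ oO bO _ (`|p| * (K0 `^ (p - 1) + K1 `^ (p - 1)) * M)).
  by apply: measurable_fun_open => // x /C1[_ /(_ i)[]].
move=> x Ox; rewrite /gG !normrM; apply: ler_pM => //; last exact: hM.
by rewrite ler_wpM2l// powB.
Qed.

Lemma lipschitz_bdd a K1 L : (forall x y, Omega x -> Omega y -> `|a x - a y| <= L * `|x - y|) ->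
  (forall x, Omega x -> `|a x| <= K1) -> bdd a.
Proof.
move=> aL aK; split; last by exists K1; exact: ae_in_all.
apply: measurable_fun_open => // x Ox; rewrite /prop_for /continuous_at; apply/(@cvgrPdist_le _ _ _ (nbhs x) _ a) => e e0.
have L1 : 0 < `|L| + 1 by rewrite ltr_wpDl.
have nO : \forall y \near x, Omega y by exact: open_nbhs_nbhs.
have nb : \forall y \near x, `|x - y| <= e / (`|L| + 1).
  apply/nbhs_ballP; exists (e / (`|L| + 1)); first by rewrite /= divr_gt0.
  by move=> y; rewrite -ball_normE => /ltW.
apply: filterS2 nO nb => y Oy; rewrite ler_pdivlMr// => h.
apply: le_trans (aL x y Ox Oy) _; apply: le_trans h.
by rewrite mulrC ler_wpM2l// (le_trans (ler_norm L))// lerDl.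
Qed.

End sobolev.

Unset Implicit Arguments.
Set Strict Implicit.
Set Printing Implicit Defensive.

Theorem theorem5p3 (R : realType) (d : nat) (Omega : set 'rV[R]_d)
    (K0 K1 theta mu : R) (a sigma g c : 'rV[R]_d -> R) :
  let b := fun x => - (2 / (1 + theta)) * mu * sigma x in
  let G := fun x => g x `^ (2 / (1 + theta)) in
  d = 2%N \/ d = 3%N ->
  open Omega -> Omega !=set0 -> bounded_set Omega ->
  simply_connected Omega -> C2_boundary Omega ->
  0 < K0 -> 0 < K1 ->
  [lipschitz a x | x in closure Omega] ->
  (forall x, closure Omega x -> K0 < a x < K1) ->
  Linfty Omega sigma ->
  ae_on Omega (fun x => K0 < sigma x < K1) ->
  C1_closure Omega g ->
  (forall x, closure Omega x -> K0 < g x < K1) ->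
  Linfty Omega c ->
  theta != -1 -> 0 <= theta ->
  ae_on Omega (fun x => 0 <= b x) ->
  ae_on Omega (fun x => c x <= 0) ->
  (* each [the weak solution] exists and is unique up to null sets, and the
     powers in the iteration have positive bases *)
  [/\ exists Psi_, iteration Omega a b c theta G Psi_,
      forall Psi_ Psi'_,
        iteration Omega a b c theta G Psi_ ->
        iteration Omega a b c theta G Psi'_ ->
        forall n, ae_on Omega (fun x => Psi_ n x = Psi'_ n x) &
      forall Psi_, iteration Omega a b c theta G Psi_ ->
        forall n, ae_on Omega (fun x => 0 < Psi_ n x) /\
                  0 < kappa Omega G Psi_ n] /\
  exists Psi : 'rV[R]_d -> R,
    [/\ pos_weak_sol Omega a b c theta G Psi,
        forall Psi', pos_weak_sol Omega a b c theta G Psi' ->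
          ae_on Omega (fun x => Psi' x = Psi x) &
        forall Psi_, iteration Omega a b c theta G Psi_ ->
          H1_cvg Omega Psi_ Psi].

Proof.
move=> b G d23 oO O0 bO _ _ K00 _ alip aK msig _ C1g gK bc _ theta0 b0 c0.
(* Any coordinate will do: [i0] is the direction in which both Poincare's inequality and the barrier
   are taken. *)
have [i0 _] : exists i : 'I_d, true by case: d23 => ->; exists ord0.
have clO x : Omega x -> closure Omega x by exact: subset_closure.
have [L [L0 aL]] : exists L, 0 <= L /\
    forall x y, Omega x -> Omega y -> `|a x - a y| <= L * `|x - y|.
  have [M [_ hM]] := alip; exists (`|M| + 1); split; first by rewrite addr_ge0.
  move=> x y Ox Oy; apply: (hM (`|M| + 1) _ (x, y)); last by split; exact: clO.
  by rewrite (le_lt_trans (ler_norm M))// ltrDl.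
have aK' x : Omega x -> K0 <= a x <= K1.
  by move=> /clO/aK/andP[/ltW -> /ltW ->].
have ba : bdd (lebesgue_rV R d) Omega a.
  apply: (lipschitz_bdd oO aL (K1 := K1)) => x /aK'/andP[h1 h2].
  by rewrite ger0_norm// (le_trans (ltW K00)).
have aK0 : ae_in (lebesgue_rV R d) Omega (fun x => K0 <= a x).
  by apply: ae_in_all => x /aK'/andP[].
have bb : bdd (lebesgue_rV R d) Omega b.
  have -> : b = fun x => sigma x * (- (2 / (1 + theta)) * mu).
    by apply/funext => x; rewrite /b mulrC.
  by apply: bddZ => //; exact: open_measurable_rV.
have gK' x : Omega x -> K0 < g x < K1 by move=> /clO/gK.
have p0 : 0 <= 2 / (1 + theta) by rewrite divr_ge0// addr_ge0.
have [gG [C1G sG sgG]] := powR_datum oO bO (2 / (1 + theta)) K00 C1g gK'.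
have wG := C1_is_wgrad oO bO C1G sG sgG.
pose K2 := K0 `^ (2 / (1 + theta)).
have K20 : 0 < K2 by rewrite powR_gt0.
have GK x : Omega x -> K2 <= G x.
  move=> /gK'/andP[h _]; apply: ge0_ler_powR => //; rewrite ?nnegrE ?(ltW K00)//.
    exact: ltW (lt_trans K00 h).
  exact: ltW.
have GKae : ae_in (lebesgue_rV R d) Omega (fun x => K2 <= G x) by exact: ae_in_all.
pose e0 : 'rV[R]_d := delta_mx 0 i0.
have aLh x h : 0 < h -> Omega x -> Omega (x - h *: e0) ->
    `|a (x - h *: e0) - a x| <= L * `|e0| * h.
  move=> h0 Ox Oxh; apply: le_trans (aL _ _ Oxh Ox) _.
  rewrite addrC addKr normrN normrZ (gtr0_norm h0).
  by rewrite -mulrA (mulrC h).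
have Le0 : 0 <= L * `|e0| by rewrite mulr_ge0.
have lb u gu : sol Omega a b (fun=> 0) G gG u gu ->
    exists kap, 0 < kap /\ ae_in (lebesgue_rV R d) Omega (fun x => kap <= u x).
  exact: (homogeneous_lower_bound oO bO K00 Le0 ba.1 aK' aLh bb b0 K20 GK C1G sG sgG).
have [Psi0 I0] := iteration_exists oO bO K00 ba aK0 i0 bb b0 bc c0 theta0 sG wG lb.
have [w [Sw cw]] := iteration_cvg oO bO K00 ba aK0 i0 bb b0 bc c0 theta0 sG wG O0 K20 GKae lb I0.
have uniq := iteration_unique oO bO K00 ba aK0 i0 bb b0 bc c0 theta0 sG wG lb.
have wuniq u v := @pos_weak_sol_unique _ _ _ oO bO _ _ K00 ba aK0 i0 _ _ _ b0 c0 theta0 G u v.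
split; first split.
- by exists Psi0.
- exact: uniq.
- exact: (iteration_positive oO bO K00 ba aK0 i0 bb b0 bc c0 theta0 sG wG O0 K20 GKae lb).
exists w; split; first exact: Sw.
  by move=> u Su; exact: wuniq Su Sw.
move=> Psi I.
(* Each iteration produces its own limit [v]. Uniqueness identifies it almost everywhere with the
   fixed solution [w], and the convergence is then transferred to that representative. *)
have [v [Sv cv]] := iteration_cvg oO bO K00 ba aK0 i0 bb b0 bc c0 theta0 sG wG O0 K20 GKae lb I.
apply: (H1_cvg_ae oO bO _ _ _ (wuniq _ _ Sv Sw) cv).
- by case: I => I1 I2; case=> [|n]; [case: I1|case: (I2 n)].
- by case: Sv.
- by case: Sw.
Qed.
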